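(* For every $t_0\in[0,T)$, $t_1\in(t_0,T]$ and $\mu_0\in\mathcal W$, $$\mathbf V^+(t_0,\mu_0)=\inf_{P\in\Delta(\mathcal A_x(t_0))}\ \sup_{v\in\mathcal V(t_0)}\mathbf V^+\big(t_1,\mu_{t_1}^{t_0,\mu_0,P,v}\big).$$
   Context: $\mathcal W$ is the set of Borel probability measures on $\mathbb R^N$ with finite second moment. Data. $T>0$; $U,V$ are nonempty compact subsets of finite-dimensional vector spaces; $f:\mathbb R^N\times U\times V\to\mathbb R^N$ is bounded, uniformly continuous, and Lipschitz continuous in $x$ uniformly in $(u,v)$; $g:\mathbb R^N\to\mathbb R$ is bounded and Lipschitz continuous. For $t_0<t_1\le T$, $\mathcal U(t_0,t_1)$ (resp. $\mathcal V(t_0,t_1)$) is the set of Lebesgue measurable maps (modulo a.e. equality) $[t_0,t_1]\to U$ (resp. $[t_0,t_1]\to V$), with the $L^1$ distance and its Borel $\sigma$-algebra; $\mathcal U(t_0)=\mathcal U(t_0,T)$, $\mathcal V(t_0)=\mathcal V(t_0,T)$. $\Delta(\mathcal U(t_0))$ denotes the set of Borel probability measures on $\mathcal U(t_0)$. For $(u,v)\in\mathcal U(t_0)\times\mathcal V(t_0)$, $t\mapsto X_t^{t_0,x,u,v}$ is the solution of $x'(t)=f(x(t),u(t),v(t))$, $x(t_0)=x$. Strategies. A strategy for Player I at time $t_0$ is a map $(x,v)\mapsto P^v_x$ from $\mathbb R^N\times\mathcal V(t_0)$ to $\Delta(\mathcal U(t_0))$, measurable (i.e. $(x,v)\mapsto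 P_x^v(A)$ is Borel measurable for every Borel $A\subset\mathcal U(t_0)$), for which there is a delay $\tau>0$ such that: if $v_1,v_2\in\mathcal V(t_0)$ coincide a.e. on $[t_0,t]$ for some $t\in[t_0,T]$, then for every $x\in\mathbb R^N$ the push-forwards of $P^{v_1}_x$ and $P^{v_2}_x$ under the restriction map $\mathcal U(t_0)\to\mathcal U(t_0,(t+\tau)\wedge T)$ coincide. $\Delta(\mathcal A_x(t_0))$ is the set of all these strategies (the subscript $x$ is only notation). Upper value. $\mathbf V^+(t_0,\mu_0)=\inf_{P\in\Delta(\mathcal A_x(t_0))}\sup_{v\in\mathcal V(t_0)}\int_{\mathbb R^N\times\mathcal U(t_0)}g(X_T^{t_0,x,u,v})\,dP^v_x(u)\,d\mu_0(x)$ for $(t_0,\mu_0)\in[0,T]\times\mathcal W$. Transported measure. For $P\in\Delta(\mathcal A_x(t_0))$ and $v\in\mathcal V(t_0)$, $\mu_{t_1}^{t_0,\mu_0,P,v}\in\mathcal W$ is defined by $\int_{\mathbb R^N}\varphi\,d\mu_{t_1}^{t_0,\mu_0,P,v}=\int_{\mathbb R^N\times\mathcal U(t_0)}\varphi(X_{t_1}^{t_0,x,u,v})\,dP^v_x(u)\,d\mu_0(x)$ for all bounded continuous $\varphi:\mathbb R^N\to\mathbb R$. *)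

(* Defs.v *)
From HB Require Import structures.
From mathcomp Require Import all_boot all_order all_algebra generic_quotient.
From mathcomp Require Import all_classical all_reals all_analysis.
From mathcomp Require Import measurable_realfun.

Set Implicit Arguments.
Unset Strict Implicit.
Unset Printing Implicit Defensive.

Import Order.TTheory GRing.Theory Num.Theory.
Import numFieldNormedType.Exports.

Local Open Scope classical_set_scope.
Local Open Scope ring_scope.

Notation borelType T := (g_sigma_algebraType (@open T)).

(* The real line with the sigma-algebra of Lebesgue measurable sets. *)
Notation lebesgueType R :=
  (caratheodory_type (wlength (idfun : R -> R))^*%mu).

Definition leb {R : realType} : {measure set (lebesgueType R) -> \bar R} :=
  completed_lebesgue_measure.

Section controls.
Context {R : realType}.

Record control_set (p : nat) := ControlSet {
  control_values :> set 'rV[R]_p;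
  control_values_nonempty : control_values !=set0;
  control_values_compact : compact control_values }.

(* A control on [t0, t1] is represented by a function on the whole real line,
   whose values outside [t0, t1] are irrelevant (see [control_eqv]). *)
Definition is_control {p} (U : set 'rV[R]_p) (t0 t1 : R) (u : R -> 'rV[R]_p) :=
  measurable_fun (`[t0, t1]%classic : set (lebesgueType R))
    (u : lebesgueType R -> borelType 'rV[R]_p) /\
  (forall t, t \in `[t0, t1] -> U (u t)).

Definition control_fun {p} (U : control_set p) (t0 t1 : R) :=
  {u : R -> 'rV[R]_p | `[< is_control U t0 t1 u >]}.

Definition coincide {p} (t0 t1 : R) (u v : R -> 'rV[R]_p) : Prop :=
  ae_eq (@leb R) (`[t0, t1]%classic : set (lebesgueType R)) u v.

Definition control_eqv {p} (U : control_set p) (t0 t1 : R)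
  (u v : control_fun U t0 t1) : bool := `[< coincide t0 t1 (val u) (val v) >].

Lemma control_eqv_refl p (U : control_set p) t0 t1 :
  reflexive (@control_eqv p U t0 t1).
Proof. by move=> u; apply/asboolP; exact: nearW. Qed.

Lemma control_eqv_sym p (U : control_set p) t0 t1 :
  symmetric (@control_eqv p U t0 t1).
Proof.
by move=> u v; apply/idP/idP => /asboolP h; apply/asboolP;
  apply: filterS h => t + tI => /(_ tI).
Qed.

Lemma control_eqv_trans p (U : control_set p) t0 t1 :
  transitive (@control_eqv p U t0 t1).
Proof.
move=> v u w /asboolP h1 /asboolP h2; apply/asboolP.
by apply: filterS2 h1 h2 => t + + tI => /(_ tI) -> /(_ tI).
Qed.

Canonical control_eqv_equiv p (U : control_set p) t0 t1 :=
  EquivRel (@control_eqv p U t0 t1)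
    (@control_eqv_refl p U t0 t1) (@control_eqv_sym p U t0 t1)
    (@control_eqv_trans p U t0 t1).

Local Open Scope quotient_scope.

Definition control {p} (U : control_set p) (t0 t1 : R) : Type :=
  {eq_quot (@control_eqv p U t0 t1)}.

HB.instance Definition _ p (U : control_set p) t0 t1 :=
  Choice.on (control U t0 t1).
HB.instance Definition _ p (U : control_set p) t0 t1 :=
  EqQuotient.on (control U t0 t1).

Definition control_repr {p} {U : control_set p} {t0 t1 : R}
  (u : control U t0 t1) : R -> 'rV[R]_p := val (repr u).
Coercion control_repr : control >-> Funclass.

Lemma control_reprP p (U : control_set p) t0 t1 (u : control U t0 t1) :
  is_control U t0 t1 u.
Proof. exact/asboolP/(valP (repr u)). Qed.

Definition control_mk {p} {U : control_set p} {t0 t1 : R} (u : R -> 'rV[R]_p)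
    (uU : is_control U t0 t1 u) : control U t0 t1 :=
  \pi_(control U t0 t1) (exist _ u (asboolT uU) : control_fun U t0 t1).

Lemma control_mkK p (U : control_set p) t0 t1 (u : R -> 'rV[R]_p)
  (uU : is_control U t0 t1 u) : coincide t0 t1 (control_mk uU) u.
Proof.
have : repr (control_mk uU) ==
    (exist _ u (asboolT uU) : control_fun U t0 t1) %[mod control U t0 t1].
  by rewrite reprK.
by rewrite eqmodE => /asboolP.
Qed.

Lemma control_inj p (U : control_set p) t0 t1 (u v : control U t0 t1) :
  coincide t0 t1 u v -> u = v.
Proof.
move=> uv; rewrite -[u]reprK -[v]reprK; apply/eqP.
by rewrite eqmodE; apply/asboolP.
Qed.

Lemma is_control_cst p (U : control_set p) t0 t1 :
  is_control U t0 t1 (cst (xget 0 U)).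
Proof.
split; first exact: measurable_cst.
by move=> t _ /=; have [a Ua] := control_values_nonempty U; apply: xgetI Ua.
Qed.

HB.instance Definition _ p (U : control_set p) t0 t1 :=
  isPointed.Build (control U t0 t1) (control_mk (is_control_cst U t0 t1)).

Definition L1_dist {p} {U : control_set p} {t0 t1 : R}
    (u v : control U t0 t1) : R :=
  \int[@leb R]_(t in `[t0, t1]) `|u t - v t|.

Lemma measurable_leb (A : set R) :
  measurable (A : set (measurableTypeR R)) ->
  measurable (A : set (lebesgueType R)).
Proof. exact: sub_caratheodory. Qed.

Lemma leb_itv_lty (t0 t1 : R) :
  (leb (`[t0, t1]%classic : set (lebesgueType R)) < +oo)%E.
Proof.
have -> : leb (`[t0, t1]%classic : set (lebesgueType R)) =
    lebesgue_measure `[t0, t1]%classic by [].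
by rewrite lebesgue_measure_itv/=; case: ifP => // _; rewrite -EFinB ltry.
Qed.

Lemma measurable_coord n (i : 'I_n) :
  measurable_fun setT ((fun x => x 0 i) : borelType 'rV[R]_n -> R).
Proof.
apply: (measurability _ (RGenOInfty.measurableE R)) => _ [_ [a ->] <-].
rewrite setTI; apply: sub_sigma_algebra.
move: (@coord_continuous R 1 n 0 i) => /continuousP; apply.
by rewrite set_itvoy; exact: open_gt.
Qed.

Lemma measurable_normB d (T : measurableType d) n (D : set T)
    (u v : T -> borelType 'rV[R]_n) :
  measurable_fun D u -> measurable_fun D v ->
  measurable_fun D (fun t => `|(u t : 'rV[R]_n) - v t|).
Proof.
move=> mu mv.
have -> : (fun t => `|(u t : 'rV[R]_n) - v t|) =
    fun t => \big[Num.max/0]_(ij : 'I_1 * 'I_n)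
      `|(u t : 'rV[R]_n) 0 ij.2 - (v t : 'rV[R]_n) 0 ij.2|.
  apply/funext => t; rewrite /Num.norm/= mx_normrE; apply: eq_bigr => -[i j] _.
  by rewrite !mxE ord1.
elim: (index_enum _) => [|ij s ih].
  by under eq_fun do rewrite big_nil; exact: measurable_cst.
under eq_fun do rewrite big_cons.
apply: measurable_maxr ih; apply: measurableT_comp => //.
apply: measurable_funB.
  exact: (measurableT_comp (measurable_coord ij.2) mu).
exact: (measurableT_comp (measurable_coord ij.2) mv).
Qed.

Lemma L1_dist_integrable p (U : control_set p) t0 t1 (u v : control U t0 t1) :
  (@leb R).-integrable (`[t0, t1]%classic : set (lebesgueType R))
    (EFin \o (fun t => `|u t - v t|)).
Proof.
have [mu Uu] := control_reprP u; have [mv Uv] := control_reprP v.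
apply: measurable_bounded_integrable.
- by apply: measurable_leb; exact: measurable_itv.
- exact: leb_itv_lty.
- exact: measurable_normB.
have [M [_ UM]] := compact_bounded (@control_values_compact _ U).
exists (2 * (M + 1)); split=> [|N MN]; first exact: num_real.
move=> t /= tI; rewrite normr_id.
apply: le_trans (ler_normB _ _) _; apply: le_trans (ltW MN).
by rewrite mulr_natl mulr2n lerD//; apply: UM; rewrite ?ltrDl//; auto.
Qed.

Lemma L1_distxx p (U : control_set p) t0 t1 (u : control U t0 t1) :
  L1_dist u u = 0.
Proof.
rewrite /L1_dist; under eq_Rintegral do rewrite subrr normr0.
by rewrite Rintegral_cst ?mul0r//; apply: measurable_leb; exact: measurable_itv.
Qed.

Lemma L1_dist_positivity p (U : control_set p) t0 t1 (u v : control U t0 t1) :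
  L1_dist u v = 0 -> u = v.
Proof.
have uvi := L1_dist_integrable u v.
move=> uv0; apply: control_inj.
have mD : measurable (`[t0, t1]%classic : set (lebesgueType R)).
  by apply: measurable_leb; exact: measurable_itv.
have := (ae_eq_integral_abs leb mD (measurable_int _ uvi)).1.
move=> /(_ _)/wrap[].
  under eq_integral do rewrite /= normr_id.
  rewrite -[LHS]fineK; first by rewrite [fine _]uv0.
  exact: integrable_fin_num.
apply: filterS => t /= + tI => /(_ tI) [] /eqP.
by rewrite normr_eq0 subr_eq0 => /eqP.
Qed.

Lemma L1_dist_sym p (U : control_set p) t0 t1 (u v : control U t0 t1) :
  L1_dist u v = L1_dist v u.
Proof. by apply: eq_Rintegral => t _; rewrite distrC. Qed.

Lemma L1_dist_triangle p (U : control_set p) t0 t1 (v u w : control U t0 t1) :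
  L1_dist u w <= L1_dist u v + L1_dist v w.
Proof.
have mD : measurable (`[t0, t1]%classic : set (lebesgueType R)).
  by apply: measurable_leb; exact: measurable_itv.
rewrite -RintegralD//; try exact: L1_dist_integrable.
apply: le_Rintegral => //; first exact: L1_dist_integrable.
  exact: (integrableD mD (L1_dist_integrable u v) (L1_dist_integrable v w)).
by move=> t _; exact: ler_distD.
Qed.

HB.instance Definition _ p (U : control_set p) t0 t1 :=
  isMetric.Build R (control U t0 t1) (@L1_distxx p U t0 t1)
    (@L1_dist_positivity p U t0 t1) (@L1_dist_sym p U t0 t1)
    (@L1_dist_triangle p U t0 t1).

Lemma is_control_restrict p (U : set 'rV[R]_p) (t0 s t1 : R)
  (u : R -> 'rV[R]_p) : s <= t1 -> is_control U t0 t1 u -> is_control U t0 s u.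
Proof.
move=> st1 [mu Uu]; have sub : `[t0, s] `<=` `[t0, t1].
  by apply: subset_itv; rewrite bnd_simp.
split=> [|t /sub]; last exact: Uu.
apply: measurable_funS mu => //.
by apply: measurable_leb; exact: measurable_itv.
Qed.

Definition control_restrict {p} {U : control_set p} {t0 t1 : R} (s : R)
    (st1 : s <= t1) (u : control U t0 t1) : control U t0 s :=
  control_mk (is_control_restrict st1 (control_reprP u)).

End controls.

Arguments control_set : clear implicits.

Section game.
Context {R : realType} {N p q : nat}.
Variables (T : R) (U : control_set R p) (V : control_set R q).
Variables (f : 'rV[R]_N -> 'rV[R]_p -> 'rV[R]_q -> 'rV[R]_N) (g : 'rV[R]_N -> R).

Notation stateT := (borelType 'rV[R]_N).

(* Caratheodory solution of x' = f(x, u, v), x(t0) = x, in integral form. *)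
Definition is_trajectory (t0 : R) (x : 'rV[R]_N) (u : control U t0 T)
    (v : control V t0 T) (y : R -> 'rV[R]_N) : Prop :=
  {within `[t0, T], continuous y} /\
  forall t, t \in `[t0, T] ->
    y t = x + \row_i \int[@leb R]_(s in `[t0, t]) f (y s) (u s) (v s) 0 i.

(* The values on [t0, T] are those of the solution, which exists and is unique
   when f is bounded, continuous, and Lipschitz in its first variable. *)
Definition trajectory (t0 : R) (x : 'rV[R]_N) (u : control U t0 T)
    (v : control V t0 T) : R -> 'rV[R]_N :=
  xget (cst x) [set y | is_trajectory x u v y].

(* On R^N x V(t0) the product sigma-algebra is the Borel one, since both factors
   are separable metric spaces. *)
Notation kernel_at t0 :=
  (R.-pker (stateT * borelType (control V t0 T)) ~>
     borelType (control U t0 T)).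

Definition has_delay (t0 tau : R) (P : kernel_at t0) : Prop :=
  forall (t : R) (v1 v2 : control V t0 T),
    t \in `[t0, T] -> coincide t0 t v1 v2 ->
  forall (le_T : Num.min (t + tau) T <= T) (x : 'rV[R]_N),
    let restr : borelType (control U t0 T) ->
                borelType (control U t0 (Num.min (t + tau) T)) :=
      control_restrict le_T in
  forall A, measurable A ->
    pushforward (P (x, v1)) restr A = pushforward (P (x, v2)) restr A.

Definition strategy (t0 : R) : set (kernel_at t0) :=
  [set P | exists2 tau : R, 0 < tau & has_delay tau P].

Definition integral_at (t0 : R) (mu0 : probability stateT R) (P : kernel_at t0)
    (v : control V t0 T) (t : R) (phi : 'rV[R]_N -> R) : \bar R :=
  (\int[mu0]_x \int[P (x, v)]_u (phi (trajectory x u v t))%:E)%E.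

Definition upper_value (t0 : R) (mu0 : probability stateT R) : \bar R :=
  ereal_inf [set ereal_sup
      [set integral_at mu0 P v T g | v in [set: control V t0 T]]
    | P in @strategy t0].

(* [`|x|] is the sup norm on R^N. *)
Definition finite_second_moment : set (probability stateT R) :=
  [set mu : probability stateT R |
    (\int[mu]_x (`|x : 'rV[R]_N| ^+ 2)%:E < +oo)%E].

(* The default value mu0 is never used when f is as in the comment on
   [trajectory], P is a strategy and mu0 has a finite second moment. *)
Definition transported (t0 t1 : R) (mu0 : probability stateT R)
    (P : kernel_at t0) (v : control V t0 T) : probability stateT R :=
  xget mu0 [set mu : probability stateT R | finite_second_moment mu /\
    forall phi : 'rV[R]_N -> R, continuous phi -> bounded_fun phi ->
      (\int[mu]_x (phi x)%:E)%E = integral_at mu0 P v t1 phi].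

End game.

(* Main.v *)
Require Import Defs.
From HB Require Import structures.
From mathcomp Require Import all_boot all_order all_algebra.
From mathcomp Require Import all_classical all_reals all_analysis.
From mathcomp Require Import measurable_realfun ring lra.

Set Implicit Arguments.
Unset Strict Implicit.
Unset Printing Implicit Defensive.

Import Order.TTheory GRing.Theory Num.Theory.
Import numFieldNormedType.Exports.

Local Open Scope classical_set_scope.
Local Open Scope ring_scope.

(** A strategy that is nearly optimal from time [t1] on depends on the law of the
    state at [t1], hence on the past of Player II, and it would have to be chosen
    measurably. The proof chooses among finitely many strategies instead.

    The state space is cut into finitely many Borel cells of size about [delta],
    up to a set of small probability: one large ball works for all strategies and
    all controls, because the state travels at bounded speed ([good_cells]). The
    flow is Lipschitz in the state, so that only the cell of the state matters, up
    to a small error. A family of kernels [Q i], one per cell, each of them mapping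
    the control of Player II after [t1] to a law on the controls of Player I after
    [t1], has a payoff equal to the sum over the cells of the probability of the
    cell times the payoff from its centre ([cell_payoff]). Two lemmas translate
    between strategies and such families. By [discretize], a strategy with payoff
    at most [a] against all controls gives, once the control of Player II is fixed
    up to [t1], a family with payoff at most [a] plus an error: condition the play
    after [t1] on the cell of the state at [t1]. By [assemble], a family gives a
    strategy starting at [t1].

    The right-hand side is at most the upper value: discretize a strategy [P]
    along a control [v0], then assemble at [t1] ([dpp_ge_cells]).

    For the converse let [P] be such that the upper value at [t1] of the measure
    transported by [P] and [v] is at most [a] for all [v]. The probabilities of the
    cells are located on a grid of step 1 / n, which distinguishes finitely many
    codes of controls. For each code a control that has it is selected, and a
    near-optimal strategy for its transported measure is discretized into a family
    of kernels ([near_optimal]). Player I plays [P] and, from [t1] on, the kernel of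
    the current code and cell. Code and cell depend on the control of Player II up
    to [t1], and a strategy must react with a delay: so Player I plays against
    the control of Player II frozen at t1 - tau, which displaces the state at [t1]
    by at most 2 M tau ([glue_strategy], [dpp_le_cells]).

    Adding a constant to [g] shifts both sides, so that [g] may be assumed to be
    nonnegative ([upper_value_shift]).

    The measurability of these constructions rests on two facts. The controls form
    a separable space for the L1 distance ([separable_control]), so that Borel maps
    can be tested on balls and the trajectory, which is continuous in the state and
    the two controls, is a Borel map of any measurable data ([trajectory_continuous],
    [measurable_trajectory]). The transported measure is the law of the state,
    because bounded continuous functions separate measures ([transportedE]). *)

(** * Borel maps into separable pseudometric spaces *)

(* These types have a point and a pseudometric; their join is declared here so
   that they can carry Borel sets and balls at the same time. *)
HB.instance Definition _ (R : realType) (T1 T2 : pseudoPMetricType R) :=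
  PseudoMetric.on (T1 * T2)%type.

HB.instance Definition _ (R : realType) n :=
  PseudoMetric.on 'rV[R]_n.

Section separable_borel.
Context {R : realType}.

Definition separable (T : pseudoPMetricType R) :=
  exists d : nat -> T, forall x e, 0 < e -> exists n, ball (d n) e x.

(** The balls of radius 1 / (m + 1) around the dense sequence that fit into [O]
    already cover it. *)
Lemma open_bigcup_ball (T : pseudoPMetricType R) (d : nat -> T) (O : set T) :
  (forall x e, 0 < e -> exists n, ball (d n) e x) -> open O ->
  O = \bigcup_n \bigcup_(m in [set m | ball (d n) m.+1%:R^-1 `<=` O])
        ball (d n) m.+1%:R^-1.
Proof.
move=> dP oO; apply/seteqP; split=> [x Ox|x [n _ [m mO]]]; last exact: mO.
have /nbhs_ballP[e /= e0 eO] : nbhs x O by exact: open_nbhs_nbhs.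
have [m me] := @ltr_add_invr R 0 (e / 2) ltac:(by rewrite divr_gt0).
rewrite add0r in me.
have [n xn] := dP x m.+1%:R^-1 ltac:(by rewrite invr_gt0).
exists n => //; exists m => //= y ny; apply: eO.
rewrite [e]splitr; apply: (@ball_triangle _ _ (d n)).
  by apply: (le_ball (ltW me)); exact: ball_sym.
exact: (le_ball (ltW me)).
Qed.

Lemma measurable_fun_open (T : pseudoPMetricType R) d (S : measurableType d)
    (D : set S) (h : S -> T) :
  (forall A, open A -> measurable (D `&` h @^-1` A)) ->
  measurable_fun D (h : S -> borelType T).
Proof.
move=> mh.
have E : @measurable _ (borelType T) = <<s @open T >> by [].
by apply: (@measurability _ _ S (borelType T) D h _ E) => _ [A oA <-]; exact: mh.
Qed.

(** Open sets are countable unions of balls by [open_bigcup_ball], so that balls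
    generate the Borel sets. *)
Lemma measurable_fun_balls (T : pseudoPMetricType R) d (S : measurableType d)
    (D : set S) (s : nat -> T) (h : S -> T) :
  (forall x e, 0 < e -> exists n, ball (s n) e x) ->
  (forall n r, measurable (D `&` h @^-1` ball (s n) r)) ->
  measurable_fun D (h : S -> borelType T).
Proof.
move=> sP mh; apply: measurable_fun_open => A oA.
rewrite (open_bigcup_ball sP oA) preimage_bigcup setI_bigcupr.
apply: bigcupT_measurable => n.
rewrite preimage_bigcup setI_bigcupr.
apply: bigcup_measurable => m _; exact: mh.
Qed.

Lemma open_borel (T : pseudoPMetricType R) (O : set T) :
  open O -> measurable (O : set (borelType T)).
Proof. by move=> oO; apply: sub_sigma_algebra. Qed.

Lemma measurable_ball (T : pseudoPMetricType R) d (S : measurableType d)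
    (D : set S) (h : S -> T) x r : measurable D ->
  measurable_fun D (h : S -> borelType T) -> open (ball x r) ->
  measurable (D `&` h @^-1` ball x r).
Proof. by move=> mD mh o; apply: mh => //; exact: open_borel. Qed.

Lemma separable_prod (T1 T2 : pseudoPMetricType R) :
  separable T1 -> separable T2 -> separable (T1 * T2)%type.
Proof.
move=> [d1 h1] [d2 h2].
exists (fun n => if unpickle n is Some (i, j) then (d1 i, d2 j) else (d1 0, d2 0)).
move=> [x y] e e0; have [i xi] := h1 x e e0; have [j yj] := h2 y e e0.
by exists (pickle (i, j)); rewrite pickleK.
Qed.

(** The Borel sets of a product are generated by products of balls only thanks to
    separability. The balls of a pseudometric space need not be open. *)
Lemma measurable_fun_pair_borel (T1 T2 : pseudoPMetricType R)
    d (S : measurableType d) (D : set S) (h1 : S -> T1) (h2 : S -> T2) :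
  (forall (x : T1) r, open (ball x r)) -> (forall (x : T2) r, open (ball x r)) ->
  separable T1 -> separable T2 -> measurable D ->
  measurable_fun D (h1 : S -> borelType T1) ->
  measurable_fun D (h2 : S -> borelType T2) ->
  measurable_fun D ((fun s => (h1 s, h2 s)) : S -> borelType (T1 * T2)%type).
Proof.
move=> o1 o2 s1 s2 mD m1 m2.
have [s sP] := separable_prod s1 s2.
apply: (measurable_fun_balls sP) => n r.
rewrite (_ : _ `&` _ = (D `&` h1 @^-1` ball (s n).1 r) `&`
    (D `&` h2 @^-1` ball (s n).2 r)); last first.
  by apply/seteqP; split => z /=; [move=> [? []]|move=> [[? ?] [? ?]]].
by apply: measurableI; apply: measurable_ball.
Qed.

Lemma continuous_borel (T1 T2 : pseudoPMetricType R) (h : T1 -> T2) :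
  continuous h -> measurable_fun setT (h : borelType T1 -> borelType T2).
Proof.
move=> ch; apply: measurable_fun_open => A oA.
by rewrite setTI; apply: open_borel; move/continuousP : ch; exact.
Qed.

Lemma continuous_borel_real (T1 : pseudoPMetricType R) (h : T1 -> R) :
  continuous h -> measurable_fun setT (h : borelType T1 -> measurableTypeR R).
Proof.
move=> ch; apply: (measurability _ (RGenOInfty.measurableE R)) => _ [_ [a ->] <-].
rewrite setTI; apply: open_borel; move/continuousP : ch; apply.
by rewrite set_itvoy; exact: open_gt.
Qed.

Lemma lipschitz_metric_continuous (T : metricType R) (h : T -> R) :
  (forall x y, `|h x - h y| <= mdist x y) -> continuous h.
Proof.
move=> hl x; apply/cvgrPdist_lt => e e0; apply/nbhs_ballP; exists e => //= y.
by rewrite ballEmdist/=; apply: le_lt_trans.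
Qed.

Lemma uniformly_continuous_real (T : pseudoPMetricType R) (h : T -> R) :
  (forall e, 0 < e -> exists2 d, 0 < d &
     forall x y, ball x d y -> `|h x - h y| < e) -> continuous h.
Proof.
move=> hu x; apply/cvgrPdist_lt => e e0; have [d d0 hd] := hu e e0.
by apply/nbhs_ballP; exists d => //= y; exact: hd.
Qed.

Lemma metric_ball_open (T : metricType R) (x : T) r : open (ball x r).
Proof.
rewrite openE => y; rewrite ballEmdist/= => xy.
apply/nbhs_ballP; exists (r - mdist x y) => /=; first by rewrite subr_gt0.
move=> z; rewrite !ballEmdist/= ltrBrDl.
by apply: le_lt_trans; exact: metric_triangle.
Qed.

Lemma rV_ball_open n (x : 'rV[R]_n) r : open (ball x r).
Proof. exact: ball_open. Qed.

Lemma prod_ball_open (T1 T2 : pseudoPMetricType R) :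
  (forall (x : T1) r, open (ball x r)) -> (forall (x : T2) r, open (ball x r)) ->
  forall (x : T1 * T2) r, open (ball x r).
Proof.
move=> o1 o2 x r.
have -> : ball x r = (fst @^-1` ball x.1 r) `&` (snd @^-1` ball x.2 r) by [].
apply: openI.
  by apply: open_comp (o1 _ _) => z _; exact: cvg_fst.
by apply: open_comp (o2 _ _) => z _; exact: cvg_snd.
Qed.

Lemma separable_rV n : separable 'rV[R]_n.
Proof.
exists (fun k => if unpickle k is Some q then
   \row_i ratr ((q : {ffun 'I_n -> rat}) i) else 0).
move=> x e e0.
have H i : exists q : rat, ball (x 0 i) e (ratr q).
  have [r [/= xr [q _ qr]]] := @dense_rat R (ball (x 0 i) e)
    ltac:(by exists (x 0 i); exact: ballxx) (@ball_open _ _ (x 0 i) e).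
  by exists q; rewrite qr.
pose q := [ffun i => projT1 (cid (H i))].
exists (pickle q); rewrite pickleK; split=> // i j.
rewrite (ord1 i) mxE; apply: ball_sym; rewrite ffunE; exact: projT2 (cid (H j)).
Qed.

(** A ball for the sup norm is a finite intersection of conditions on the
    coordinates. *)
Lemma measurable_fun_rV n d (S : measurableType d) (D : set S) (h : S -> 'rV[R]_n) :
  measurable D -> (forall i, measurable_fun D (fun s => h s 0 i)) ->
  measurable_fun D (h : S -> borelType 'rV[R]_n).
Proof.
move=> mD mh; have [s sP] := separable_rV n.
apply: (measurable_fun_balls sP) => k r.
have [r0|r0] := ltP 0 r; last first.
  rewrite (_ : _ `&` _ = set0)//; apply/seteqP; split=> // z [_ [r1 _]].
  by move: (lt_le_trans r1 r0); rewrite ltxx.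
rewrite (_ : _ `&` _ = D `&` \bigcap_(i in [set: 'I_n])
   (D `&` (fun z => h z 0 i) @^-1` ball (s k 0 i) r)); last first.
  apply/seteqP; split => z /= [Dz hz]; split=> //.
    by move=> i _; split=> //; exact: hz.2.
  by split=> // i j; rewrite (ord1 i); exact: (hz j I).2.
apply: measurableI => //; apply: fin_bigcap_measurable => // i _.
by apply: mh => //; apply: open_measurable; exact: ball_open.
Qed.

End separable_borel.

Lemma integral_affine_indic d (T : measurableType d) (R : realType)
    (mu : {measure set T -> \bar R}) (D A : set T) (a b : R) :
  measurable D -> measurable A -> 0 <= a -> 0 <= b ->
  (\int[mu]_(x in D) (a%:E + b%:E * (\1_A x)%:E) =
   a%:E * mu D + b%:E * mu (A `&` D))%E.
Proof.
move=> mD mA a0 b0.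
have m1 : measurable_fun D (EFin \o (\1_A : T -> R)).
  exact/measurable_EFinP/measurable_indic.
rewrite ge0_integralD//; last 2 first.
- by move=> x _; rewrite mule_ge0// lee_fin.
- exact: measurable_funeM.
by rewrite integral_cst// ge0_integralZl// integral_indic.
Qed.

(** Continuity of [phi] relative to [Q] is enough when [h] takes its values in
    [Q]. This serves for the field f, which is continuous only where the controls
    take their values: the preimage of an open half-line under [phi] is the trace
    on [Q] of the open set [W]. *)
Lemma measurable_fun_comp_within (R : realType) (Z : pseudoPMetricType R) d
    (S : measurableType d) (D : set S) (Q : set Z) (h : S -> Z) (phi : Z -> R) :
  measurable D -> (forall (z : Z) r, open (ball z r)) ->
  (forall z e, Q z -> 0 < e -> exists2 r, 0 < r &
     forall z', Q z' -> ball z r z' -> `|phi z - phi z'| < e) ->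
  (forall s, D s -> Q (h s)) ->
  measurable_fun D (h : S -> borelType Z) ->
  measurable_fun D (phi \o h : S -> measurableTypeR R).
Proof.
move=> mD ob cphi hQ mh.
apply: (measurability _ (RGenOInfty.measurableE R)) => _ [_ [a ->] <-].
pose good (zr : Z * R) := Q zr.1 /\
  forall z', Q z' -> ball zr.1 zr.2 z' -> a < phi z'.
pose W := \bigcup_(zr in good) ball zr.1 zr.2.
have oW : open W by apply: bigcup_open => zr _; exact: ob.
rewrite (_ : _ `&` _ = D `&` h @^-1` W).
  by apply: mh => //; exact: open_borel.
apply/seteqP; split=> s /= [Ds].
  rewrite in_itv/= andbT => as_; split => //.
  have [r r0 hr] := cphi (h s) (phi (h s) - a) (hQ s Ds) ltac:(by rewrite subr_gt0).
  exists (h s, r) => /=; last exact: ballxx.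
  split=> [|z' Qz' bz']; first exact: hQ.
  have := hr z' Qz' bz'; rewrite ltr_norml => /andP[_].
  by rewrite ltrD2l ltrN2.
move=> [zr [Qz gz] bz]; split => //; rewrite in_itv/= andbT.
by apply: gz => //; exact: hQ.
Qed.

(** * Almost everywhere equality and pasting of controls *)

Section control_ops.
Context {R : realType}.
Notation LT := (lebesgueType R).

Lemma measurable_lebI (s t : R) : measurable (`[s, t]%classic : set LT).
Proof. by apply: measurable_leb; exact: measurable_itv. Qed.

Lemma coincide_refl p s t (a : R -> 'rV[R]_p) : coincide s t a a.
Proof. exact: nearW. Qed.

Lemma coincide_sym p s t (a b : R -> 'rV[R]_p) :
  coincide s t a b -> coincide s t b a.
Proof. by apply: filterS => x /[apply]. Qed.

Lemma coincide_trans p s t (b a c : R -> 'rV[R]_p) :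
  coincide s t a b -> coincide s t b c -> coincide s t a c.
Proof. by apply: filterS2 => x h1 h2 sx; rewrite h1// h2. Qed.

Lemma coincide_sub p s t s' t' (a b : R -> 'rV[R]_p) : s <= s' -> t' <= t ->
  coincide s t a b -> coincide s' t' a b.
Proof.
move=> ss tt; apply: filterS => x + sx; apply.
by apply: (subset_itv _ _ sx); rewrite bnd_simp.
Qed.

Lemma coincide_ext p s t (a b : R -> 'rV[R]_p) :
  (forall x, s <= x <= t -> a x = b x) -> coincide s t a b.
Proof. by move=> ab; apply: nearW => x /=; rewrite in_itv/= => /ab. Qed.

Lemma coincide_cat p s r t (a b : R -> 'rV[R]_p) :
  coincide s r a b -> coincide r t a b -> coincide s t a b.
Proof.
apply: filterS2 => x h1 h2 /=; rewrite in_itv/= => /andP[sx xt].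
have [xr|rx] := leP x r; [apply: h1|apply: h2]; rewrite /= in_itv/=.
  by rewrite sx.
by rewrite (ltW rx).
Qed.

Lemma leb_set1 (x : R) : leb ([set x] : set LT) = 0%E.
Proof.
have -> : leb ([set x] : set LT) = lebesgue_measure [set x] by [].
by rewrite lebesgue_measure_set1.
Qed.

Lemma measurable_leb1 (x : R) : measurable ([set x] : set LT).
Proof. by apply: measurable_leb; exact: measurable_set1. Qed.

Lemma coincide_catr p s r t (a b : R -> 'rV[R]_p) :
  (forall x, s <= x < r -> a x = b x) -> coincide r t a b -> coincide s t a b.
Proof.
move=> h1; apply: filterS => x h2 /=; rewrite in_itv/= => /andP[sx xt].
have [xr|rx] := ltP x r; first by apply: h1; rewrite sx.
by apply: h2; rewrite /= in_itv/= rx.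
Qed.

Lemma coincide_point p s t (a b : R -> 'rV[R]_p) : t <= s -> coincide s t a b.
Proof.
move=> ts; exists [set s]; split => /=.
- exact: measurable_leb1.
- exact: leb_set1.
- move=> x /= /not_implyP[]; rewrite in_itv/= => /andP[sx xt] _.
  by apply/eqP; rewrite eq_le sx (le_trans xt ts).
Qed.

Lemma Rintegral_leb_set1 (x : R) (h : R -> R) :
  measurable_fun ([set x] : set LT) h ->
  \int[@leb R]_(y in ([set x] : set LT)) h y = 0.
Proof.
move=> mh; rewrite /Rintegral null_set_integral ?fine0//.
- exact: measurable_leb1.
- exact/measurable_EFinP.
- exact: leb_set1.
Qed.

Lemma Rintegral_leb_cat s r t (h : R -> R) : s <= r <= t ->
  (@leb R).-integrable (`[s, t]%classic : set LT) (EFin \o h) ->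
  \int[@leb R]_(x in (`[s, t]%classic : set LT)) h x =
  \int[@leb R]_(x in (`[s, r]%classic : set LT)) h x +
  \int[@leb R]_(x in (`[r, t]%classic : set LT)) h x.
Proof.
move=> /andP[sr rt] ih.
have E : (`[s, t]%classic : set LT) = (`[s, r]%classic `|` `]r, t]%classic).
  by rewrite -itv_bndbnd_setU// bnd_simp.
have mr : measurable (`]r, t]%classic : set LT).
  by apply: measurable_leb; exact: measurable_itv.
rewrite E Rintegral_setU//; last 3 first.
- exact: measurable_lebI.
- by rewrite -E; exact: ih.
- apply/disj_setPS => x /=; rewrite !in_itv/= => -[/andP[_ xr] /andP[rx _]].
  by move: (le_lt_trans xr rx); rewrite ltxx.
congr (_ + _).
have E2 : (`[r, t]%classic : set LT) = ([set r] `|` `]r, t]%classic).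
  by rewrite setU1itv// bnd_simp.
have i2 : (@leb R).-integrable (`[r, t]%classic : set LT) (EFin \o h).
  apply: integrableS ih; try exact: measurable_lebI.
  by apply: subset_itv; rewrite bnd_simp.
rewrite E2 Rintegral_setU//; last 3 first.
- exact: measurable_leb1.
- by rewrite -E2.
- by apply/disj_setPS => x /= [->]; rewrite in_itv/= ltxx.
rewrite Rintegral_leb_set1 ?add0r//.
have /measurable_EFinP mh := measurable_int _ i2.
by apply: measurable_funS mh; [exact: measurable_lebI|rewrite E2; exact: subsetUl].
Qed.

Section is_control.
Variables (p : nat) (U : control_set R p).

(** A total version of [control_mk], so that pasting controls requires no proof
    argument. *)
Definition to_control (s t : R) (h : R -> 'rV[R]_p) : control U s t :=
  if pselect (is_control U s t h) is left H then control_mk H else point.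

Lemma to_controlE s t h : is_control U s t h -> coincide s t (to_control s t h) h.
Proof.
by move=> H; rewrite /to_control; case: pselect => // H'; exact: control_mkK.
Qed.

Lemma is_control_sub s t s' t' (h : R -> 'rV[R]_p) : s <= s' -> t' <= t ->
  is_control U s t h -> is_control U s' t' h.
Proof.
move=> ss tt [mh hU]; split.
  apply: measurable_funS mh; first exact: measurable_lebI.
  by apply: subset_itv; rewrite bnd_simp.
by move=> x xs; apply: hU; apply: subset_itv xs; rewrite bnd_simp.
Qed.

Definition splice (r : R) (a b : R -> 'rV[R]_p) (x : R) :=
  if x < r then a x else b x.

Lemma is_control_splice s ta r tb t (a b : R -> 'rV[R]_p) :
  r <= ta -> tb <= r ->
  is_control U s ta a -> is_control U tb t b ->
  is_control U s t (splice r a b).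
Proof.
move=> rta tbr [ma aU] [mb bU]; split.
  have mlt : measurable_fun (`[s, t]%classic : set LT) (fun x : LT => (x : R) < r).
    apply: (measurable_fun_bool true) => //; rewrite (_ : _ `&` _ = 
       (`[s, t]%classic : set LT) `&` (`]-oo, r[%classic : set LT)).
      apply: measurableI; first exact: measurable_lebI.
      by apply: measurable_leb; exact: measurable_itv.
    by apply/seteqP; split=> x /=; rewrite !in_itv.
  apply: measurable_fun_if => //.
  - exact: measurable_lebI.
  - apply: measurable_funS ma; first exact: measurable_lebI.
    move=> x /= []; rewrite !in_itv/= => /andP[-> _] xr/=.
    by rewrite (le_trans (ltW xr)).
  - apply: measurable_funS mb; first exact: measurable_lebI.
    move=> x /= []; rewrite !in_itv/= => /andP[_ ->] /negbT; rewrite -leNgt => xr.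
    by rewrite (le_trans tbr xr).
move=> x; rewrite in_itv/= => /andP[sx xt]; rewrite /splice; case: ltP => xr.
  by apply: aU; rewrite in_itv/= sx (le_trans (ltW xr)).
by apply: bU; rewrite in_itv/= xt (le_trans tbr).
Qed.

(** The controls [a] and [b] may live on different intervals, so that cutting,
    freezing and concatenating controls are all instances. *)
Definition paste (s t r : R) (a b : R -> 'rV[R]_p) : control U s t :=
  to_control s t (splice r a b).

Lemma pasteE s ta r tb t (a : control U s ta) (b : control U tb t) :
  r <= ta -> tb <= r -> coincide s t (paste s t r a b) (splice r a b).
Proof.
move=> h1 h2; apply: to_controlE.
apply: is_control_splice h1 h2 _ _; exact: control_reprP.
Qed.

Lemma integrable_L1_gap s t (a b : R -> 'rV[R]_p) :
  is_control U s t a -> is_control U s t b ->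
  (@leb R).-integrable (`[s, t]%classic : set LT)
    (EFin \o (fun x => `|a x - b x|)).
Proof.
move=> [ma aU] [mb bU].
apply: measurable_bounded_integrable.
- exact: measurable_lebI.
- exact: leb_itv_lty.
- exact: measurable_normB.
have [M [_ UM]] := compact_bounded (@control_values_compact _ _ U).
exists (2 * (M + 1)); split=> [|N MN]; first exact: num_real.
move=> x /= xI; rewrite normr_id.
apply: le_trans (ler_normB _ _) _; apply: le_trans (ltW MN).
by rewrite mulr_natl mulr2n lerD//; apply: UM; rewrite ?ltrDl//; auto.
Qed.

(** [L1_dist] on a subinterval, for functions instead of classes. *)
Definition L1_gap (s t : R) (a b : R -> 'rV[R]_p) : R :=
  \int[@leb R]_(x in (`[s, t]%classic : set LT)) `|a x - b x|.

Lemma L1_distE s t (a b : control U s t) : L1_dist a b = L1_gap s t a b.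
Proof. by []. Qed.

Lemma eq_L1_gap s t (a a' b : R -> 'rV[R]_p) :
  is_control U s t a -> is_control U s t a' -> is_control U s t b ->
  coincide s t a a' -> L1_gap s t a b = L1_gap s t a' b.
Proof.
move=> ca ca' cb aa; rewrite /L1_gap /Rintegral; congr fine.
apply: ae_eq_integral.
- exact: measurable_lebI.
- exact: measurable_int (integrable_L1_gap ca cb).
- exact: measurable_int (integrable_L1_gap ca' cb).
- by apply: filterS aa => x /[apply] ->.
Qed.

Lemma L1_gap_sym s t (a b : R -> 'rV[R]_p) : L1_gap s t a b = L1_gap s t b a.
Proof. by apply: eq_Rintegral => x _; rewrite distrC. Qed.

Lemma L1_gap_triangle s t (a b c : R -> 'rV[R]_p) :
  is_control U s t a -> is_control U s t b -> is_control U s t c ->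
  L1_gap s t a c <= L1_gap s t a b + L1_gap s t b c.
Proof.
move=> ca cb cc.
rewrite -RintegralD//; try exact: integrable_L1_gap; last exact: measurable_lebI.
apply: le_Rintegral => //.
- exact: measurable_lebI.
- exact: integrable_L1_gap.
- apply: (integrableD _ (integrable_L1_gap ca cb) (integrable_L1_gap cb cc)).
  exact: measurable_lebI.
- by move=> x _; exact: ler_distD.
Qed.

Lemma L1_gap_sub s t s' t' (a b : R -> 'rV[R]_p) : s <= s' -> t' <= t ->
  is_control U s t a -> is_control U s t b ->
  L1_gap s' t' a b <= L1_gap s t a b.
Proof.
move=> ss tt ca cb; have i1 := integrable_L1_gap ca cb.
have i2 := integrable_L1_gap (is_control_sub ss tt ca) (is_control_sub ss tt cb).
rewrite /L1_gap /Rintegral fine_le//.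
- by apply: integrable_fin_num i2; exact: measurable_lebI.
- by apply: integrable_fin_num i1; exact: measurable_lebI.
apply: ge0_subset_integral; try exact: measurable_lebI.
- exact: measurable_int i1.
- by move=> x _; rewrite lee_fin.
- by apply: subset_itv; rewrite bnd_simp.
Qed.

Lemma L1_gap_cat s r t (a b : R -> 'rV[R]_p) : s <= r <= t ->
  is_control U s t a -> is_control U s t b ->
  L1_gap s t a b = L1_gap s r a b + L1_gap r t a b.
Proof.
move=> srt ca cb; apply: Rintegral_leb_cat => //; exact: integrable_L1_gap.
Qed.

Lemma eq_ndistl s t (a a' b : R -> 'rV[R]_p) :
  (forall x, s <= x <= t -> a x = a' x) -> L1_gap s t a b = L1_gap s t a' b.
Proof.
move=> aa; apply: eq_Rintegral => x; rewrite inE/= in_itv/= => xst.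
by rewrite aa.
Qed.

Lemma L1_gap_lipschitz s t s' t' (w : R -> 'rV[R]_p) (a b : control U s t) :
  s <= s' -> t' <= t -> is_control U s' t' w ->
  `|L1_gap s' t' a w - L1_gap s' t' b w| <= L1_dist a b.
Proof.
move=> ss tt cw; rewrite L1_distE.
have ca := control_reprP a; have cb := control_reprP b.
have ca' := is_control_sub ss tt ca; have cb' := is_control_sub ss tt cb.
apply: le_trans (L1_gap_sub ss tt ca cb).
have H1 := L1_gap_triangle ca' cb' cw; have H2 := L1_gap_triangle cb' ca' cw.
rewrite (L1_gap_sym s' t' b a) in H2.
move: (L1_gap s' t' a b) (L1_gap s' t' a w) (L1_gap s' t' b w) H1 H2 => x y z H1 H2.
by rewrite ler_norml; apply/andP; split; lra.
Qed.

Lemma measurable_L1_gap s t s' t' (w : R -> 'rV[R]_p) :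
  s <= s' -> t' <= t -> is_control U s' t' w ->
  measurable_fun setT ((fun a : control U s t => L1_gap s' t' a w)
    : borelType (control U s t) -> measurableTypeR R).
Proof.
move=> ss tt cw; apply: continuous_borel_real; apply: lipschitz_metric_continuous => a b.
exact: L1_gap_lipschitz.
Qed.

(** The Borel sets of a separable metric space are generated by the distances to
    the points of a dense sequence. *)
Lemma measurable_control d (S : measurableType d) (D : set S) s t
    (h : S -> control U s t) :
  separable (control U s t) -> measurable D ->
  (forall w : control U s t, measurable_fun D (fun z => L1_dist (h z) w)) ->
  measurable_fun D (h : S -> borelType (control U s t)).
Proof.
move=> [e eP] mD mh; apply: (measurable_fun_balls eP) => n r.
rewrite (_ : _ `&` _ = D `&` (fun z => L1_dist (h z) (e n)) @^-1` `]-oo, r[%classic).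
  by apply: mh => //; exact: measurable_itv.
have E z : ball (e n) r (h z) = (L1_dist (h z) (e n) < r) :> Prop.
  by rewrite ballEmdist L1_dist_sym.
by apply/seteqP; split => z [Dz]; rewrite /preimage/= E in_itv.
Qed.

(** The L1 distance splits at [r], which reduces the measurability of pasting to
    that of each half. *)
Lemma L1_dist_paste s ta r tb t (a : control U s ta) (b : control U tb t)
    (w : control U s t) : s <= r <= t -> r <= ta -> tb <= r ->
  L1_dist (paste s t r a b) w = L1_gap s r a w + L1_gap r t b w.
Proof.
move=> /andP[sr rt] h1 h2; rewrite L1_distE.
have ca := control_reprP a; have cb := control_reprP b.
have cw := control_reprP w; have cs := is_control_splice h1 h2 ca cb.
rewrite (eq_L1_gap (control_reprP _) cs cw (pasteE _ _ h1 h2)).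
rewrite (@L1_gap_cat s r t)//; last by rewrite sr.
congr (_ + _).
  apply: eq_L1_gap.
  - exact: is_control_sub cs.
  - exact: is_control_sub ca.
  - exact: is_control_sub cw.
  apply: (@coincide_catr _ _ r); last exact: coincide_point.
  by move=> x /andP[_ xr]; rewrite /splice xr.
apply: eq_ndistl => x /andP[rx _].
by rewrite /splice ltNge rx.
Qed.

Lemma measurable_paste s ta r tb t d (S : measurableType d)
    (a : S -> control U s ta) (b : S -> control U tb t) :
  separable (control U s t) ->
  s <= r <= t -> r <= ta -> tb <= r ->
  measurable_fun setT (a : S -> borelType (control U s ta)) ->
  measurable_fun setT (b : S -> borelType (control U tb t)) ->
  measurable_fun setT ((fun z => paste s t r (a z) (b z))
    : S -> borelType (control U s t)).
Proof.
move=> sep srt h1 h2 ma mb; apply: measurable_control => // w.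
have cw := control_reprP w; have /andP[sr rt] := srt.
under eq_fun do rewrite L1_dist_paste//.
apply: measurable_funD.
  apply: (measurableT_comp (measurable_L1_gap (lexx s) h1 _) ma).
  exact: is_control_sub cw.
apply: (measurableT_comp (measurable_L1_gap h2 (lexx t) _) mb).
exact: is_control_sub cw.
Qed.

End is_control.
End control_ops.

(** * The controls form a separable metric space *)

Section control_separable.
Context {R : realType}.
Notation LT := (lebesgueType R).

Definition ratseq (n : nat) : R := if unpickle n is Some r then ratr r else 0.

Lemma ratseqP (x e : R) : 0 < e -> exists n, `|ratseq n - x| < e.
Proof.
move=> e0.
have [r [/= xr [q _ qr]]] := @dense_rat R (ball x e)
    ltac:(by exists x; exact: ballxx) (@ball_open _ _ x e).
exists (pickle q); rewrite /ratseq pickleK qr distrC; exact: xr.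
Qed.

(** Finite unions of rational intervals, coded by lists of integers: a countable
    supply of approximations of measurable sets. *)
Definition in_balls (l : seq (nat * nat)) (x : R) :=
  has (fun k => `|ratseq k.1 - x| < k.2.+1%:R^-1) l.

Lemma open_in_balls l : open [set x | in_balls l x].
Proof.
elim: l => [|k l ih].
  have -> : [set x : R | in_balls [::] x] = set0 by apply/seteqP; split.
  exact: open0.
rewrite (_ : [set x | _] = ball (ratseq k.1) k.2.+1%:R^-1 `|` [set x | in_balls l x]).
  by apply: openU => //; exact: ball_open.
by apply/seteqP; split => x /=; [move=> /orP[]; [left|right]|move=> [|] h; apply/orP; [left|right]].
Qed.

(** Up to a null set [A] is a Borel set [B]. Outer regularity gives an open set
    [G] close to [B], which is an increasing union of finite unions of rational
    intervals; by continuity from above one of these already covers most of [B]. *)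
Lemma approx_balls (s t e : R) (A : set LT) : measurable A ->
  A `<=` `[s, t]%classic -> 0 < e ->
  exists l, (leb ((A `\` [set x | in_balls l x]) `|` ([set x | in_balls l x] `\` A) : set LT) < e%:E)%E.
Proof.
move=> mA Ast e0; have e20 : 0 < e / 2 by rewrite divr_gt0.
have [B mB [N nN BN]] : completed_algebra_gen (@lebesgue_measure R) A.
  rewrite -g_sigma_completed_algebra_genE.
  by rewrite completed_caratheodory_measurable.
have [F [mF F0 NF]] := nN.
have Bst : B `<=` `[s, t]%classic by move=> x Bx; apply: Ast; rewrite -BN; left.
have Bfin : (lebesgue_measure B < +oo)%E.
  apply: (@le_lt_trans _ _ (lebesgue_measure (`[s, t]%classic : set (measurableTypeR R)))).
    by rewrite le_measure ?inE.
  exact: (leb_itv_lty s t).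
have [G [oO BO OB]] := lebesgue_regularity_outer mB Bfin e20.
pose good (k : nat * nat) := `[< [set x | `|ratseq k.1 - x| < k.2.+1%:R^-1] `<=` G >].
pose L k := [seq x <- pmap unpickle (iota 0 k) | good x].
pose D k := (B : set (measurableTypeR R)) `\` [set x | in_balls (L k) x].
have mC k : measurable ([set x | in_balls (L k) x] : set (measurableTypeR R)).
  by apply: open_measurable; exact: open_in_balls.
have mD k : measurable (D k) by apply: measurableD.
have CO k : [set x | in_balls (L k) x] `<=` G.
  move=> x /= /hasP[z]; rewrite mem_filter => /andP[/asboolP zO _]; exact: zO.
have D0 : \bigcap_k D k = set0.
  apply/seteqP; split=> // x Dx; have [Bx _] := Dx 0 I.
  have Gx := BO _ Bx.
  have : G x by [].
  rewrite (open_bigcup_ball (d := ratseq) _ oO); last by move=> y r; exact: ratseqP.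
  move=> [n _ [m mO xnm]]; have [_] := Dx (pickle (n, m)).+1 I; apply.
  apply/hasP; exists (n, m) => //; rewrite mem_filter; apply/andP; split.
    exact/asboolP.
  rewrite mem_pmap; apply/mapP; exists (pickle (n, m)); last by rewrite pickleK.
  by rewrite mem_iota add0n leq0n ltnS leqnn.
have cD : (lebesgue_measure \o D) k @[k --> \oo] --> (0 : \bar R)%E.
  rewrite -(measure0 (@lebesgue_measure R)) -D0.
  apply: nonincreasing_cvg_mu => //.
  - apply: le_lt_trans Bfin; apply: le_measure; rewrite ?inE//.
    by move=> x [].
  - by rewrite D0; exact: measurable0.
  - move=> m n mn; apply/subsetPset => x [Bx nx]; split=> // mx; apply: nx.
    have /hasP[z] := mx; rewrite mem_filter => /andP[gz zm] xz.
    apply/hasP; exists z => //; rewrite mem_filter gz/=.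
    move: zm; rewrite !mem_pmap => /mapP[k]; rewrite mem_iota => /andP[_ km] zk.
    apply/mapP; exists k => //; rewrite mem_iota leq0n/=.
    by rewrite add0n in km *; exact: leq_trans mn.
have [k Dk] : exists k, (lebesgue_measure (D k) < (e / 2)%:E)%E.
  have /cD[k _ /(_ k (leqnn k))] : nbhs (0 : \bar R)%E [set x | (x < (e / 2)%:E)%E].
    apply: open_nbhs_nbhs; split; first exact: open_ereal_lt_ereal.
    by rewrite /= lte_fin.
  by exists k.
exists (L k).
pose F' : set LT := F; pose D' : set LT := D k; pose G' : set LT := G `\` B.
have mF' : measurable F' by exact: (@measurable_leb R F mF).
have mD' : measurable D' by exact: (@measurable_leb R (D k) (mD k)).
have mG' : measurable G'.
  by apply: measurable_leb; apply: measurableD => //; exact: open_measurable.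
apply: (@le_lt_trans _ _ (leb (D' `|` G' `|` F'))).
  apply: le_measure; rewrite ?inE.
  - by apply: measurableU; apply: measurableD => //; exact: measurable_leb.
  - by do 2 apply: measurableU => //.
  - move=> x [[Ax nx]|[x1 nA]].
      by move: Ax; rewrite -BN => -[Bx|/NF Fx]; [left; left|right].
    left; right; split; first exact: (CO k).
    by move=> Bx; apply: nA; rewrite -BN; left.
have F'0 : leb F' = 0%E by exact: F0.
apply: (@le_lt_trans _ _ (leb D' + leb G' + leb F')%E).
  apply: le_trans (measureU2 _ _ mF') _; first exact: measurableU.
  by apply: leeD2r; exact: measureU2.
rewrite F'0 adde0 [e]splitr EFinD.
apply: lteD; [exact: Dk|exact: OB].
Qed.

Lemma measurable_in_balls l (D : set LT) : measurable D ->
  measurable_fun D (fun x : LT => in_balls l x).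
Proof.
move=> mD; apply: (measurable_fun_bool true) => //; apply: measurableI => //.
apply: measurable_leb; apply: open_measurable; exact: open_in_balls.
Qed.

Lemma compact_net p (U : set 'rV[R]_p) (e : R) : compact U -> 0 < e ->
  exists l : seq 'rV[R]_p, (forall y, y \in l -> U y) /\
    forall x, U x -> exists2 y, y \in l & `|x - y| < e.
Proof.
rewrite compact_cover => cU e0.
have [|x Ux|l lU Ul] := cU _ U (fun y => ball y e).
- by move=> y _; exact: ball_open.
- by exists x => //; exact: ballxx.
exists (finmap.enum_fset l); split=> [y yl|x /Ul[y /= yl yx]].
  by have := lU y yl; rewrite inE.
by exists y => //; rewrite distrC; move: yx; rewrite mx_norm_ball.
Qed.

Section control.
Variables (p : nat) (U : control_set R p).

Let invS_gt0 m : 0 < m.+1%:R^-1 :> R. Proof. by rewrite invr_gt0. Qed.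

Definition net (m : nat) : seq 'rV[R]_p :=
  projT1 (cid (compact_net (@control_values_compact _ _ U)
    (invS_gt0 m))).

Lemma netU m y : y \in net m -> control_values U y.
Proof. exact: (projT2 (cid (compact_net _ (invS_gt0 m)))).1. Qed.

Lemma netP m x : control_values U x -> exists2 y, y \in net m & `|x - y| < m.+1%:R^-1.
Proof. exact: (projT2 (cid (compact_net _ (invS_gt0 m)))).2. Qed.

(** The step function that takes at [x] the value attached to the first union of
    intervals containing [x]. The default value lies in [U], which makes it a
    control in all cases. *)
Fixpoint first_match (zl : seq ('rV[R]_p * seq (nat * nat))) (x : R) : 'rV[R]_p :=
  if zl is z :: zl' then if in_balls z.2 x then z.1 else first_match zl' x
  else xget 0 U.

Lemma is_control_first_match s t zl :
  (forall z, z \in zl -> control_values U z.1) -> is_control U s t (first_match zl).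
Proof.
elim: zl => [_|z zl ih zU] /=; first exact: is_control_cst.
have {ih}[mzl Uzl] := ih (fun y yzl => zU y (mem_behead (s := z :: zl) yzl)).
split=> [|x xst].
  apply: measurable_fun_if => //.
  - exact: measurable_lebI.
  - by apply: measurable_in_balls; exact: measurable_lebI.
  - by apply: measurable_funS mzl => //; exact: measurable_lebI.
case: ifP => _; last exact: Uzl.
by apply: zU; rewrite mem_head.
Qed.

Lemma first_match_near (h : 'rV[R]_p) (e : R) zl x :
  (forall z, z \in zl -> in_balls z.2 x = (`|h - z.1| < e)) ->
  (exists2 z, z \in zl & `|h - z.1| < e) -> `|h - first_match zl x| < e.
Proof.
elim: zl => [_ []//|z zl ih /= zE [y]].
rewrite zE ?mem_head//; case: ifP => // hz; rewrite inE => /orP[/eqP->|yzl hy].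
  by rewrite hz.
apply: ih => [w wzl|]; last by exists y.
by apply: zE; rewrite inE wzl orbT.
Qed.

(** The sets where [h] is within [e] of a point of [l] are approximated one by
    one by [approx_balls], and [B] collects the errors. *)
Lemma approx_control s t (h : R -> 'rV[R]_p) (l : seq 'rV[R]_p) (e e' : R) :
  is_control U s t h -> 0 < e' ->
  exists zl (B : set LT), [/\ map fst zl = l, measurable B,
    (leb B <= ((size l)%:R * e')%:E)%E &
    forall x, s <= x <= t -> ~ B x -> forall z, z \in zl ->
      in_balls z.2 x = (`|h x - z.1| < e)].
Proof.
move=> ch e'0; elim: l => [|y l [zl [B [zE mB Bl Bz]]]].
  exists [::], set0; split => //; first by rewrite measure0 mul0r.
pose A : set LT := `[s, t]%classic `&` [set x | `|h x - y| < e].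
have mA : measurable A.
  have [mh _] := ch.
  have := measurable_normB mh (@measurable_cst _ _ _ _ _ (y : borelType _)).
  move=> /(_ (measurable_lebI s t) `]-oo, e[%classic (measurable_itv _)).
  by rewrite /A; congr measurable; apply/seteqP; split => x /= []; rewrite ?in_itv.
have [||k kE] := @approx_balls s t e' A mA => //; first by move=> x [].
set C := (X in leb X) in kE.
have mC : measurable C.
  have mk : measurable ([set x | in_balls k x] : set LT).
    by apply: measurable_leb; apply: open_measurable; exact: open_in_balls.
  by apply: measurableU; apply: measurableD.
exists ((y, k) :: zl), (C `|` B); split => /=.
- by rewrite zE.
- exact: measurableU.
- apply: le_trans (measureU2 _ mC mB) _.
  rewrite -nat1r mulrDl mul1r EFinD; apply: leeD => //; exact: ltW.
- move=> x sxt /not_orP[nC nB] z; rewrite inE => /orP[/eqP->/=|]; last exact: Bz.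
  apply/idP/idP => [kx|hx].
    apply: contrapT => nhx; apply: nC; right; split => // -[_]; exact: nhx.
  apply: contrapT => nkx; apply: nC; left; split => //.
Qed.

Definition dense_control s t (n : nat) : control U s t :=
  if unpickle n is Some (m, ss) then
    to_control U s t (first_match (zip (net m) ss)) else point.

(** The step functions with values in a finite net of [U] and with unions of
    rational intervals as steps are dense. The distance to the net contributes at
    most e / 2; the exceptional set of [approx_control] contributes at most e / 2
    because [U] is bounded. *)
Lemma separable_control s t : separable (control U s t).
Proof.
exists (dense_control s t) => /= u e e0.
pose u' : control U s t := u; rewrite -[u]/u'.
clearbody u'; clear u; rename u' into u.
have cu := control_reprP u.
have [C [_ UC]] := compact_bounded (@control_values_compact _ _ U).
pose M : R := `|C| + 1.
have UM y : control_values U y -> `|y| <= M.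
  by move=> Uy; apply: UC => //; rewrite /M (le_lt_trans (ler_norm C)) ?ltrDl.
pose d := fine (leb (`[s, t]%classic : set LT)).
have d0 : 0 <= d by exact: fine_ge0.
have [m mE] := @ltr_add_invr R 0 (e / 2 / (d + 1)) ltac:(by rewrite !divr_gt0// ltr_wpDl).
rewrite add0r in mE.
pose e' := e / 2 / (2 * M * (size (net m))%:R + 1).
have M0 : 0 < M by rewrite /M ltr_wpDl.
have e'0 : 0 < e'.
  by rewrite !divr_gt0// ltr_wpDl// mulr_ge0// mulr_ge0// ltW.
have [zl [B [zE mB Bl Bz]]] := approx_control (net m) m.+1%:R^-1 cu e'0.
have zip_zl : zip (net m) (map snd zl) = zl.
  by rewrite -zE; elim: (zl) => //= -[a b] r ->.
have zU z : z \in zl -> control_values U z.1.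
  by move=> zzl; apply: (@netU m); rewrite -zE; exact: map_f.
have cf : is_control U s t (first_match zl) by exact: is_control_first_match.
exists (pickle (m, map snd zl)); rewrite /dense_control pickleK zip_zl.
suff : L1_dist (to_control U s t (first_match zl)) u < e by rewrite ballEmdist.
rewrite L1_distE (eq_L1_gap (control_reprP _) cf cu (to_controlE cf)).
have near x : s <= x <= t -> `|first_match zl x - u x| <= m.+1%:R^-1 + 2 * M * \1_B x.
  move=> sxt; have Uux : control_values U (u x) by apply: cu.2; rewrite in_itv.
  have [Bx|nBx] := pselect (B x).
    rewrite indicE mem_set// mulr1 (le_trans (ler_normB _ _))//.
    have := UM _ Uux; have := UM _ (cf.2 x _); rewrite in_itv => /(_ sxt).
    have : 0 <= m.+1%:R^-1 :> R by rewrite ltW.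
    move: `|_| `|_| (m.+1%:R^-1) => a b c; lra.
  rewrite indicE memNset// mulr0 addr0 distrC ltW//.
  apply: first_match_near => [z zzl|]; first exact: Bz.
  have [y + uy] := netP m Uux; rewrite -zE => /mapP[z zzl yz].
  by exists z => //; rewrite -yz.
have mD := measurable_lebI s t.
have ind := integrable_L1_gap cf cu.
have Dfin := leb_itv_lty s t.
have Bt : (leb (B `&` `[s, t]%classic : set LT) <= ((size (net m))%:R * e')%:E)%E.
  by apply: le_trans Bl; apply: le_measure; rewrite ?inE//; exact: measurableI.
have m1 : measurable_fun (`[s, t]%classic : set LT) (EFin \o (\1_B : LT -> R)).
  exact/measurable_EFinP/measurable_indic.
have le1 : (\int[leb]_(x in (`[s, t]%classic : set LT)) `|first_match zl x - u x|%:E <=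
    (m.+1%:R^-1 * d + 2 * M * ((size (net m))%:R * e'))%:E)%E.
  apply: (@le_trans _ _ (\int[leb]_(x in (`[s, t]%classic : set LT))
      ((m.+1%:R^-1)%:E + (2 * M)%:E * (\1_B x)%:E))%E).
    apply: ge0_le_integral.
    - exact: mD.
    - by move=> x _; rewrite lee_fin.
    - exact: measurable_int ind.
    - by apply: emeasurable_funD; [exact: measurable_cst|exact: measurable_funeM].
    - by move=> x; rewrite /= in_itv/= => /near; rewrite -EFinM -EFinD lee_fin.
  have M20 : 0 <= 2 * M by rewrite mulr_ge0// ltW.
  rewrite (integral_affine_indic leb mD mB (ltW (invS_gt0 m)) M20).
  rewrite EFinD; apply: leeD.
    by rewrite EFinM /d fineK// ge0_fin_numE.
  by rewrite [leRHS]EFinM lee_wpmul2l// lee_fin mulr_ge0// ltW.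
have fin1 := integrable_fin_num mD ind.
rewrite /L1_gap /Rintegral -lte_fin fineK//; apply: le_lt_trans le1 _.
rewrite lte_fin [e]splitr; apply: ltr_leD.
  apply: le_lt_trans (_ : m.+1%:R^-1 * (d + 1) < _).
    by rewrite ler_wpM2l// lerDl.
  by rewrite -ltr_pdivlMr// ltr_wpDl.
rewrite /e' mulrA mulrCA ler_piMr//; first by rewrite ltW// divr_gt0.
rewrite ler_pdivrMr; last by rewrite ltr_wpDl// mulr_ge0// mulr_ge0// ltW.
by rewrite mul1r lerDl.
Qed.

End control.
End control_separable.

(** * Integrals of vector-valued functions *)

Section leb_integral.
Context {R : realType}.
Notation LT := (lebesgueType R).

(** The identity pushes the completed measure [leb] forward to the Lebesgue
    measure on Borel sets. *)
Lemma integral_leb_borel (D : set (measurableTypeR R)) (h : measurableTypeR R -> \bar R) :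
  measurable D -> measurable_fun D h -> (forall x, D x -> 0 <= h x)%E ->
  (\int[@leb R]_(x in (D : set LT)) h x = \int[lebesgue_measure]_(x in D) h x)%E.
Proof.
move=> mD mh h0.
have mid : measurable_fun setT (idfun : LT -> measurableTypeR R).
  by move=> _ Y mY; rewrite setTI; exact: measurable_leb.
have := ge0_integral_pushforward mid (@leb R) mD mh.
move=> /(_ ltac:(by move=> x; rewrite inE => /h0)) <-.
by apply: eq_measure_integral => A mA _.
Qed.

Lemma continuous_exp_weight (c a : R) : continuous (fun s => expR (c * (s - a))).
Proof.
move=> x; apply: continuous_comp; last exact: continuous_expR.
apply: cvgM; first exact: cvg_cst.
by apply: cvgB; [exact: cvg_id|exact: cvg_cst].
Qed.

Lemma integral_exp_weight (c a t : R) : 0 < c -> a < t ->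
  (\int[@leb R]_(s in (`[a, t]%classic : set LT)) (c * expR (c * (s - a)))%:E =
   (expR (c * (t - a)) - 1)%:E)%E.
Proof.
move=> c0 at_.
pose F s := expR (c * (s - a)).
have dF (s : R) : is_derive s (1 : R) F (c * expR (c * (s - a))).
  rewrite /F; apply: is_derive_eq.
  by rewrite subr0 mulrC /GRing.scale/= mulr1.
have cf : continuous (fun s => c * expR (c * (s - a))).
  by move=> s; apply: cvgM; [exact: cvg_cst|exact: continuous_exp_weight].
rewrite integral_leb_borel; last 3 first.
- exact: measurable_itv.
- apply/measurable_EFinP; apply: measurable_funTS.
  exact: continuous_measurable_fun.
- by move=> s _; rewrite lee_fin mulr_ge0// ?expR_ge0// ltW.
rewrite (@continuous_FTC2 _ _ F a t)//.
- by rewrite /F subrr mulr0 expR0.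
- exact: continuous_subspaceT.
- split.
  + by move=> s _; exact: ex_derive.
  + by apply: cvg_at_right_filter; exact: continuous_exp_weight.
  + by apply: cvg_at_left_filter; exact: continuous_exp_weight.
- by move=> s _; rewrite derive1E; exact: derive_val.
Qed.

Lemma leb_itv (s t : R) : s <= t -> leb (`[s, t]%classic : set LT) = (t - s)%:E.
Proof.
move=> st; have -> : leb (`[s, t]%classic : set LT) = lebesgue_measure `[s, t]%classic by [].
rewrite lebesgue_measure_itv/= lte_fin; case: ifPn => [_|]; first by rewrite EFinB.
by rewrite -leNgt => ts; rewrite (le_anti (_ : s <= t <= s)) ?subrr// st ts.
Qed.

Section vint.
Variable n : nat.
Implicit Types h k : R -> 'rV[R]_n.

Lemma coord_le_norm (x : 'rV[R]_n) i : `|x 0 i| <= `|x|.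
Proof.
rewrite [leRHS]/Num.norm/= mx_normrE.
exact: (le_bigmax _ (fun ij : 'I_1 * 'I_n => `|x ij.1 ij.2|) (0, i)).
Qed.

Lemma norm_le_coord (x : 'rV[R]_n) e : 0 <= e -> (forall i, `|x 0 i| <= e) -> `|x| <= e.
Proof.
move=> e0 xe; rewrite /Num.norm/= mx_normrE; apply: bigmax_le => // -[i j] _ /=.
by rewrite (ord1 i).
Qed.

Definition bounded_meas (a b : R) h :=
  measurable_fun (`[a, b]%classic : set LT) (h : LT -> borelType 'rV[R]_n) /\
  exists M : R, forall s, a <= s <= b -> `|h s| <= M.

Lemma bounded_meas_sub a b a' b' h : a <= a' -> b' <= b -> bounded_meas a b h -> bounded_meas a' b' h.
Proof.
move=> aa bb [mh [M hM]]; split.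
  apply: measurable_funS mh; first exact: measurable_lebI.
  by apply: subset_itv; rewrite bnd_simp.
by exists M => s /andP[h1 h2]; apply: hM; rewrite (le_trans aa)// (le_trans h2).
Qed.

Lemma integrable_bounded a b (h : R -> R) (M : R) :
  measurable_fun (`[a, b]%classic : set LT) (h : LT -> R) ->
  (forall s, a <= s <= b -> `|h s| <= M) ->
  (@leb R).-integrable (`[a, b]%classic : set LT) (EFin \o h).
Proof.
move=> mh hM; apply: measurable_bounded_integrable.
- exact: measurable_lebI.
- exact: leb_itv_lty.
- exact: mh.
exists M; split=> [|e Me]; first exact: num_real.
by move=> s /=; rewrite in_itv/= => /hM hs; exact: le_trans (ltW Me).
Qed.

Lemma bounded_meas_coord a b h i : bounded_meas a b h ->
  (@leb R).-integrable (`[a, b]%classic : set LT) (EFin \o (fun s => h s 0 i)).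
Proof.
move=> [mh [M hM]]; apply: (@integrable_bounded _ _ _ M).
  exact: (measurableT_comp (measurable_coord i) mh).
by move=> s /hM; apply: le_trans; exact: coord_le_norm.
Qed.

Lemma bounded_meas_normB a b h k : bounded_meas a b h -> bounded_meas a b k ->
  (@leb R).-integrable (`[a, b]%classic : set LT) (EFin \o (fun s => `|h s - k s|)).
Proof.
move=> [mh [M hM]] [mk [M' kM]]; apply: (@integrable_bounded _ _ _ (M + M')).
  exact: measurable_normB.
move=> s sab; rewrite normr_id (le_trans (ler_normB _ _))//.
by apply: lerD; [exact: hM|exact: kM].
Qed.

Definition vint (a b : R) h : 'rV[R]_n :=
  \row_i \int[@leb R]_(s in (`[a, b]%classic : set LT)) h s 0 i.

Lemma vintB_le a b h k : bounded_meas a b h -> bounded_meas a b k ->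
  `|vint a b h - vint a b k| <=
  \int[@leb R]_(s in (`[a, b]%classic : set LT)) `|h s - k s|.
Proof.
move=> bh bk; have mI := measurable_lebI a b.
apply: norm_le_coord => [|i]; first exact: Rintegral_ge0.
have ih := bounded_meas_coord i bh; have ik := bounded_meas_coord i bk.
rewrite !mxE -(RintegralB mI ih ik).
have ihk := integrableB mI ih ik.
apply: le_trans (le_normr_Rintegral mI ihk) _.
apply: (le_Rintegral mI).
- exact: integrable_norm ihk.
- exact: bounded_meas_normB.
by move=> s _; rewrite -[X in X <= _]/(`|h s 0 i - k s 0 i|);
  have := coord_le_norm (h s - k s) i; rewrite !mxE.
Qed.

Lemma vint_cat a r b h : a <= r <= b -> bounded_meas a b h ->
  vint a b h = vint a r h + vint r b h.
Proof.
move=> arb bh; apply/rowP => i; rewrite !mxE.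
exact: Rintegral_leb_cat (bounded_meas_coord i bh).
Qed.

Lemma vint_bound a b h M : a <= b -> 0 <= M -> bounded_meas a b h ->
  (forall s, a <= s <= b -> `|h s| <= M) -> `|vint a b h| <= M * (b - a).
Proof.
move=> ab M0 bh hM; have mI := measurable_lebI a b.
apply: norm_le_coord => [|i]; first by rewrite mulr_ge0// subr_ge0.
have ih := bounded_meas_coord i bh; rewrite mxE.
apply: le_trans (le_normr_Rintegral mI ih) _.
have E : M * (b - a) = \int[@leb R]_(s in (`[a, b]%classic : set LT)) M.
  by rewrite (Rintegral_cst leb mI) leb_itv.
rewrite E; apply: (le_Rintegral mI).
- exact: integrable_norm ih.
- apply: (@integrable_bounded _ _ _ `|M|) => //; exact: measurable_cst.
move=> s /=; rewrite in_itv/= => /hM; apply: le_trans; exact: coord_le_norm.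
Qed.

Lemma vint_point a b h : b <= a -> vint a b h = 0.
Proof.
move=> ba; apply/rowP => i; rewrite !mxE.
have [ab|ab] := ltP b a.
  by rewrite set_itv_ge ?Rintegral_set0// bnd_simp -ltNge.
have -> : b = a by apply/eqP; rewrite eq_le ba.
rewrite set_itv1; apply: Rintegral_leb_set1.
by apply: measurable_fun_set1.
Qed.

End vint.
End leb_integral.

(** * Caratheodory differential equations *)

Section ode.
Context {R : realType} {n : nat}.
Notation LT := (lebesgueType R).
Implicit Types (y z : R -> 'rV[R]_n).

Lemma lip_within (a b L : R) y :
  (forall t t', a <= t <= b -> a <= t' <= b -> `|y t - y t'| <= L * `|t - t'|) ->
  {within `[a, b], continuous y}.
Proof.
move=> yL; apply/subspace_continuousP => t /=; rewrite in_itv/= => tab.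
apply/cvgrPdist_lt => e e0; rewrite near_withinE.
have L0 : 0 < `|L| + 1 by rewrite ltr_wpDl.
apply/nbhs_ballP; exists (e / (`|L| + 1)) => /=; first by rewrite divr_gt0.
move=> t' tt'; rewrite in_itv/= => t'ab; apply: le_lt_trans (yL _ _ tab t'ab) _.
apply: le_lt_trans (_ : (`|L| + 1) * `|t - t'| < _).
  by rewrite ler_wpM2r// (le_trans (ler_norm L))// lerDl.
by rewrite mulrC -ltr_pdivlMr.
Qed.

Lemma within_bounded_meas (a b : R) y : {within `[a, b], continuous y} -> bounded_meas a b y.
Proof.
move=> cy; split.
  apply: measurable_fun_rV => [|i]; first exact: measurable_lebI.
  have cyi : {within `[a, b], continuous (fun s => y s 0 i)}.
    move/subspace_continuousP : cy => cy; apply/subspace_continuousP => t tab.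
    exact: (cvg_comp _ (fun m : 'rV[R]_n => m 0 i) (cy t tab) (@coord_continuous _ 1 n 0 i (y t))).
  have := subspace_continuous_measurable_fun (measurable_itv _) cyi.
  move=> my _ Y mY; apply: measurable_leb; exact: my.
have /compact_bounded[M [_ hM]] := continuous_compact cy (@segment_compact _ a b).
exists (M + 1) => s sab; apply: hM; first by rewrite ltrDl.
by exists s => //=; rewrite in_itv.
Qed.

Section weight.
Variables (a K : R).
Hypothesis K0 : 0 < K.
(** Bielecki's exponential weight: in the sup norm weighted by its inverse, the
    integral operator of a K-Lipschitz field contracts by the factor 1 / 2. *)
Definition weight (t : R) := expR (2 * K * (t - a)).

Lemma weight_ge1 t : a <= t -> 1 <= weight t.
Proof.
by move=> at_; rewrite -expR0 ler_expR mulr_ge0// ?subr_ge0// mulr_ge0// ltW.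
Qed.

Lemma weight_le s t : s <= t -> weight s <= weight t.
Proof.
by move=> st; rewrite ler_expR ler_wpM2l ?lerB// mulr_ge0// ltW.
Qed.

(** Integrating the weight gains a factor 1 / (2 K), which absorbs the Lipschitz
    constant [K] and leaves 1 / 2. *)
Lemma weight_int t S (h : R -> R) : a <= t -> 0 <= S ->
  (@leb R).-integrable (`[a, t]%classic : set LT) (EFin \o h) ->
  (forall s, a <= s <= t -> h s <= S * weight s) ->
  K * (\int[@leb R]_(s in (`[a, t]%classic : set LT)) h s) <= S * weight t / 2.
Proof.
move=> at_ S0 ih hS; have mI := measurable_lebI a t.
have w0 s : 0 <= weight s by exact: expR_ge0.
move: at_; rewrite le_eqVlt => /orP[/eqP <-|at_].
  rewrite set_itv1 Rintegral_leb_set1; last exact: measurable_fun_set1.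
  by rewrite mulr0 divr_ge0// mulr_ge0.
have K20 : 0 < 2 * K by rewrite mulr_gt0.
have iw : (@leb R).-integrable (`[a, t]%classic : set LT)
    (EFin \o (fun s => 2 * K * weight s)).
  apply: (@integrable_bounded _ _ _ _ (2 * K * weight t)).
    have : measurable_fun setT (fun s : measurableTypeR R => 2 * K * weight s).
      apply: continuous_measurable_fun => s; apply: cvgM; first exact: cvg_cst.
      exact: continuous_exp_weight.
    by move=> mw _ Y mY; apply: measurable_leb; apply: measurableI;
      [exact: measurable_itv|rewrite -[X in measurable X]setTI; exact: mw].
  move=> s /andP[_ st]; rewrite ger0_norm; last by rewrite mulr_ge0// ltW.
  by rewrite ler_wpM2l ?weight_le// ltW.
have E : \int[@leb R]_(s in (`[a, t]%classic : set LT)) (2 * K * weight s) = weight t - 1.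
  by rewrite /Rintegral integral_exp_weight.
have iSw : (@leb R).-integrable (`[a, t]%classic : set LT)
    (EFin \o (fun s => S / (2 * K) * (2 * K * weight s))).
  apply: (integrableZl mI _ iw).
apply: le_trans (_ : K * (S / (2 * K) * (weight t - 1)) <= _).
  rewrite ler_wpM2l ?(ltW K0)// -E -(RintegralZl _ mI iw).
  apply: (le_Rintegral mI ih iSw) => s /=; rewrite in_itv/= => /hS.
  by rewrite mulrA divfK// gt_eqF.
have -> : K * (S / (2 * K) * (weight t - 1)) = S * (weight t - 1) / 2.
  by field; rewrite gt_eqF.
by rewrite ler_pM2r// ler_wpM2l// lerBlDr lerDl.
Qed.

(** By [weight_int] the supremum S of h / weight satisfies S <= A + S / 2. *)
Lemma gronwall b A (h : R -> R) : 
  0 <= A -> (exists M, forall s, a <= s <= b -> h s <= M) ->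
  (@leb R).-integrable (`[a, b]%classic : set LT) (EFin \o h) ->
  (forall t, a <= t <= b ->
     h t <= A + K * \int[@leb R]_(s in (`[a, t]%classic : set LT)) h s) ->
  forall t, a <= t <= b -> h t <= 2 * A * weight t.
Proof.
move=> A0 [M hM] ih hA t tab.
have /andP[at_ tb] := tab; have ab := le_trans at_ tb.
have wgt0 s : 0 < weight s by exact: expR_gt0.
pose Q := [set h s / weight s | s in [set s | a <= s <= b]].
have Q0 : has_sup Q.
  split; first by exists (h t / weight t); exists t.
  exists `|M| => _ [s sab <-]; rewrite ler_pdivrMr//.
  apply: le_trans (hM _ sab) _; apply: le_trans (ler_norm M) _.
  by rewrite ler_peMr// weight_ge1//; case/andP : sab.
have ubQ s : a <= s <= b -> h s <= sup Q * weight s.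
  by move=> sab; rewrite -ler_pdivrMr//; apply: sup_upper_bound => //; exists s.
have [S0|S0] := leP 0 (sup Q); last first.
  apply: le_trans (ubQ _ tab) _; apply: (@le_trans _ _ 0).
    by rewrite mulr_le0_ge0 ?(ltW S0)// ltW.
  by rewrite mulr_ge0 ?mulr_ge0// ltW.
suff QA : sup Q <= 2 * A.
  by apply: le_trans (ubQ _ tab) _; rewrite ler_pM2r.
suff : sup Q <= A + sup Q / 2 by lra.
apply: ge_sup; first by case: Q0.
move=> _ [s sab <-]; rewrite ler_pdivrMr//; apply: le_trans (hA _ sab) _.
have /andP[as_ sb] := sab.
have := @weight_int s (sup Q) h as_ S0 _ _.
move=> /(_ _ _)/wrap[].
- apply: integrableS ih; try exact: measurable_lebI.
  by apply: subset_itv; rewrite bnd_simp.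
- by move=> r /andP[ar rs]; apply: ubQ; rewrite ar (le_trans rs).
move=> H; rewrite mulrDl; apply: lerD.
  by rewrite ler_peMr// weight_ge1.
by rewrite mulrAC.
Qed.

End weight.

(** The Caratheodory conditions, with measurability along continuous curves only:
    this is what gives a meaning to the integral equation [sol]. *)
Record is_field (a b K M : R) (F : R -> 'rV[R]_n -> 'rV[R]_n) : Prop := IsField {
  field_meas : forall y, {within `[a, b], continuous y} ->
    measurable_fun (`[a, b]%classic : set LT)
      ((fun s => F s (y s)) : LT -> borelType 'rV[R]_n) ;
  field_bound : forall s x, a <= s <= b -> `|F s x| <= M ;
  field_lip : forall s x x', a <= s <= b -> `|F s x - F s x'| <= K * `|x - x'| }.

Definition sol (a b : R) (F : R -> 'rV[R]_n -> 'rV[R]_n) (x : 'rV[R]_n) y : Prop :=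
  {within `[a, b], continuous y} /\
  forall t, t \in `[a, b] -> y t = x + vint a t (fun s => F s (y s)).

Lemma within_sub (a b a' b' : R) y : a <= a' -> b' <= b ->
  {within `[a, b], continuous y} -> {within `[a', b'], continuous y}.
Proof.
move=> aa bb; apply: continuous_subspaceW.
by apply: subset_itv; rewrite bnd_simp.
Qed.

Lemma is_field_bounded_meas a b K M F y : is_field a b K M F ->
  {within `[a, b], continuous y} -> bounded_meas a b (fun s => F s (y s)).
Proof.
move=> fF cy; split; first exact: (field_meas fF).
by exists M => s; exact: (field_bound fF).
Qed.

Lemma sol_start a b F x y : a <= b -> sol a b F x y -> y a = x.
Proof.
by move=> ab [_ /(_ a)]; rewrite in_itv/= lexx ab => /(_ isT) ->;
  rewrite vint_point// addr0.
Qed.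

Lemma sol_sub a b r F x y : r <= b -> sol a b F x y -> sol a r F x y.
Proof.
move=> rb [cy yE]; split; first exact: within_sub cy.
by move=> t tar; apply: yE; apply: subset_itv tar; rewrite bnd_simp.
Qed.

Lemma sol_tail a r b K M F x y : is_field a b K M F -> a <= r <= b ->
  sol a b F x y -> sol r b F (y r) y.
Proof.
move=> fF /andP[ar rb] [cy yE]; split; first exact: within_sub cy.
move=> t; rewrite in_itv/= => /andP[rt tb].
have bF := bounded_meas_sub (lexx a) tb (is_field_bounded_meas fF cy).
rewrite yE; last by rewrite in_itv/= (le_trans ar).
rewrite (@vint_cat _ _ a r t) ?ar//.
rewrite yE; last by rewrite in_itv/= ar.
by rewrite addrA.
Qed.

Lemma vint_lip a b M (h : R -> 'rV[R]_n) : 0 <= M -> bounded_meas a b h ->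
  (forall s, a <= s <= b -> `|h s| <= M) ->
  forall t t', a <= t <= b -> a <= t' <= b ->
    `|vint a t h - vint a t' h| <= M * `|t - t'|.
Proof.
move=> M0 bh hM t t'; wlog tt : t t' / t <= t' => [W|] tab t'ab.
  have [tt|tt] := leP t t'; first exact: W.
  by rewrite distrC [X in _ * X]distrC; apply: W => //; exact: ltW.
have /andP[at_ tb] := tab; have /andP[at' t'b] := t'ab.
rewrite (@vint_cat _ _ a t t') ?at_//; last exact: bounded_meas_sub bh.
rewrite opprD addrA subrr add0r normrN distrC ger0_norm ?subr_ge0//.
apply: vint_bound => //; first exact: bounded_meas_sub bh.
by move=> s /andP[ts st]; apply: hM; rewrite (le_trans at_)//= (le_trans st).
Qed.

(** Inserting the field [F] along the second solution splits the difference into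
    a Lipschitz term, absorbed by [gronwall], and the discrepancy of the fields. *)
Lemma sol_dist a b K M F G x x' y z : 0 < K -> a <= b ->
  is_field a b K M F -> sol a b F x y ->
  sol a b G x' z -> bounded_meas a b (fun s => G s (z s)) ->
  forall t, a <= t <= b -> `|y t - z t| <=
    2 * (`|x - x'| + \int[@leb R]_(s in (`[a, b]%classic : set LT)) `|F s (z s) - G s (z s)|)
      * weight a K t.
Proof.
move=> K0 ab fF [cy yE] [cz zE] bG.
have bFz := is_field_bounded_meas fF cz; have bFy := is_field_bounded_meas fF cy.
have iFG := bounded_meas_normB bFz bG.
have byz := bounded_meas_normB (within_bounded_meas cy) (within_bounded_meas cz).
apply: (@gronwall a K K0 b) => //.
- by rewrite addr_ge0//; exact: Rintegral_ge0.
- have [_ [M1 h1]] := within_bounded_meas cy; have [_ [M2 h2]] := within_bounded_meas cz.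
  exists (M1 + M2) => s sab; rewrite (le_trans (ler_normB _ _))//.
  by apply: lerD; [exact: h1|exact: h2].
move=> t tab; have /andP[at_ tb] := tab.
have tI : t \in `[a, b] by rewrite in_itv.
have bFz' := bounded_meas_sub (lexx a) tb bFz; have bFy' := bounded_meas_sub (lexx a) tb bFy.
have bG' := bounded_meas_sub (lexx a) tb bG.
have mI := measurable_lebI a t.
have byz' := bounded_meas_normB (bounded_meas_sub (lexx a) tb (within_bounded_meas cy))
  (bounded_meas_sub (lexx a) tb (within_bounded_meas cz)).
rewrite (yE t tI) (zE t tI) opprD addrACA.
apply: le_trans (ler_normD _ _) _; rewrite -[leRHS]addrA lerD2l.
apply: le_trans (ler_distD (vint a t (fun s => F s (z s))) _ _) _.
rewrite addrC; apply: lerD; last first.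
  apply: le_trans (vintB_le bFz' bG') _.
  rewrite /Rintegral fine_le//.
  - by apply: integrable_fin_num (bounded_meas_normB bFz' bG').
  - by apply: integrable_fin_num iFG; exact: measurable_lebI.
  apply: (ge0_subset_integral leb mI (measurable_lebI a b) (measurable_int _ iFG)).
    by move=> s _; rewrite lee_fin.
  by apply: subset_itv; rewrite bnd_simp.
apply: le_trans (vintB_le bFy' bFz') _.
rewrite -(RintegralZl _ mI byz').
apply: (le_Rintegral mI (bounded_meas_normB bFy' bFz')).
  exact: (integrableZl mI _ byz').
move=> s /=; rewrite in_itv/= => /andP[as_ st]; apply: (field_lip fF).
by rewrite as_ (le_trans st).
Qed.

Section existence.
Variables (a b K M : R) (F : R -> 'rV[R]_n -> 'rV[R]_n) (x : 'rV[R]_n).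
Hypotheses (K0 : 0 < K) (M0 : 0 <= M) (ab : a <= b) (fF : is_field a b K M F).

Fixpoint picard (k : nat) : R -> 'rV[R]_n :=
  if k is k'.+1 then fun t => x + vint a t (fun s => F s (picard k' s)) else cst x.

Lemma picard_within k : {within `[a, b], continuous (picard k)}.
Proof.
elim: k => [|k ih]; first by apply: continuous_subspaceT => t; exact: cvg_cst.
apply: (@lip_within _ _ M) => t t' tab t'ab /=.
rewrite opprD addrACA subrr add0r.
apply: (@vint_lip a b M _ M0 (is_field_bounded_meas fF ih)) => // s.
exact: (field_bound fF).
Qed.

(** By [weight_int] each iteration gains a factor 1 / 2 in the weighted norm. *)
Lemma picard_step k t : a <= t <= b ->
  `|picard k.+1 t - picard k t| <= M * (b - a) / 2 ^+ k * weight a K t.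
Proof.
elim: k t => [|k ih] t tab; have /andP[at_ tb] := tab.
  rewrite /= addrC addKr expr0 divr1.
  apply: le_trans (_ : M * (t - a) <= _).
    have b0 : bounded_meas a t (fun s => F s x).
      have /= := is_field_bounded_meas fF (@picard_within 0%N).
      exact: bounded_meas_sub.
    apply: (vint_bound at_ M0 b0).
    by move=> s /andP[as_ st]; apply: (field_bound fF); rewrite as_ (le_trans st).
  apply: (@le_trans _ _ (M * (b - a))).
    by rewrite ler_wpM2l// lerB.
  by rewrite ler_peMr ?weight_ge1// mulr_ge0// subr_ge0.
rewrite [picard k.+2]/= [picard k.+1]/= opprD addrACA subrr add0r.
have bk m : bounded_meas a t (fun s => F s (picard m s)).
  exact: bounded_meas_sub (lexx a) tb (is_field_bounded_meas fF (@picard_within m)).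
have bp m : bounded_meas a t (picard m).
  exact: bounded_meas_sub (lexx a) tb (within_bounded_meas (@picard_within m)).
apply: le_trans (vintB_le (bk k.+1) (bk k)) _.
have mI := measurable_lebI a t; have ip := bounded_meas_normB (bp k.+1) (bp k).
apply: (@le_trans _ _ (K * \int[@leb R]_(s in (`[a, t]%classic : set LT))
   `|picard k.+1 s - picard k s|)).
  rewrite -(RintegralZl _ mI ip).
  apply: (le_Rintegral mI (bounded_meas_normB (bk k.+1) (bk k))).
    exact: (integrableZl mI _ ip).
  move=> s /=; rewrite in_itv/= => /andP[as_ st]; apply: (field_lip fF).
  by rewrite as_ (le_trans st).
have D0 : 0 <= M * (b - a) / 2 ^+ k by rewrite divr_ge0 ?exprn_ge0// mulr_ge0// subr_ge0.
have := @weight_int a K K0 t _ (fun s => `|picard k.+1 s - picard k s|) at_ D0 ip.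
move=> /(_ _)/wrap[].
  by move=> s /andP[as_ st]; apply: ih; rewrite as_ (le_trans st).
by rewrite exprS [2 * _]mulrC invfM mulrA [_ / 2 * weight _ _ _]mulrAC.
Qed.

Let D := M * (b - a) * weight a K b.

Let D0 : 0 <= D.
Proof. by rewrite mulr_ge0 ?expR_ge0// mulr_ge0// subr_ge0. Qed.

Lemma picard_cauchy t k m : a <= t <= b ->
  `|picard (k + m) t - picard k t| <= 2 * D / 2 ^+ k - 2 * D / 2 ^+ (k + m).
Proof.
move=> tab; elim: m => [|m ih]; first by rewrite addn0 !subrr normr0.
apply: le_trans (ler_distD (picard (k + m) t) _ _) _; rewrite addnS.
have := picard_step (k + m) tab; have /andP[_ tb] := tab => H.
have {}H : `|picard (k + m).+1 t - picard (k + m) t| <= D / 2 ^+ (k + m).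
  apply: le_trans H _; rewrite /D mulrAC ler_wpM2r ?invr_ge0 ?exprn_ge0//.
  by rewrite ler_wpM2l ?weight_le// mulr_ge0// subr_ge0.
apply: le_trans (lerD H ih) _; rewrite exprS.
have -> : 2 * D / (2 * 2 ^+ (k + m)) = D / 2 ^+ (k + m).
  by rewrite -mulf_div divff ?mul1r.
have -> : 2 * D / 2 ^+ (k + m) = D / 2 ^+ (k + m) + D / 2 ^+ (k + m).
  by rewrite -mulrA mulr_natl mulr2n.
by move: (2 * D / 2 ^+ k) (D / 2 ^+ (k + m)) => u v; lra.
Qed.

Lemma small_pow2 (E e : R) : 0 <= E -> 0 < e -> exists k, E / 2 ^+ k < e.
Proof.
move=> E0 e0; have [k] := @ltr_add_invr R 0 (e / (E + 1)) ltac:(by rewrite divr_gt0// ltr_wpDl).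
rewrite add0r => ke; exists k.
apply: (@le_lt_trans _ _ (E / k.+1%:R)).
  by rewrite ler_wpM2l// lef_pV2 ?posrE ?exprn_gt0// -natrX ler_nat ltn_expl.
rewrite ltr_pdivrMr// in ke *.
apply: (@le_lt_trans _ _ ((E + 1) * k.+1%:R^-1 * k.+1%:R)).
  by rewrite divfK// lerDl.
rewrite ltr_pM2r// mulrC -ltr_pdivlMr ?ltr_wpDl//.
Qed.

Lemma picard_lim t : a <= t <= b ->
  exists l, forall k, `|l - picard k t| <= 2 * D / 2 ^+ k.
Proof.
move=> tab.
have /cvg_ex[l pl] : cvg (picard k t @[k --> \oo]).
  apply: cauchy_cvg; apply: cauchy_exP => e e0.
  have [k ke] := @small_pow2 (2 * D) e ltac:(by rewrite mulr_ge0) e0.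
  exists (picard k t); exists k => //= m /= km.
  rewrite -ball_normE /= distrC -(subnKC km); apply: le_lt_trans (picard_cauchy _ _ tab) _.
  by apply: le_lt_trans ke; rewrite lerBlDr lerDl divr_ge0// mulr_ge0.
exists l => k; apply/ler_addgt0Pr => e e0.
have /cvgrPdist_lt/(_ e e0)[m _ hm] := pl.
apply: le_trans (ler_distD (picard (k + m) t) _ _) _; rewrite addrC; apply: lerD.
  apply: le_trans (picard_cauchy _ _ tab) _.
  by rewrite lerBlDr lerDl divr_ge0// mulr_ge0.
by apply: ltW; apply: hm => /=; rewrite leq_addl.
Qed.

(** The Picard iterates converge uniformly with an error 2 D / 2 ^ k, which allows
    passing to the limit in the integral equation. *)
Lemma ode_exists : exists y, sol a b F x y.
Proof.
pose y t := if pselect (a <= t <= b) is left tab then projT1 (cid (picard_lim tab)) else 0.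
have yP t k : a <= t <= b -> `|y t - picard k t| <= 2 * D / 2 ^+ k.
  move=> tab; rewrite /y; case: pselect => // tab'.
  by case: (cid _) => l /= /(_ k).
have yL t t' : a <= t <= b -> a <= t' <= b -> `|y t - y t'| <= M * `|t - t'|.
  move=> tab t'ab; apply/ler_addgt0Pr => e e0.
  have [k ke] := @small_pow2 (2 * D) (e / 2) ltac:(by rewrite mulr_ge0) ltac:(by rewrite divr_gt0).
  apply: le_trans (ler_distD (picard k t) _ _) _.
  apply: le_trans (lerD (lexx _) (ler_distD (picard k t') _ _)) _.
  have L : `|picard k t - picard k t'| <= M * `|t - t'|.
    case: k {ke} => [|k] /=; first by rewrite subrr normr0 mulr_ge0.
    rewrite opprD addrACA subrr add0r.
    apply: (@vint_lip a b M _ M0 (is_field_bounded_meas fF (@picard_within k))) => // s.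
    exact: (field_bound fF).
  have H1 := le_trans (yP t k tab) (ltW ke); have H2 := le_trans (yP t' k t'ab) (ltW ke).
  rewrite distrC in H2.
  move: (`|y t - _|) (`|picard k t - _|) (`|_ - y t'|) (M * _) L H1 H2 => u v w z; lra.
have cy : {within `[a, b], continuous y} by exact: lip_within yL.
exists y; split=> // t; rewrite in_itv/= => tab; have /andP[at_ tb] := tab.
apply/eqP; rewrite -subr_eq0 -normr_le0; apply/ler_addgt0Pr => e e0; rewrite add0r.
pose C := 1 + K * (b - a).
have C0 : 0 < C by rewrite /C ltr_wpDr// mulr_ge0 ?subr_ge0// ltW.
have [k ke] := @small_pow2 (2 * D) (e / C) ltac:(by rewrite mulr_ge0) ltac:(by rewrite divr_gt0).
have by_ := bounded_meas_sub (lexx a) tb (is_field_bounded_meas fF cy).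
have bk := bounded_meas_sub (lexx a) tb (is_field_bounded_meas fF (@picard_within k)).
have mI := measurable_lebI a t.
have H2 : `|vint a t (fun s => F s (picard k s)) - vint a t (fun s => F s (y s))| <=
    K * (b - a) * (2 * D / 2 ^+ k).
  apply: le_trans (vintB_le bk by_) _.
  apply: (@le_trans _ _ (\int[@leb R]_(s in (`[a, t]%classic : set LT)) (K * (2 * D / 2 ^+ k)))).
    apply: (le_Rintegral mI (bounded_meas_normB bk by_)).
      by apply: (@integrable_bounded _ _ _ _ `|K * (2 * D / 2 ^+ k)|) => //.
    move=> s /=; rewrite in_itv/= => /andP[as_ st].
    have sab : a <= s <= b by rewrite as_ (le_trans st).
    apply: le_trans (field_lip fF _ _ sab) _.
    by rewrite ler_wpM2l ?(ltW K0)// distrC yP.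
  rewrite (Rintegral_cst leb mI) leb_itv//= mulrAC ler_wpM2r//.
    by rewrite divr_ge0// mulr_ge0.
  by rewrite ler_wpM2l ?(ltW K0)// lerB.
apply: le_trans (ler_distD (picard k.+1 t) _ _) _.
have -> : picard k.+1 t - (x + vint a t (fun s => F s (y s))) =
    vint a t (fun s => F s (picard k s)) - vint a t (fun s => F s (y s)).
  by rewrite /= opprD addrACA subrr add0r.
have H1 := yP t k.+1 tab.
have H3 : 2 * D / 2 ^+ k.+1 <= 2 * D / 2 ^+ k.
  have D20 : 0 <= 2 * D by rewrite mulr_ge0.
  apply: (ler_wpM2l D20); rewrite lef_pV2 ?posrE ?exprn_gt0// exprS.
  by rewrite ler_peMl ?exprn_ge0// ler1n.
apply: le_trans (lerD (le_trans H1 H3) H2) _.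
rewrite -[X in X + _]mul1r -mulrDl -/C mulrC -ler_pdivlMr//; exact: ltW.
Qed.

End existence.
End ode.

(** * Probability kernels *)

Section kernels.
Local Open Scope ereal_scope.

Section pkcomp.
Context d1 d2 d3 (X : measurableType d1) (Y : measurableType d2)
  (Z : measurableType d3) (R : realType).
Variables (l : R.-pker X ~> Y) (k : R.-pker (X * Y) ~> Z).

Definition pkcomp : X -> {measure set Z -> \bar R} := mkcomp l k.

Let pkcomp_measurable A : measurable A -> measurable_fun [set: X] (pkcomp ^~ A).
Proof. exact: measurable_fun_mkcomp_sfinite. Qed.

HB.instance Definition _ := isKernel.Build _ _ _ _ _ pkcomp pkcomp_measurable.

Let pkcomp_prob x : pkcomp x [set: Z] = 1.
Proof.
rewrite /pkcomp /mkcomp/= /kcomp.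
under eq_integral do rewrite prob_kernel.
by rewrite integral_cst// prob_kernel mule1.
Qed.

HB.instance Definition _ :=
  Kernel_isProbability.Build _ _ _ _ _ pkcomp pkcomp_prob.

Lemma pkcompE x A : pkcomp x A = \int[l x]_y k (x, y) A.
Proof. by []. Qed.

Lemma integral_pkcomp x (h : Z -> \bar R) : (forall z, 0 <= h z) ->
  measurable_fun [set: Z] h ->
  \int[pkcomp x]_z h z = \int[l x]_y \int[k (x, y)]_z h z.
Proof. exact: integral_kcomp. Qed.

End pkcomp.

Section kprecomp.
Context d1 d2 d3 (X : measurableType d1) (Y : measurableType d2)
  (Z : measurableType d3) (R : realType).
Variables (k : R.-pker Y ~> Z) (h : X -> Y).
Hypothesis mh : measurable_fun setT h.

(** The measurability proof is an argument so that the kernel structure can be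
    found from it. *)
Definition kprecomp of measurable_fun setT h : X -> {measure set Z -> \bar R} :=
  fun x => k (h x).

Let kprecomp_measurable A : measurable A ->
  measurable_fun [set: X] (kprecomp mh ^~ A).
Proof.
by move=> mA; exact: (measurableT_comp (measurable_kernel k A mA) mh).
Qed.

HB.instance Definition _ :=
  isKernel.Build _ _ _ _ _ (kprecomp mh) kprecomp_measurable.

Let kprecomp_prob x : kprecomp mh x [set: Z] = 1.
Proof. exact: prob_kernel. Qed.

HB.instance Definition _ :=
  Kernel_isProbability.Build _ _ _ _ _ (kprecomp mh) kprecomp_prob.

End kprecomp.

Section kcst.
Context d1 d2 (X : measurableType d1) (Y : measurableType d2) (R : realType).
Variable mu : probability Y R.

Definition kcst : X -> {measure set Y -> \bar R} := fun=> mu.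

Let kcst_measurable A : measurable A -> measurable_fun [set: X] (kcst ^~ A).
Proof. by move=> _; exact: measurable_cst. Qed.

HB.instance Definition _ := isKernel.Build _ _ _ _ _ kcst kcst_measurable.

Let kcst_prob x : kcst x [set: Y] = 1.
Proof. exact: probability_setT. Qed.

HB.instance Definition _ := Kernel_isProbability.Build _ _ _ _ _ kcst kcst_prob.

End kcst.

Lemma measurable_fun_select d1 d2 (X : measurableType d1) (Y : measurableType d2)
    (I : finType) (idx : X -> I) (h : I -> X -> Y) :
  (forall i, measurable [set x | idx x = i]) ->
  (forall i, measurable_fun setT (h i)) ->
  measurable_fun setT (fun x => h (idx x) x).
Proof.
move=> mi mh _ A mA; rewrite setTI.
rewrite (_ : _ @^-1` A = \bigcup_(i in [set: I]) ([set x | idx x = i] `&` h i @^-1` A)).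
  apply: fin_bigcup_measurable => // i _; apply: measurableI => //.
  by rewrite -[X in measurable X]setTI; exact: mh.
by apply/seteqP; split=> [x Ax|x [i _ [<-]]//]; exists (idx x).
Qed.

Section kselect.
Context d1 d2 (X : measurableType d1) (Y : measurableType d2) (R : realType)
  (I : finType).
Variables (k : I -> R.-pker X ~> Y) (idx : X -> I).
Hypothesis midx : forall i, measurable [set x | idx x = i].

Definition kselect of (forall i, measurable [set x | idx x = i]) :
  X -> {measure set Y -> \bar R} := fun x => k (idx x) x.

Let kselect_measurable A : measurable A ->
  measurable_fun [set: X] (kselect midx ^~ A).
Proof.
move=> mA; apply: (measurable_fun_select (h := fun i x => k i x A) midx) => i.
exact: measurable_kernel.
Qed.

HB.instance Definition _ :=
  isKernel.Build _ _ _ _ _ (kselect midx) kselect_measurable.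

Let kselect_prob x : kselect midx x [set: Y] = 1.
Proof. exact: prob_kernel. Qed.

HB.instance Definition _ :=
  Kernel_isProbability.Build _ _ _ _ _ (kselect midx) kselect_prob.

End kselect.

Section krestr.
Context d1 d2 (X : measurableType d1) (Y : measurableType d2) (R : realType).
Variables (k : R.-pker X ~> Y) (C : set Y).
Hypothesis mC : measurable C.

Definition krestr : X -> {measure set Y -> \bar R} :=
  fun x => mrestr (k x) mC.

Let krestr_measurable A : measurable A ->
  measurable_fun [set: X] (krestr ^~ A).
Proof. by move=> mA; apply: measurable_kernel; exact: measurableI. Qed.

HB.instance Definition _ :=
  isKernel.Build _ _ _ _ _ krestr krestr_measurable.

End krestr.

Lemma ge0_integral_mrestr d (Y : measurableType d) (R : realType)
    (m : {measure set Y -> \bar R}) (C : set Y) (mC : measurable C) (h : Y -> \bar R) :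
  (forall y, 0 <= h y) -> measurable_fun setT h ->
  \int[mrestr m mC]_y h y = \int[m]_y ((\1_C y)%:E * h y).
Proof.
move=> h0 mh; have mC' := measurableC mC.
transitivity (\int[mrestr m mC]_(y in C `|` ~` C) h y); first by rewrite setUv.
rewrite ge0_integral_setU//=; last 2 first.
- by rewrite setUv.
- by apply/disj_setPS => x [].
rewrite [X in _ + X](_ : _ = 0) ?adde0; last first.
  apply: null_set_integral => //; first exact: measurable_funTS.
  by rewrite -[LHS]/(m (~` C `&` C)) setIC setICr measure0.
rewrite [RHS](_ : _ = \int[m]_(y in C) h y).
  apply: eq_measure_integral => A mA AC; rewrite -[LHS]/(m (A `&` C)).
  by congr (m _); exact/classical_sets.setIidPl.
rewrite [RHS]integral_mkcond; apply: eq_integral => y _.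
by rewrite patchE indicE; case: ifPn => _; rewrite ?mul1e ?mul0e.
Qed.

Section kcond.
Context d1 d2 d3 (X : measurableType d1) (Y : measurableType d2)
  (W : measurableType d3) (R : realType).
Variables (k : R.-pker X ~> (Y * W)%type) (C : set Y).
Hypothesis mC : measurable C.
Variable (Q0 : probability (Y * W)%type R).

Let mCT : measurable (C `*` [set: W]).
Proof. exact: measurableX. Qed.

(** The law of the second component conditionally on the first one being in [C].
    [Q0] supplies a value when this event has probability zero. *)
Definition kcond : R.-pker X ~> W :=
  pkcomp (knormalize (krestr k mCT) Q0)
    (kdirac (measurableT_comp measurable_snd (measurable_snd : measurable_fun setT (@snd X (Y * W)%type)))).

(** Multiplying by the probability of the event removes the normalization, and
    keeps the formula valid when this probability vanishes. *)
Lemma integral_kcond x (h : W -> \bar R) : (forall w, 0 <= h w) ->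
  measurable_fun setT h ->
  k x (C `*` setT) * \int[kcond x]_w h w =
  \int[k x]_z ((\1_C z.1)%:E * h z.2).
Proof.
move=> h0 mh.
have mh2 : measurable_fun setT (fun z : (Y * W)%type => h z.2).
  exact: (measurableT_comp mh measurable_snd).
have E0 : \int[k x]_z ((\1_C z.1)%:E * h z.2) = \int[krestr k mCT x]_z h z.2.
  rewrite ge0_integral_mrestr//; apply: eq_integral => -[y w] _ /=.
  by rewrite /indic /=; congr ((_ : bool)%:R%:E * _); apply/idP/idP;
    rewrite !inE/= => // -[].
have -> : \int[kcond x]_w h w = \int[knormalize (krestr k mCT) Q0 x]_z h z.2.
  rewrite integral_pkcomp//; apply: eq_integral => z _.
  by rewrite /kdirac/= integral_dirac// diracT mul1e.
set w := k x _; have wE : w = krestr k mCT x setT.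
  by rewrite -[RHS]/(k x (setT `&` (C `*` setT))) setTI.
have wlt : w < +oo.
  apply: (@le_lt_trans _ _ (k x setT)).
    by apply: le_measure; rewrite ?inE.
  by rewrite prob_kernel ltry.
have wfin : w \is a fin_num by rewrite ge0_fin_numE// /w.
have [w0|w0] := eqVneq w 0.
  rewrite w0 mul0e; apply/esym; rewrite E0.
  have krT : krestr k mCT x setT = 0 by rewrite -wE.
  exact: null_set_integral measurableT mh2 krT.
have c0 : (0 <= (fine w)^-1)%R by rewrite invr_ge0; apply: fine_ge0; rewrite /w.
have E : forall A, measurable A -> A `<=` setT ->
    knormalize (krestr k mCT) Q0 x A = mscale (NngNum c0) (krestr k mCT x) A.
  move=> A mA _; have woo : w != +oo by rewrite lt_eqF.
  rewrite -[LHS]/((if (krestr k mCT x setT == 0) || (krestr k mCT x setT == +oo)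
    then fun B => Q0 B
    else fun B => krestr k mCT x B * (fine (krestr k mCT x setT))^-1%:E) A).
  rewrite -wE (negbTE w0) (negbTE woo) /=.
  by rewrite muleC.
rewrite (eq_measure_integral _ E) ge0_integral_mscale// -E0 /= muleA.
rewrite -{1}(fineK wfin) -EFinM divff ?mul1e//.
by apply: contra w0 => /eqP fw0; rewrite -(fineK wfin) fw0.
Qed.

Lemma kcondE x A : measurable A ->
  kcond x A = if (k x (C `*` setT) == 0) || (k x (C `*` setT) == +oo)
    then Q0 (setT `*` A)
    else k x (C `*` A) * (fine (k x (C `*` setT)))^-1%:E.
Proof.
move=> mA.
have mTA : measurable ([set: Y] `*` A) by exact: measurableX.
have -> : kcond x A = knormalize (krestr k mCT) Q0 x (setT `*` A).
  have <- : \int[knormalize (krestr k mCT) Q0 x]_z (\1_(setT `*` A) z)%:E =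
      knormalize (krestr k mCT) Q0 x (setT `*` A).
    by rewrite (integral_indic (knormalize (krestr k mCT) Q0 x) measurableT mTA) setIT.
  rewrite pkcompE; apply: eq_integral => -[y w] _; rewrite /kdirac/= diracE indicE.
  by congr ((_ : bool)%:R%:E); apply/idP/idP; rewrite !inE//= => -[].
have wE : k x (C `*` setT) = krestr k mCT x setT.
  by rewrite -[RHS]/(k x (setT `&` (C `*` setT))) setTI.
rewrite -[LHS]/((if (krestr k mCT x setT == 0) || (krestr k mCT x setT == +oo)
    then fun B => Q0 B
    else fun B => krestr k mCT x B * (fine (krestr k mCT x setT))^-1%:E) (setT `*` A)).
rewrite -wE; case: ifP => // _; congr (_ * _).
rewrite -[LHS]/(k x ((setT `*` A) `&` (C `*` setT))); congr (k x _).
by apply/seteqP; split=> -[y w] /=; tauto.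
Qed.

End kcond.

Section joint.
Context d1 d2 d3 (Z : measurableType d1) (V : measurableType d2)
  (U : measurableType d3) (R : realType).
Variables (mu : probability Z R) (P : R.-pker (Z * V) ~> U).

Let mswap : measurable_fun setT (fun z : (V * Z)%type => (z.2, z.1)).
Proof. by apply: measurable_fun_pair; [exact: measurable_snd|exact: measurable_fst]. Qed.

Let mstate : measurable_fun setT (fun z : ((V * Z) * U)%type => (z.1.2, z.2)).
Proof.
apply: measurable_fun_pair; last exact: measurable_snd.
exact: (measurableT_comp measurable_snd measurable_fst).
Qed.

(** The joint law of the initial state and of the control of Player I, as a kernel
    in the control of Player II. *)
Definition joint : R.-pker V ~> (Z * U)%type :=
  pkcomp (kcst mu : R.-pker V ~> Z) (pkcomp (kprecomp P mswap) (kdirac mstate)).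

Lemma integral_joint v (h : (Z * U)%type -> \bar R) : (forall z, 0 <= h z) ->
  measurable_fun setT h ->
  \int[joint v]_z h z = \int[mu]_x \int[P (x, v)]_u h (x, u).
Proof.
move=> h0 mh; rewrite integral_pkcomp//; apply: eq_integral => x _.
rewrite integral_pkcomp//; apply: eq_integral => u _.
by rewrite /kdirac/= integral_dirac// diracT mul1e.
Qed.

Lemma jointE v (A : set (Z * U)) : measurable A ->
  joint v A = \int[mu]_x P (x, v) (xsection A x).
Proof.
move=> mA.
have <- : \int[joint v]_z (\1_A z)%:E = joint v A by rewrite (integral_indic (joint v) measurableT mA) setIT.
rewrite integral_joint//; last exact/measurable_EFinP/measurable_indic.
apply: eq_integral => x _.
rewrite -[in RHS](setIT (xsection A x)) -(integral_indic _ measurableT); last first.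
  exact: measurable_xsection.
apply: eq_integral => u _; rewrite !indicE; congr ((_ : bool)%:R%:E).
by apply/idP/idP; rewrite !inE /xsection/= inE.
Qed.

Section push.
Context d4 (W : measurableType d4).
Variable m : (V * (Z * U))%type -> W.
Hypothesis mm : measurable_fun setT m.

Definition push : R.-pker V ~> W :=
  pkcomp joint (kdirac mm).

Lemma integral_push v (h : W -> \bar R) : (forall z, 0 <= h z) ->
  measurable_fun setT h ->
  \int[push v]_w h w = \int[joint v]_z h (m (v, z)).
Proof.
move=> h0 mh; rewrite integral_pkcomp//; apply: eq_integral => z _.
by rewrite /kdirac/= integral_dirac// diracT mul1e.
Qed.

Lemma pushE v A : measurable A -> push v A = joint v [set z | A (m (v, z))].
Proof.
move=> mA.
have mA' : measurable [set z | A (m (v, z))].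
  rewrite -[X in measurable X]setTI.
  exact: (measurable_fun_pair2 _ mm).
rewrite pkcompE -[RHS]/(joint v _) -(setIT [set z | A _]).
rewrite -(integral_indic (joint v) measurableT mA').
apply: eq_integral => z _; rewrite /kdirac/= diracE indicE.
by congr ((_ : bool)%:R%:E); apply/idP/idP; rewrite !inE.
Qed.

End push.
End joint.

Section finite_partition.
Context d (Y : measurableType d) (R : realType) (I : finType).
Variable c : Y -> I.
Hypothesis mc : forall i, measurable [set y | c y = i].

Lemma sum_indic_select (h : I -> \bar R) y :
  \sum_(i : I) (\1_[set y' | c y' = i] y)%:E * h i = h (c y).
Proof.
rewrite (bigD1 (c y))//= indicE mem_set// mul1e big1 ?adde0// => i ic.
by rewrite indicE memNset ?mul0e//= => ci; rewrite ci eqxx in ic.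
Qed.

Lemma integral_select (m : {measure set Y -> \bar R}) (h : I -> \bar R) :
  (forall i, 0 <= h i) ->
  \int[m]_y h (c y) = \sum_(i : I) m [set y | c y = i] * h i.
Proof.
move=> h0; under eq_integral do rewrite -sum_indic_select.
rewrite ge0_integral_sum//; last 2 first.
- move=> i; apply: emeasurable_funM => //.
  exact/measurable_EFinP/measurable_indic.
- by move=> i y _; rewrite mule_ge0// lee_fin.
apply: eq_bigr => i _.
under eq_integral do rewrite muleC.
rewrite ge0_integralZl//.
  by rewrite (integral_indic m measurableT (mc i)) setIT muleC.
exact/measurable_EFinP/measurable_indic.
Qed.

Context d2 d3 (X : measurableType d2) (W : measurableType d3).
Variables (L : R.-pker X ~> (Y * W)%type) (Q0 : probability (Y * W)%type R).

(** The law of total expectation, for an integrand that may depend on the cell. *)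
Lemma integral_kcond_sum x (h : I -> W -> \bar R) :
  (forall i w, 0 <= h i w) -> (forall i, measurable_fun setT (h i)) ->
  \sum_(i : I) L x ([set y | c y = i] `*` setT) *
    \int[kcond L (mc i) Q0 x]_w h i w =
  \int[L x]_z h (c z.1) z.2.
Proof.
move=> h0 mh.
under eq_bigr => i _ do rewrite (integral_kcond L (mc i) Q0 x (h0 i) (mh i)).
rewrite -ge0_integral_sum//; last 2 first.
- move=> i; apply: emeasurable_funM.
    apply/measurable_EFinP.
    exact: (measurableT_comp (measurable_indic (mc i)) measurable_fst).
  exact: (measurableT_comp (mh i) measurable_snd).
- by move=> i z _; rewrite mule_ge0// lee_fin.
by apply: eq_integral => z _; exact: (sum_indic_select (h ^~ z.2)).
Qed.

End finite_partition.

Lemma measurable_int_kernel d1 d2 d3 (X : measurableType d1)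
    (Y : measurableType d2) (W : measurableType d3) (R : realType)
    (k : R.-pker Y ~> W) (a : X -> Y) (h : X * W -> \bar R) :
  measurable_fun setT a -> (forall z, 0 <= h z) -> measurable_fun setT h ->
  measurable_fun setT (fun x => \int[k (a x)]_w h (x, w)).
Proof.
move=> ma h0 mh.
exact: (measurable_fun_integral_finite_kernel h (kprecomp k ma)).
Qed.

(** The pattern of all the estimates below: an error [a] everywhere, and an error
    [b] on a bad set. *)
Lemma integral_le_error d (Y : measurableType d) (R : realType)
    (m : {measure set Y -> \bar R}) (h k : Y -> \bar R) (B : set Y) (a b : R) :
  m setT = 1 -> measurable B -> (0 <= a)%R -> (0 <= b)%R ->
  (forall y, 0 <= h y) -> measurable_fun setT h ->
  (forall y, 0 <= k y) -> measurable_fun setT k ->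
  (forall y, h y <= k y + (a + b * \1_B y)%:E) ->
  \int[m]_y h y <= \int[m]_y k y + (a%:E + b%:E * m B).
Proof.
move=> mT mB a0 b0 h0 mh k0 mk hk.
have m1 : measurable_fun setT (fun y => a%:E + b%:E * (\1_B y)%:E).
  apply: emeasurable_funD => //; apply: measurable_funeM.
  exact/measurable_EFinP/measurable_indic.
have e0 y : setT y -> 0 <= a%:E + b%:E * (\1_B y)%:E.
  move=> _; apply: adde_ge0; first by rewrite lee_fin.
  by apply: mule_ge0; rewrite lee_fin.
apply: (@le_trans _ _ (\int[m]_y (k y + (a%:E + b%:E * (\1_B y)%:E)))).
  apply: (ge0_le_integral m measurableT (fun y _ => h0 y) mh).
    exact: emeasurable_funD.
  by move=> y _; apply: le_trans (hk y) _; rewrite EFinD EFinM.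
rewrite (ge0_integralD m measurableT (fun y _ => k0 y) mk e0 m1).
rewrite (integral_affine_indic m measurableT mB a0 b0) setIT.
by rewrite mT mule1.
Qed.

End kernels.

Section kprob.
Context d1 d2 (X : measurableType d1) (Y : measurableType d2) (R : realType).
Variables (k : R.-pker X ~> Y) (x : X).
Definition kprob : set Y -> \bar R := k x.
HB.instance Definition _ := Measure.on kprob.
Let kprob_setT : kprob setT = 1%E. Proof. exact: prob_kernel. Qed.
HB.instance Definition _ := Measure_isProbability.Build _ _ _ kprob kprob_setT.
End kprob.

Section glue_kernel.
Context d1 d2 d3 d4 d5 (Z : measurableType d1) (V : measurableType d2)
  (U : measurableType d3) (V1 : measurableType d4) (U1 : measurableType d5)
  (R : realType) (J : finType).
Variables (P : R.-pker (Z * V) ~> U) (Q : J -> R.-pker V1 ~> U1).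
Variables (hld : V -> V) (ct : V -> V1) (idx : Z -> V -> U -> J) (cc : U -> U1 -> U).
Hypothesis mhld : measurable_fun setT hld.
Hypothesis mct : measurable_fun setT ct.
Hypothesis midx : forall j, measurable [set z : Z * V * U | idx z.1.1 z.1.2 z.2 = j].
Hypothesis mcc : measurable_fun setT (fun z : U * U1 => cc z.1 z.2).

(** Draw [u] from [P] against the modified control [hld v], then [u'] from the
    kernel [Q] selected by the outcome, and combine the two. The values of the
    composed kernel give its delay, and the integrals its payoff. *)
Lemma glue_kernel : exists S : R.-pker (Z * V) ~> U,
  (forall x v B, measurable B ->
     S (x, v) B = \int[P (x, hld v)]_u (Q (idx x v u) (ct v) [set u' | B (cc u u')]))%E /\
  (forall x v (h : U -> \bar R), (forall u, 0 <= h u)%E -> measurable_fun setT h ->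
     \int[S (x, v)]_u h u =
     \int[P (x, hld v)]_u \int[Q (idx x v u) (ct v)]_u' h (cc u u'))%E.
Proof.
have m1 : measurable_fun setT (fun z : (Z * V)%type => (z.1, hld z.2)).
  apply: measurable_fun_pair; first exact: measurable_fst.
  exact: (measurableT_comp mhld measurable_snd).
have m2 : measurable_fun setT (fun z : (Z * V * U)%type => ct z.1.2).
  exact: (measurableT_comp mct (measurableT_comp measurable_snd measurable_fst)).
have m3 : measurable_fun setT (fun z : (Z * V * U * U1)%type => cc z.1.2 z.2).
  have m : measurable_fun setT (fun z : (Z * V * U * U1)%type => (z.1.2, z.2)).
    apply: measurable_fun_pair; last exact: measurable_snd.
    exact: (measurableT_comp measurable_snd measurable_fst).
  exact: (measurableT_comp mcc m).
pose sel : R.-pker (Z * V * U) ~> U1 := kselect (fun j => kprecomp (Q j) m2) midx.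
pose S : R.-pker (Z * V) ~> U :=
  pkcomp (kprecomp P m1) (pkcomp sel (kdirac m3)).
have SE x v (h : U -> \bar R) : (forall u, 0 <= h u)%E -> measurable_fun setT h ->
     (\int[S (x, v)]_u h u =
     \int[P (x, hld v)]_u \int[Q (idx x v u) (ct v)]_u' h (cc u u'))%E.
  move=> h0 mh; rewrite integral_pkcomp//; apply: eq_integral => u _.
  rewrite integral_pkcomp//; apply: eq_integral => u' _.
  by rewrite /kdirac/= integral_dirac// diracT mul1e.
exists S; split => // x v B mB.
have m1B : measurable_fun setT (fun u : U => (\1_B u)%:E : \bar R).
  exact/measurable_EFinP/measurable_indic.
have <- : (\int[S (x, v)]_u (\1_B u)%:E = S (x, v) B)%E.
  by rewrite (integral_indic (S (x, v)) measurableT mB) setIT.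
rewrite SE//; apply: eq_integral => u _; pose A := [set u' | B (cc u u')].
have mA : measurable A.
  rewrite -[X in measurable X]setTI.
  exact: (measurableT_comp mcc (pair1_measurable u)).
have <- : (\int[Q (idx x v u) (ct v)]_u' (\1_A u')%:E = Q (idx x v u) (ct v) A)%E.
  by rewrite (integral_indic (Q (idx x v u) (ct v)) measurableT mA) setIT.
by apply: eq_integral => u' _; rewrite !indicE; congr ((_ : bool)%:R%:E);
  apply/idP/idP; rewrite !inE.
Qed.

End glue_kernel.

Lemma integral_shift d (Y : measurableType d) (R : realType)
    (m : {measure set Y -> \bar R}) (h : Y -> R) (b a : R) :
  m setT = 1%E -> measurable_fun setT h -> (forall y, `|h y| <= b) ->
  (\int[m]_y (h y + a)%:E = \int[m]_y (h y)%:E + a%:E)%E.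
Proof.
move=> mT mh hb.
have mfin : (m setT < +oo)%E by rewrite mT ltry.
have bi (k : Y -> R) (b' : R) : measurable_fun setT k -> (forall y, `|k y| <= b') ->
    m.-integrable setT (EFin \o k).
  move=> mk kb; apply: measurable_bounded_integrable => //.
  exists b'; split; first exact: num_real.
  by move=> r br y _ /=; exact: le_trans (kb y) (ltW br).
have ih := bi h b mh hb; have ia := bi (cst a) `|a| (measurable_cst _) (fun=> lexx _).
under eq_integral do rewrite EFinD.
rewrite [LHS](integralD measurableT ih ia); congr (_ + _)%E.
by rewrite [LHS](integral_cst m measurableT a%:E) mT mule1.
Qed.

Lemma integral_prob_le d (Y : measurableType d) (R : realType)
    (m : {measure set Y -> \bar R}) (h : Y -> \bar R) (b : R) :
  m setT = 1%E -> measurable_fun setT h -> (forall y, 0 <= h y <= b%:E)%E ->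
  (0 <= \int[m]_y h y <= b%:E)%E.
Proof.
move=> mT mh hb; apply/andP; split.
  by apply: integral_ge0 => y _; case/andP : (hb y).
apply: (@le_trans _ _ (\int[m]_y (cst b%:E) y)%E).
  apply: ge0_le_integral => //; first by move=> y _; case/andP : (hb y).
  by move=> y _; case/andP : (hb y).
by rewrite integral_cst// mT mule1.
Qed.

(** * Probability measures on the state space *)

Section dist_to_set.
Context {R : realType} {n : nat}.
Implicit Types (F O : set 'rV[R]_n).

Definition dist_set F (x : 'rV[R]_n) : R := inf [set `|x - y| | y in F].

Lemma dist_set_has_inf F x : F !=set0 -> has_inf [set `|x - y| | y in F].
Proof.
move=> [y Fy]; split; first by exists `|x - y|; exists y.
by exists 0 => _ [z _ <-].
Qed.

Lemma dist_set_lip F x x' : F !=set0 ->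
  dist_set F x - dist_set F x' <= `|x - x'|.
Proof.
move=> F0; rewrite lerBlDl -lerBlDr.
apply: lb_le_inf; first by case: (dist_set_has_inf x' F0).
move=> _ [y Fy <-]; rewrite lerBlDr.
apply: le_trans (ge_inf (dist_set_has_inf x F0).2 _) _; first by exists y.
by rewrite [leRHS]addrC; exact: ler_distD.
Qed.

Lemma dist_set_ge0 F x : F !=set0 -> 0 <= dist_set F x.
Proof.
move=> F0; apply: lb_le_inf; first by case: (dist_set_has_inf x F0).
by move=> _ [y _ <-].
Qed.

(** These functions increase with [m] to the indicator of [O], when [O] is open
    and is not the whole space. *)
Definition bump O (m : nat) (x : 'rV[R]_n) : R :=
  Num.min 1 (m%:R * dist_set (~` O) x).

Lemma bump_continuous O m : (~` O) !=set0 -> continuous (bump O m).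
Proof.
move=> O0; apply: (@uniformly_continuous_real _ 'rV[R]_n) => e e0.
exists (e / m.+1%:R); first by rewrite divr_gt0.
move=> x y; rewrite mx_norm_ball /ball_/= => xy.
have L a b : `|Num.min 1 a - Num.min 1 b| <= `|a - b| :> R.
  rewrite /Num.min; case: ltP => a1; case: ltP => b1;
    rewrite ?subrr ?normr0 //.
  - by rewrite !ger0_norm ?subr_ge0 ?lerD2r// ltW// (le_lt_trans b1).
  - rewrite distrC [leRHS]distrC.
    by rewrite !ger0_norm ?subr_ge0 ?lerD2r// ltW// (le_lt_trans a1).
apply: le_lt_trans (L _ _) _; rewrite -mulrBr normrM ger0_norm//.
apply: (@le_lt_trans _ _ (m%:R * `|x - y|)).
  rewrite ler_wpM2l// ler_norml dist_set_lip// andbT lerNl opprB.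
  by rewrite distrC dist_set_lip.
apply: (@le_lt_trans _ _ (m.+1%:R * `|x - y|)).
  by rewrite ler_wpM2r// ler_nat.
by rewrite mulrC -ltr_pdivlMr.
Qed.

Lemma bump_ge0 O m x : (~` O) !=set0 -> 0 <= bump O m x.
Proof. by move=> O0; rewrite /bump le_min ler01 mulr_ge0// dist_set_ge0. Qed.

Lemma bump_le1 O m x : bump O m x <= 1.
Proof. by rewrite /bump ge_min lexx. Qed.

Lemma bump_nd O x : (~` O) !=set0 -> {homo bump O ^~ x : a b / (a <= b)%N >-> a <= b}.
Proof.
move=> O0 a b ab; rewrite /bump le_min ge_min lexx/= ge_min.
by rewrite ler_wpM2r ?orbT ?ler_nat// dist_set_ge0.
Qed.

Lemma bump_cvg O x : open O -> (~` O) !=set0 -> bump O m x @[m --> \oo] --> (\1_O x : R).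
Proof.
move=> oO O0; have [Ox|nOx] := pselect (O x); last first.
  have d0 : dist_set (~` O) x = 0.
    apply/eqP; rewrite eq_le dist_set_ge0// andbT.
    apply: le_trans (ge_inf (dist_set_has_inf x O0).2 _) _; first by exists x.
    by rewrite subrr normr0.
  rewrite indicE memNset//= (_ : (fun m => _) = cst 0); first exact: cvg_cst.
  by apply/funext => m; rewrite /bump d0 mulr0 min_r.
rewrite indicE mem_set//=.
have /nbhs_ballP[e /= e0 eO] : nbhs (x : 'rV[R]_n) O by exact: open_nbhs_nbhs.
have de : e <= dist_set (~` O) x.
  apply: lb_le_inf; first by case: (dist_set_has_inf x O0).
  move=> _ [y nOy <-]; rewrite leNgt; apply/negP => xye; apply: nOy; apply: eO.
  by rewrite mx_norm_ball.
have [k ke] := @ltr_add_invr R 0 e e0; rewrite add0r in ke.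
apply: cvg_near_cst; exists k.+1 => // m /= km; rewrite /bump min_l//.
apply: (@le_trans _ _ (k.+1%:R * e)).
  by rewrite -ler_pdivrMl// mulr1 ltW.
by apply: ler_pM => //; [exact: ltW|rewrite ler_nat].
Qed.

End dist_to_set.

Section measure_eq.
Context {R : realType} {n : nat}.
Notation ZT := (borelType 'rV[R]_n).

(** The bumps identify the two measures on the open sets, which are stable under
    intersection and generate the Borel sets. *)
Lemma bounded_continuous_eq (m1 m2 : probability ZT R) :
  (forall h : 'rV[R]_n -> R, continuous h -> bounded_fun h -> (forall x, 0 <= h x) ->
    (\int[m1]_x (h x)%:E = \int[m2]_x (h x)%:E)%E) ->
  forall A : set ZT, measurable A -> m1 A = m2 A.
Proof.
move=> hm.
have mb O m : open O -> (~` O) !=set0 -> measurable_fun setT ((EFin \o bump O m) : ZT -> \bar R).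
  move=> oO O0; apply/measurable_EFinP.
  exact: (continuous_borel_real (@bump_continuous _ _ O m O0)).
have cv (m : probability ZT R) O : open O -> (~` O) !=set0 ->
    (\int[m]_x (bump O k x)%:E @[k --> \oo] --> m O)%E.
  move=> oO O0.
  have <- : (\int[m]_x (\1_O x)%:E = m O)%E.
    by rewrite (integral_indic m measurableT (open_borel oO)) setIT.
  have bc x : ((bump O k x)%:E @[k --> \oo] --> (\1_O x)%:E)%E.
    by apply/fine_cvgP; split; [exact: nearW|exact: bump_cvg].
  have -> : (\int[m]_x (\1_O x)%:E = \int[m]_x lim ((bump O k x)%:E @[k --> \oo]))%E.
    by apply: eq_integral => x _; apply/esym/cvg_lim.
  apply: (@cvg_monotone_convergence _ _ _ m _ measurableT
    (fun k x => (bump O k x)%:E) (fun k => mb O k oO O0)).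
  - by move=> k x _; rewrite lee_fin bump_ge0.
  - by move=> x _ k l kl; rewrite lee_fin; exact: bump_nd.
have oE W : open W -> m1 W = m2 W.
  move=> oW; have [W0|/nonemptyPn W0] := pselect ((~` W) !=set0); last first.
    have -> : W = setT by rewrite -(setCK W) W0 setC0.
    by rewrite !probability_setT.
  have h1 := cv m1 W oW W0; have := cv m2 W oW W0.
  have E k : (\int[m2]_x (bump W k x)%:E = \int[m1]_x (bump W k x)%:E)%E.
    apply/esym/hm.
    - exact: (@bump_continuous _ _ W k W0).
    - exists 1; split; first exact: num_real.
      move=> r r1 x _ /=; rewrite ger0_norm; last exact: bump_ge0.
      exact: le_trans (bump_le1 W k x) (ltW r1).
    - by move=> x; exact: bump_ge0.
  under eq_fun => k do rewrite E.
  by move=> h2; exact: (cvg_unique _ h1 h2).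
move=> A mA; pose opens : set (set ZT) := @open 'rV[R]_n.
have mG : @measurable _ ZT = <<s opens >> by [].
have oI : setI_closed opens by move=> B C oB oC; exact: openI.
have oT : forall k : nat, opens ((fun=> setT) k) by move=> _; exact: openT.
have cT : \bigcup_(k : nat) ((fun=> setT) k : set ZT) = setT.
  by apply/seteqP; split => // x _; exists 0%N.
have m1T (k : nat) : (m1 ((fun=> setT) k) < +oo)%E.
  by rewrite /= probability_setT ltry.
exact: (@measure_unique _ R ZT opens (fun=> setT) mG oI oT cT m1 m2 oE m1T A mA).
Qed.

End measure_eq.

Section cells.
Context {R : realType} {N : nat}.
Notation ZT := (borelType 'rV[R]_N).

Lemma measurable_norm_ball (y : 'rV[R]_N) (d : R) :
  measurable ([set z | `|(z : 'rV[R]_N) - y| < d] : set ZT).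
Proof.
have := measurable_normB (@measurable_id _ ZT setT) (@measurable_cst _ _ _ _ _ (y : ZT)).
move=> /(_ measurableT `]-oo, d[%classic (measurable_itv _)).
by rewrite setTI; congr measurable; apply/seteqP; split => x /=; rewrite in_itv.
Qed.

Lemma measurable_norm_gt (r : R) :
  measurable ([set z | r < `|z : 'rV[R]_N|] : set ZT).
Proof.
have := measurable_normB (@measurable_id _ ZT setT) (@measurable_cst _ _ _ _ _ (0 : ZT)).
move=> /(_ measurableT `]r, +oo[%classic (measurable_itv _)).
by rewrite setTI; congr measurable; apply/seteqP; split => x /=;
  rewrite in_itv/= andbT subr0.
Qed.

Lemma measurable_find (l : seq 'rV[R]_N) (d : R) (k : nat) :
  measurable ([set z | find (fun y => `|(z : 'rV[R]_N) - y| < d) l = k] : set ZT).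
Proof.
elim: l k => [|y l ih] k /=.
  case: k => [|k]; first by rewrite (_ : mkset _ = setT)//; apply/seteqP; split.
  by rewrite (_ : mkset _ = set0)//; apply/seteqP; split.
pose A : set ZT := [set z | `|(z : 'rV[R]_N) - y| < d].
have mA : measurable A by exact: measurable_norm_ball.
case: k => [|k].
  rewrite (_ : mkset _ = A)//; apply/seteqP; split=> z /=; first by case: ifP.
  by move=> ->.
rewrite (_ : mkset _ = ~` A `&` [set z : ZT | find (fun y => `|(z : 'rV[R]_N) - y| < d) l = k]).
  by apply: measurableI => //; exact: measurableC.
apply/seteqP; split=> z /=.
  by rewrite /A /=; case: ifP => // _ [].
by move=> [/negP/negbTE -> ->].
Qed.

(** The cell of [z] is the index of the first point of a finite net of the ball of
    radius [r] that is close to [z]; the points far from the net share the last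
    index. *)
Lemma cells_exist (r d : R) : 0 < d ->
  exists (m : nat) (c : 'rV[R]_N -> 'I_m.+1) (ctr : 'I_m.+1 -> 'rV[R]_N),
    (forall i, measurable ([set z | c z = i] : set ZT)) /\
    (forall z, ~ (r < `|z|) -> `|z - ctr (c z)| <= d).
Proof.
move=> d0.
have cB : compact [set z : 'rV[R]_N | `|z| <= r].
  apply: bounded_closed_compact.
    exists r; split; first exact: num_real.
    by move=> s rs z /= zr; exact: le_trans (ltW rs).
  apply: closed_comp (@closed_le R r) => z _; exact: norm_continuous.
have [l [_ lB]] := compact_net cB d0.
pose c (z : 'rV[R]_N) : 'I_(size l).+1 := inord (find (fun y => `|z - y| < d) l).
exists (size l), c, (fun i => nth 0 l i); split=> [i|z /negP].
  have -> : [set z | c z = i] = [set z | find (fun y => `|z - y| < d) l = i].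
    apply/seteqP; split=> z /=; first by move=> <-; rewrite inordK// ltnS find_size.
    by rewrite /c => ->; rewrite inord_val.
  exact: measurable_find.
rewrite -leNgt => zr; have [y yl zy] := lB z zr.
have hl : has (fun y => `|z - y| < d) l by apply/hasP; exists y.
have := nth_find 0 hl; rewrite /c inordK; first exact: ltW.
by rewrite ltnS find_size.
Qed.

(** Continuity from above along the complements of the balls of integer radius. *)
Lemma tight (mu : probability ZT R) (e : R) : 0 < e ->
  exists r : R, (mu [set z : ZT | (r < `|z : 'rV[R]_N|)%R] <= e%:E)%E.
Proof.
move=> e0; pose D (k : nat) : set ZT := [set z | k%:R < `|z : 'rV[R]_N|].
have mD k : measurable (D k) by exact: measurable_norm_gt.
have D0 : \bigcap_k D k = set0.
  apply/seteqP; split=> // z Dz.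
  have := Dz (Num.truncn `|z : 'rV[R]_N|).+1 Logic.I; rewrite /D /= ltNge => /negP; apply.
  by rewrite ltW// truncnS_gt.
have cD : (mu \o D) k @[k --> \oo] --> (0 : \bar R)%E.
  rewrite -(measure0 mu) -D0; apply: nonincreasing_cvg_mu => //.
  - by apply: le_lt_trans (probability_le1 _ _) _ => //; rewrite ltry.
  - by rewrite D0.
  - move=> m n mn; apply/subsetPset => z; rewrite /D /=; apply: le_lt_trans.
    by rewrite ler_nat.
have /cD[k _ /(_ k (leqnn k)) /= kE] : nbhs (0 : \bar R)%E [set x | (x < e%:E)%E].
  by apply: open_nbhs_nbhs; split; [exact: open_ereal_lt_ereal|rewrite /= lte_fin].
by exists k%:R; exact: ltW.
Qed.

End cells.

(** * Cutting and concatenating controls *)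

Section surgery.
Context {R : realType} {p : nat}.
Variables (U : control_set R p) (t0 T : R).
Implicit Types (s : R) (u : control U t0 T).

Definition extend s (r : control U t0 s) : control U t0 T :=
  paste U t0 T s r (point : control U s T).

Definition cut s u : control U s T :=
  paste U s T s (point : control U s s) u.

(** The control [u] frozen at time [s]. It is a function of the restriction of [u]
    to [t0, s], see [hold_eq], which is what makes delays possible. *)
Definition hold s u : control U t0 T :=
  paste U t0 T s u (point : control U s T).

Definition concat s u (u' : control U s T) : control U t0 T :=
  paste U t0 T s u u'.

Lemma splicel s (a b : R -> 'rV[R]_p) : coincide t0 s (splice s a b) a.
Proof.
apply: (@coincide_catr _ _ _ s); last exact: coincide_point.
by move=> x /andP[_ xs]; rewrite /splice xs.
Qed.

Lemma splicer s (a b : R -> 'rV[R]_p) : coincide s T (splice s a b) b.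
Proof. by apply: coincide_ext => x /andP[sx _]; rewrite /splice ltNge sx. Qed.

Lemma extendE s (r : control U t0 s) : s <= T -> coincide t0 s (extend r) r.
Proof.
move=> sT; apply: coincide_trans (splicel _ _ _).
exact: coincide_sub (lexx _) sT (pasteE _ _ (lexx s) (lexx s)).
Qed.

Lemma cutE s u : t0 <= s -> coincide s T (cut s u) u.
Proof.
move=> ts; apply: coincide_trans (splicer _ _ _).
exact: pasteE (lexx s) ts.
Qed.

Lemma holdE s u : s <= T -> coincide t0 s (hold s u) u.
Proof.
move=> sT; apply: coincide_trans (splicel _ _ _).
exact: coincide_sub (lexx _) sT (pasteE _ _ sT (lexx s)).
Qed.

Lemma hold_eq s u u' : s <= T -> coincide t0 s u u' -> hold s u = hold s u'.
Proof.
move=> sT uu; apply: control_inj.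
apply: coincide_trans (pasteE _ _ sT (lexx s)) _.
apply: coincide_trans _ (coincide_sym (pasteE _ _ sT (lexx s))).
apply: (@coincide_cat _ _ _ s).
  apply: coincide_trans (splicel _ _ _) _.
  by apply: coincide_trans uu _; exact: coincide_sym (splicel _ _ _).
by apply: coincide_trans (splicer _ _ _) _; exact: coincide_sym (splicer _ _ _).
Qed.

Lemma concatl s u (u' : control U s T) : s <= T -> coincide t0 s (concat u u') u.
Proof.
move=> sT; apply: coincide_trans (splicel _ _ _).
exact: coincide_sub (lexx _) sT (pasteE _ _ sT (lexx s)).
Qed.

Lemma concatr s u (u' : control U s T) : t0 <= s -> s <= T ->
  coincide s T (concat u u') u'.
Proof.
move=> ts sT; apply: coincide_trans (splicer _ _ _).
exact: coincide_sub ts (lexx T) (pasteE _ _ sT (lexx s)).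
Qed.

Let sepU (a b : R) : separable (control U a b). Proof. exact: separable_control. Qed.

Lemma measurable_extend s : t0 <= s -> s <= T ->
  measurable_fun setT (extend (s := s) :
    borelType (control U t0 s) -> borelType (control U t0 T)).
Proof.
move=> ts sT; apply: measurable_paste => //.
by rewrite ts.
Qed.

Lemma measurable_cut s : t0 <= s -> s <= T ->
  measurable_fun setT (cut s :
    borelType (control U t0 T) -> borelType (control U s T)).
Proof.
move=> ts sT; apply: measurable_paste => //.
by rewrite lexx.
Qed.

Lemma measurable_hold s : t0 <= s -> s <= T ->
  measurable_fun setT (hold s :
    borelType (control U t0 T) -> borelType (control U t0 T)).
Proof.
move=> ts sT; apply: measurable_paste => //.
by rewrite ts.
Qed.

Lemma measurable_concat s d (S : measurableType d)
    (a : S -> control U t0 T) (b : S -> control U s T) : t0 <= s -> s <= T ->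
  measurable_fun setT (a : S -> borelType (control U t0 T)) ->
  measurable_fun setT (b : S -> borelType (control U s T)) ->
  measurable_fun setT ((fun z => concat (a z) (b z)) : S -> borelType (control U t0 T)).
Proof. by move=> ts sT; apply: measurable_paste => //; rewrite ts. Qed.

Lemma control_restrictE s (sT : s <= T) u : coincide t0 s (control_restrict sT u) u.
Proof. exact: control_mkK. Qed.

Lemma measurable_restrict s (sT : s <= T) :
  measurable_fun setT (control_restrict sT :
    borelType (control U t0 T) -> borelType (control U t0 s)).
Proof.
apply: (measurable_control (sepU _ _) measurableT) => w.
have cw := control_reprP w.
have E u : L1_dist (control_restrict sT u) w = L1_gap t0 s u w.
  apply: eq_L1_gap (control_reprP _) _ cw (control_restrictE sT u).
  exact: is_control_sub (lexx _) sT (control_reprP u).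
under eq_fun do rewrite E.
exact: measurable_L1_gap.
Qed.

End surgery.

Section delay.
Context {R : realType} {N p q : nat}.
Variables (T : R) (U : control_set R p) (V : control_set R q).
Notation kernel_at t0 :=
  (R.-pker (borelType 'rV[R]_N * borelType (control V t0 T)) ~>
     borelType (control U t0 T)).

(** The events known to an observer of the control up to time [s]. *)
Definition determined (t0 s : R) (B : set (control U t0 T)) : Prop :=
  forall u u' : control U t0 T, coincide t0 s u u' -> B u -> B u'.

(** An event about the restricted control pulls back to an event determined at
    time [s]; conversely, a determined event is the pull-back of its preimage under
    [extend]. This form avoids spaces of controls with varying intervals. *)
Lemma has_delayP (t0 tau : R) (P : kernel_at t0) : t0 <= T -> 0 < tau ->
  has_delay tau P <->
  (forall (t : R) (v1 v2 : control V t0 T), t0 <= t <= T -> coincide t0 t v1 v2 ->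
   forall x (B : set (borelType (control U t0 T))), measurable B ->
     determined (Num.min (t + tau) T) B -> P (x, v1) B = P (x, v2) B).
Proof.
move=> t0T tau0; split=> [hP t v1 v2 tI vv x B mB dB|hP t v1 v2 tI vv sT x restr A mA].
  have /andP[t0t tT] := tI.
  set s := Num.min (t + tau) T in dB.
  have sT : s <= T by rewrite /s ge_min lexx orbT.
  have t0s : t0 <= s by rewrite /s le_min t0T andbT (le_trans t0t)// lerDl ltW.
  pose E := (@extend _ _ U t0 T s) @^-1` B.
  have mE : measurable (E : set (borelType (control U t0 s))).
    by rewrite -[X in measurable X]setTI; exact: measurable_extend.
  have ext (u : control U t0 T) : coincide t0 s (extend T (control_restrict sT u)) u.
    have H1 := extendE (control_restrict sT u) sT.
    exact: coincide_trans H1 (control_restrictE sT u).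
  have EB : control_restrict sT @^-1` E = B.
    apply/seteqP; split => u Bu.
      exact: (dB _ u (ext u) Bu).
    exact: (dB u _ (coincide_sym (ext u)) Bu).
  have := hP t v1 v2 _ vv sT x E mE; rewrite in_itv/= => /(_ tI).
  by rewrite /pushforward EB.
apply: (hP t v1 v2 _ vv x); first by rewrite in_itv in tI.
  by rewrite -[X in measurable X]setTI; exact: measurable_restrict.
move=> u u' uu; rewrite /preimage/=; suff -> : restr u = restr u' by [].
apply: control_inj; apply: coincide_trans (control_restrictE sT u) _.
by apply: coincide_trans uu _; exact: coincide_sym (control_restrictE sT u').
Qed.

End delay.

(** * Extended real suprema and grids *)

Section shift.
Context {R : realType} (Y : Type).
Implicit Types (A : set Y) (F : Y -> \bar R) (b : R).
Local Open Scope ereal_scope.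

Lemma ereal_sup_shift A F b :
  ereal_sup [set F y + b%:E | y in A] = ereal_sup [set F y | y in A] + b%:E.
Proof.
apply/eqP; rewrite eq_le; apply/andP; split.
  apply: ge_ereal_sup => _ [y Ay <-]; rewrite leeD2r//.
  by apply: ereal_sup_ubound; exists y.
rewrite -leeBrDr//; apply: ge_ereal_sup => _ [y Ay <-]; rewrite leeBrDr//.
by apply: ereal_sup_ubound; exists y.
Qed.

Lemma ereal_inf_shift A F b :
  ereal_inf [set F y + b%:E | y in A] = ereal_inf [set F y | y in A] + b%:E.
Proof.
apply/eqP; rewrite eq_le; apply/andP; split; last first.
  apply: le_ereal_inf_tmp => _ [y Ay <-]; rewrite leeD2r//.
  by apply: ereal_inf_lbound; exists y.
rewrite -leeBlDr//; apply: le_ereal_inf_tmp => _ [y Ay <-]; rewrite leeBlDr//.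
by apply: ereal_inf_lbound; exists y.
Qed.

End shift.

Section nonneg_sup.
Context {R : realType}.
Local Open Scope ereal_scope.

Lemma sup_nonneg_cases (Y : pointedType) (F : Y -> \bar R) : (forall y, 0 <= F y) ->
  ereal_sup [set F y | y in [set: Y]] = +oo \/
  exists a : R, ereal_sup [set F y | y in [set: Y]] = a%:E /\ forall y, F y <= a%:E.
Proof.
move=> F0.
have Fs y : F y <= ereal_sup [set F y | y in [set: Y]].
  by apply: ereal_sup_ubound; exists y.
case: (ereal_sup _) Fs => [a||] Fs; [by right; exists a|by left|].
by have := le_trans (F0 point) (Fs point); rewrite leeNy_eq.
Qed.

End nonneg_sup.

(** For [j] the integer part of n x, the hypothesis gives n y >= j > n x - 1. *)
Lemma grid_near {R : realType} (x y : R) n : (0 < n)%N -> 0 <= x <= 1 ->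
  (forall j : 'I_n.+1, (j%:R <= n%:R * x) = (j%:R <= n%:R * y)) ->
  x <= y + n%:R^-1.
Proof.
move=> n0 /andP[x0 x1] xy; have nx0 : 0 <= n%:R * x by rewrite mulr_ge0.
pose j := Num.truncn (n%:R * x).
have jn : (j < n.+1)%N.
  rewrite ltnS -(ler_nat R); apply: le_trans (_ : n%:R * x <= _).
    by rewrite truncn_le.
  by rewrite -[leRHS]mulr1 ler_wpM2l.
have := xy (Ordinal jn); rewrite /= truncn_le nx0 => /esym jy.
have jx : n%:R * x < j%:R + 1 by have := truncnS_gt (n%:R * x); rewrite -natr1.
have n0' : 0 < n%:R :> R by rewrite ltr0n.
rewrite -(ler_pM2l n0') mulrDr mulfV ?gt_eqF//.
by apply: ltW; apply: lt_le_trans jx _; rewrite lerD2r.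
Qed.

(** * Trajectories *)

Section game.
Context {R : realType} {N p q : nat}.
Variables (T : R) (U : control_set R p) (V : control_set R q).
Variables (f : 'rV[R]_N -> 'rV[R]_p -> 'rV[R]_q -> 'rV[R]_N).
Variables (M K : R).
Hypotheses (M0 : 0 <= M) (K0 : 0 < K).
Hypothesis fM : forall x u v, control_values U u -> control_values V v ->
  `|f x u v| <= M.
Hypothesis fK : forall u v, control_values U u -> control_values V v ->
  forall x y, `|f x u v - f y u v| <= K * `|x - y|.
Hypothesis f_ucont : forall e : R, 0 < e -> exists2 d : R, 0 < d &
     forall x x' u u' v v', control_values U u -> control_values U u' ->
       control_values V v -> control_values V v' ->
       `|x - x'| < d -> `|u - u'| < d -> `|v - v'| < d ->
       `|f x u v - f x' u' v'| < e.
Notation LT := (lebesgueType R).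
Notation ZT := (borelType 'rV[R]_N).
Notation UT s := (borelType (control U s T)).
Notation VT s := (borelType (control V s T)).
Notation kernel_at t0 := (R.-pker (ZT * VT t0) ~> UT t0).

Definition field_of (u : R -> 'rV[R]_p) (v : R -> 'rV[R]_q) (s : R) (x : 'rV[R]_N) :=
  f x (u s) (v s).

(** The field is continuous only relative to the values of the controls, whence
    [measurable_fun_comp_within]. *)
Lemma is_field_field_of a b u v : is_control U a b u -> is_control V a b v ->
  is_field a b K M (field_of u v).
Proof.
move=> [mu Uu] [mv Vv]; split.
- move=> y cy; have mI := measurable_lebI a b.
  have [my _] := within_bounded_meas cy.
  apply: (measurable_fun_rV mI) => i.
  pose Q : set ('rV[R]_N * 'rV[R]_p * 'rV[R]_q)%type :=
    [set z | control_values U z.1.2 /\ control_values V z.2].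
  pose h (s : LT) := (y s, u s, v s).
  have mh : measurable_fun (`[a, b]%classic : set LT)
      (h : LT -> borelType ('rV[R]_N * 'rV[R]_p * 'rV[R]_q)%type).
    have myu : measurable_fun (`[a, b]%classic : set LT)
        ((fun s => (y s, u s)) : LT -> borelType ('rV[R]_N * 'rV[R]_p)%type).
      exact: (measurable_fun_pair_borel (@rV_ball_open _ _) (@rV_ball_open _ _)
        (separable_rV _) (separable_rV _) mI my mu).
    exact: (measurable_fun_pair_borel
      (prod_ball_open (@rV_ball_open _ _) (@rV_ball_open _ _)) (@rV_ball_open _ _)
      (separable_prod (separable_rV _) (separable_rV _)) (separable_rV _) mI myu mv).
  apply: (@measurable_fun_comp_within _ _ _ _ _ Q h
    (fun z => f z.1.1 z.1.2 z.2 0 i) mI _ _ _ mh).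
  + by apply: prod_ball_open; [apply: prod_ball_open|]; exact: rV_ball_open.
  + move=> [[x1 u1] v1] e [/= Uu1 Vv1] e0; have [r r0 hr] := f_ucont e0.
    exists r => // -[[x2 u2] v2] [/= Uu2 Vv2] [[/=]].
    rewrite !mx_norm_ball /ball_/= => bx bu bv.
    have := hr x1 x2 u1 u2 v1 v2 Uu1 Uu2 Vv1 Vv2 bx bu bv.
    by apply: le_lt_trans; have := coord_le_norm (f x1 u1 v1 - f x2 u2 v2) i; rewrite !mxE.
  + by move=> s sab; split => /=; [exact: Uu|exact: Vv].
- by move=> s x sab; apply: fM; [apply: Uu|apply: Vv]; rewrite in_itv.
- by move=> s x x' sab; apply: fK; [apply: Uu|apply: Vv]; rewrite in_itv.
Qed.

Section one_trajectory.
Variables (t0 : R).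
Hypothesis t0T : t0 <= T.
Implicit Types (u : control U t0 T) (v : control V t0 T).

Lemma field_control u v : is_field t0 T K M (field_of u v).
Proof. by apply: is_field_field_of; exact: control_reprP. Qed.

(** [trajectory] chooses a solution, and [ode_exists] provides one. *)
Lemma trajectoryP x u v : sol t0 T (field_of u v) x (trajectory f x u v).
Proof.
have [y yP] := ode_exists x K0 M0 t0T (field_control u v).
exact: (@xgetI _ (cst x) [set y | is_trajectory f x u v y] y yP).
Qed.

End one_trajectory.

Lemma sol_coincide a b u u' v v' x y z : a <= b ->
  is_control U a b u -> is_control U a b u' ->
  is_control V a b v -> is_control V a b v' ->
  coincide a b u u' -> coincide a b v v' ->
  sol a b (field_of u v) x y -> sol a b (field_of u' v') x z ->
  forall t, a <= t <= b -> y t = z t.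
Proof.
move=> ab cu cu' cv cv' uu vv sy sz t tab.
have fF := is_field_field_of cu cv; have fG := is_field_field_of cu' cv'.
have bG := is_field_bounded_meas fG sz.1; have bF := is_field_bounded_meas fF sz.1.
have := sol_dist K0 ab fF sy sz bG tab.
rewrite subrr normr0 add0r.
rewrite (_ : Rintegral _ _ _ = 0) ?mulr0 ?mul0r.
  by rewrite normr_le0 subr_eq0 => /eqP.
have mFG := measurable_int _ (bounded_meas_normB bF bG).
rewrite /Rintegral (ae_eq_integral (cst 0%E) _ (measurable_lebI a b) mFG).
- by rewrite integral0.
- exact: measurable_cst.
- by apply: filterS2 uu vv => s h1 h2 sab; rewrite /= /field_of h1// h2// subrr normr0.
Qed.

Section dependence.
Variables (t0 : R).
Implicit Types (u : control U t0 T) (v : control V t0 T).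

Lemma trajectory_nonanticipative t x u u' v v' : t0 <= t <= T ->
  coincide t0 t u u' -> coincide t0 t v v' ->
  trajectory f x u v t = trajectory f x u' v' t.
Proof.
move=> /andP[t0t tT] uu vv; have t0T := le_trans t0t tT.
apply: (@sol_coincide t0 t u u' v v' x) => //; last by rewrite t0t lexx.
1-4: by apply: is_control_sub (control_reprP _).
1,2: exact: sol_sub tT (trajectoryP t0T _ _ _).
Qed.

Lemma trajectory_start x u v : t0 <= T -> trajectory f x u v t0 = x.
Proof. by move=> t0T; exact: (sol_start t0T (trajectoryP t0T x u v)). Qed.

Lemma trajectory_lip x u v s t : t0 <= s <= T -> t0 <= t <= T ->
  `|trajectory f x u v s - trajectory f x u v t| <= M * `|s - t|.
Proof.
move=> sI tI; have t0T : t0 <= T by case/andP : sI; exact: le_trans.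
have [cy yE] := trajectoryP t0T x u v.
rewrite !yE ?in_itv// opprD addrACA subrr add0r.
have fF := field_control u v.
apply: (vint_lip M0 (is_field_bounded_meas fF cy)) => // r; exact: (field_bound fF).
Qed.

Lemma trajectory_travel x u v t : t0 <= t <= T ->
  `|trajectory f x u v t - x| <= M * (t - t0).
Proof.
move=> tI; have /andP[t0t tT] := tI; have t0T := le_trans t0t tT.
rewrite -[X in _ - X](trajectory_start x u v t0T).
apply: le_trans (trajectory_lip _ _ _ tI _) _; first by rewrite lexx.
by rewrite ger0_norm ?subr_ge0.
Qed.

(** The two trajectories agree at time [s], and then move at speed at most [M]. *)
Lemma trajectory_hold x u v v' s t : t0 <= s -> s <= t -> t <= T ->
  coincide t0 s v v' ->
  `|trajectory f x u v t - trajectory f x u v' t| <= 2 * M * (t - s).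
Proof.
move=> t0s st tT vv; have sT := le_trans st tT.
have sI : t0 <= s <= T by rewrite t0s.
have tI : t0 <= t <= T by rewrite tT (le_trans t0s).
apply: le_trans (ler_distD (trajectory f x u v s) _ _) _.
rewrite {2}(@trajectory_nonanticipative s x u u v v' sI _ vv); last exact: coincide_ext.
rewrite -mulrA mulr_natl mulr2n; apply: lerD.
  by apply: le_trans (trajectory_lip _ _ _ tI sI) _; rewrite ger0_norm ?subr_ge0.
apply: le_trans (trajectory_lip _ _ _ sI tI) _; rewrite distrC.
by rewrite ger0_norm ?subr_ge0.
Qed.

Lemma trajectory_dist_init x x' u v t : t0 <= t <= T ->
  `|trajectory f x u v t - trajectory f x' u v t| <=
    2 * weight t0 K T * `|x - x'|.
Proof.
move=> tI; have /andP[t0t tT] := tI; have t0T := le_trans t0t tT.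
have sy := trajectoryP t0T x u v; have sz := trajectoryP t0T x' u v.
have fF := field_control u v.
have := sol_dist K0 t0T fF sy sz (is_field_bounded_meas fF sz.1) tI.
rewrite (_ : Rintegral _ _ _ = 0); last first.
  under eq_Rintegral do rewrite subrr normr0.
  by rewrite (Rintegral_cst leb (measurable_lebI t0 T)) mul0r.
move=> /le_trans; apply; rewrite addr0 mulrAC ler_wpM2r// ler_wpM2l//.
exact: weight_le.
Qed.

Lemma trajectory_flow t1 x u v (u1 : control U t1 T) (v1 : control V t1 T) t :
  t0 <= t1 -> t1 <= t <= T ->
  coincide t1 T u u1 -> coincide t1 T v v1 ->
  trajectory f x u v t = trajectory f (trajectory f x u v t1) u1 v1 t.
Proof.
move=> t01 tI uu vv; have /andP[t1t tT] := tI.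
have t1T := le_trans t1t tT; have t0T := le_trans t01 t1T.
apply: (@sol_coincide t1 T u u1 v v1 (trajectory f x u v t1)) => //.
1-4: by apply: is_control_sub (control_reprP _).
  apply: (sol_tail (field_control u v) _ (trajectoryP t0T x u v)).
  by rewrite t01.
exact: trajectoryP.
Qed.

(** Uniform continuity in a form that can be integrated against the L1 distance
    of controls: if a difference exceeds [d], then the trivial bound 2 M is at most
    2 M / d times this difference. *)
Lemma f_ucont_linear e : 0 < e -> exists2 L : R, 0 <= L &
  forall x (u u' : 'rV[R]_p) (v v' : 'rV[R]_q), control_values U u -> control_values U u' ->
    control_values V v -> control_values V v' ->
    `|f x u v - f x u' v'| <= e + L * (`|u - u'| + `|v - v'|).
Proof.
move=> e0; have [d d0 hd] := f_ucont e0; exists (2 * M / d).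
  by rewrite divr_ge0 ?mulr_ge0// ltW.
move=> x u u' v v' Uu Uu' Vv Vv'.
have L0 : 0 <= 2 * M / d by rewrite divr_ge0 ?mulr_ge0// ltW.
have [du|du] := ltP `|u - u'| d; last first.
  apply: le_trans (_ : 2 * M <= _).
    by rewrite (le_trans (ler_normB _ _))// mulr_natl mulr2n lerD// fM.
  rewrite -[leLHS]add0r lerD ?(ltW e0)//.
  apply: le_trans (_ : 2 * M / d * d <= _); first by rewrite divfK// gt_eqF.
  by rewrite ler_wpM2l// (le_trans du)// lerDl.
have [dv|dv] := ltP `|v - v'| d; last first.
  apply: le_trans (_ : 2 * M <= _).
    by rewrite (le_trans (ler_normB _ _))// mulr_natl mulr2n lerD// fM.
  rewrite -[leLHS]add0r lerD ?(ltW e0)//.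
  apply: le_trans (_ : 2 * M / d * d <= _); first by rewrite divfK// gt_eqF.
  by rewrite ler_wpM2l// (le_trans dv)// lerDr.
apply: le_trans (ltW (hd x x u u' v v' _ _ _ _ _ _ _)) _ => //.
  by rewrite subrr normr0.
by rewrite lerDl mulr_ge0// addr_ge0.
Qed.

Lemma trajectory_dist_controls x x' u u' v v' e L t : t0 <= t <= T ->
  0 <= L -> 0 <= e ->
  (forall x (u u' : 'rV[R]_p) (v v' : 'rV[R]_q), control_values U u -> control_values U u' ->
    control_values V v -> control_values V v' ->
    `|f x u v - f x u' v'| <= e + L * (`|u - u'| + `|v - v'|)) ->
  `|trajectory f x u v t - trajectory f x' u' v' t| <=
   2 * (`|x - x'| + (e * (T - t0) + L * (L1_dist u u' + L1_dist v v')))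
    * weight t0 K T.
Proof.
move=> tI L0 e0 hL; have /andP[t0t tT] := tI; have t0T := le_trans t0t tT.
have sy := trajectoryP t0T x u v; have sz := trajectoryP t0T x' u' v'.
have fF := field_control u v; have fG := field_control u' v'.
have bG := is_field_bounded_meas fG sz.1; have bF := is_field_bounded_meas fF sz.1.
apply: le_trans (sol_dist K0 t0T fF sy sz bG tI) _.
have mI := measurable_lebI t0 T.
have iu := L1_dist_integrable u u'; have iv := L1_dist_integrable v v'.
have iuv := integrableD mI iu iv; have iL := integrableZl mI L iuv.
have ie : (@leb R).-integrable (`[t0, T]%classic : set LT) (EFin \o (cst e)).
  by apply: (@integrable_bounded _ _ _ _ `|e|) => //.
apply: ler_pM.
- by rewrite mulr_ge0// addr_ge0//; exact: Rintegral_ge0.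
- exact: expR_ge0.
- rewrite ler_wpM2l// lerD2l.
  have -> : e * (T - t0) + L * (L1_dist u u' + L1_dist v v') =
     \int[@leb R]_(s in (`[t0, T]%classic : set LT))
        (e + L * (`|u s - u' s| + `|v s - v' s|)).
    rewrite (RintegralD mI ie iL) (Rintegral_cst leb mI) leb_itv//=.
    by rewrite (RintegralZl _ mI iuv) (RintegralD mI iu iv).
  apply: (le_Rintegral mI (bounded_meas_normB bF bG) (integrableD mI ie iL)).
  move=> s sI; apply: hL.
  + exact: (control_reprP u).2.
  + exact: (control_reprP u').2.
  + exact: (control_reprP v).2.
  + exact: (control_reprP v').2.
- exact: weight_le.
Qed.

Lemma trajectory_continuous t : t0 <= t <= T ->
  continuous (fun z : ('rV[R]_N * control U t0 T * control V t0 T)%type =>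
    trajectory f z.1.1 z.1.2 z.2 t).
Proof.
move=> tI [[x u] v]; have /andP[t0t tT] := tI; have t0T := le_trans t0t tT.
apply/cvgrPdist_lt => /= e e0.
have halfE (w X : R) : X != 0 -> w / (2 * X) * X = w / 2.
  by move=> X0; rewrite invfM mulrA mulfVK.
pose C := 2 * weight t0 K T.
have C0 : 0 < C by rewrite /C mulr_gt0// expR_gt0.
(* After multiplication by C the uniform error e1 contributes less than e / 2, and
   the three distances, each less than d, at most e / 2 together. *)
pose e1 := e / C / (2 * (T - t0 + 1)).
have Tt : 0 < T - t0 + 1 by rewrite ltr_wpDl// subr_ge0.
have e10 : 0 < e1 by rewrite /e1 !divr_gt0// mulr_gt0.
have [L L0 hL] := f_ucont_linear e10.
pose d := e / C / (2 * (1 + 2 * L)).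
have L20 : 0 < 1 + 2 * L by rewrite ltr_wpDr// mulr_ge0.
have d0 : 0 < d by rewrite /d !divr_gt0// mulr_gt0.
pose PP : pseudoPMetricType R := ('rV[R]_N * control U t0 T * control V t0 T)%type.
apply: (@filterS _ _ (@nbhs_filter PP (x, u, v)) (ball ((x, u, v) : PP) d)); last first.
  exact: (@nbhsx_ballx _ PP (x, u, v) d d0).
move=> -[[x' u'] v'] [[/=]].
rewrite mx_norm_ball !ballEmdist /ball_/= => dx du dv.
apply: le_lt_trans (trajectory_dist_controls x x' u u' v v' tI L0 (ltW e10) hL) _.
have du' : L1_dist u u' < d by exact: du.
have dv' : L1_dist v v' < d by exact: dv.
rewrite mulrAC -/C mulrC -ltr_pdivlMr//.
apply: (@lt_le_trans _ _ (d + (e1 * (T - t0) + L * (d + d)))).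
  rewrite ltr_leD// lerD2l ler_wpM2l//; apply: lerD; exact: ltW.
have -> : d + (e1 * (T - t0) + L * (d + d)) = d * (1 + 2 * L) + e1 * (T - t0) by ring.
have -> : d * (1 + 2 * L) = e / C / 2.
  by rewrite /d halfE// gt_eqF.
have -> : e / C = e / C / 2 + e / C / 2 by rewrite -splitr.
rewrite mulrDl -splitr lerD2l.
apply: (@le_trans _ _ (e1 * (T - t0 + 1))).
  by rewrite ler_wpM2l ?(ltW e10)// lerDl.
by rewrite /e1 halfE// gt_eqF.
Qed.

(** By [trajectory_continuous], since by separability a triple of Borel maps is
    a Borel map into the product. *)
Lemma measurable_trajectory d (S : measurableType d) t
    (xs : S -> 'rV[R]_N) (us : S -> control U t0 T) (vs : S -> control V t0 T) :
  t0 <= t <= T ->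
  measurable_fun setT (xs : S -> borelType 'rV[R]_N) ->
  measurable_fun setT (us : S -> borelType (control U t0 T)) ->
  measurable_fun setT (vs : S -> borelType (control V t0 T)) ->
  measurable_fun setT ((fun s => trajectory f (xs s) (us s) (vs s) t)
     : S -> borelType 'rV[R]_N).
Proof.
move=> tI mx mu mv.
pose PU : pseudoPMetricType R := control U t0 T.
pose PV : pseudoPMetricType R := control V t0 T.
have oU (x : PU) r : open (ball x r) by exact: (@metric_ball_open R (control U t0 T)).
have oV (x : PV) r : open (ball x r) by exact: (@metric_ball_open R (control V t0 T)).
have sU : separable PU by exact: separable_control.
have sV : separable PV by exact: separable_control.
have mxu : measurable_fun setT
    ((fun s => (xs s, us s)) : S -> borelType ('rV[R]_N * control U t0 T)%type).
  exact: (measurable_fun_pair_borel (@rV_ball_open _ _) oU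
    (separable_rV _) sU measurableT mx mu).
have mxuv : measurable_fun setT
    ((fun s => (xs s, us s, vs s)) :
      S -> borelType ('rV[R]_N * control U t0 T * control V t0 T)%type).
  exact: (measurable_fun_pair_borel
    (prod_ball_open (@rV_ball_open _ _) oU) oV
    (separable_prod (separable_rV _) sU) sV
    measurableT mxu mv).
exact: (measurableT_comp (continuous_borel (trajectory_continuous tI)) mxuv).
Qed.

End dependence.

(** * The law of the state under a strategy *)

(** The delay condition, for a kernel that ignores the state. *)
Definition kernel_delay s (tau : R) (Q : R.-pker VT s ~> UT s) : Prop :=
  forall t (v1 v2 : control V s T), s <= t <= T -> coincide s t v1 v2 ->
  forall B : set (UT s), measurable B -> determined (Num.min (t + tau) T) B ->
    Q v1 B = Q v2 B.

Section initial_state.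
Variables (t0 : R) (mu0 : probability ZT R) (P : kernel_at t0).
Hypothesis t0T : t0 <= T.

(** The delay of [P] passes to the joint law, section by section. *)
Lemma joint_determined tau t (v1 v2 : control V t0 T) (A : set (ZT * UT t0)) :
  0 < tau -> has_delay tau P -> t0 <= t <= T -> coincide t0 t v1 v2 ->
  measurable A ->
  (forall x, determined (Num.min (t + tau) T) [set u | A (x, u)]) ->
  joint mu0 P v1 A = joint mu0 P v2 A.
Proof.
move=> tau0 /(has_delayP _ t0T tau0) hP tI vv mA dA.
rewrite !(jointE mu0 P _ mA); apply: eq_integral => x _.
apply: (hP t v1 v2 tI vv); first exact: measurable_xsection.
move=> u u' uu; rewrite /xsection/= !inE; exact: dA.
Qed.

Lemma integral_at_joint v t (h : 'rV[R]_N -> R) : t0 <= t <= T ->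
  (forall x, 0 <= h x) -> measurable_fun setT (h : ZT -> measurableTypeR R) ->
  integral_at f mu0 P v t h =
  (\int[joint mu0 P v]_z (h (trajectory f z.1 z.2 v t))%:E)%E.
Proof.
move=> tI h0 mh; rewrite integral_joint; first by [].
  by move=> z; rewrite lee_fin.
apply/measurable_EFinP; apply: (measurableT_comp mh).
apply: (measurable_trajectory) => //; exact: measurable_fst.
Qed.

End initial_state.

Section state_at_time.
Variables (t0 t : R) (mu0 : probability ZT R) (P : kernel_at t0).
Hypothesis tI : t0 <= t <= T.

(** The inner integral of the bounded function [h] is a measurable function of the
    state because that of h + b, which is nonnegative, is one. *)
Lemma integral_at_shift v (h : 'rV[R]_N -> R) (b a : R) :
  measurable_fun setT (h : ZT -> measurableTypeR R) -> (forall x, `|h x| <= b) ->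
  integral_at f mu0 P v t (fun x => h x + a) =
  (integral_at f mu0 P v t h + a%:E)%E.
Proof.
move=> mh hb.
have mt : measurable_fun setT
    ((fun z : (ZT * UT t0)%type => trajectory f z.1 z.2 v t) : _ -> ZT).
  apply: (measurable_trajectory tI); [exact: measurable_fst|
    exact: measurable_snd|exact: measurable_cst].
pose k (z : (ZT * UT t0)%type) : R := h (trajectory f z.1 z.2 v t).
have mk : measurable_fun setT k by exact: (measurableT_comp mh mt).
have kb z : `|k z| <= b by exact: hb.
have b0 : 0 <= b by exact: le_trans (normr_ge0 _) (hb 0).
pose J' (x : ZT) := (\int[P (x, v)]_u (k (x, u) + b)%:E)%E.
have mkb : measurable_fun setT (fun z => (k z + b)%:E).
  by apply/measurable_EFinP; apply: measurable_funD.
have kb0 z : (0 <= (k z + b)%:E <= (b + b)%:E)%E.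
  by rewrite !lee_fin; have := kb z; rewrite ler_norml => /andP[h1 h2]; lra.
have mJ' : measurable_fun setT J'.
  apply: (measurable_int_kernel (a := fun x : ZT => (x, v)) P _ _ mkb).
    exact: measurable_fun_pair.
  by move=> z; case/andP : (kb0 z).
have PT x : P (x, v) setT = 1%E by exact: prob_kernel.
have mkx x : measurable_fun setT (fun u : UT t0 => k (x, u)).
  exact: (measurable_fun_pair2 _ mk).
have J'b x : (0 <= J' x <= (b + b)%:E)%E.
  apply: integral_prob_le => //.
  exact: (measurable_fun_pair2 x mkb).
have J'f x : J' x \is a fin_num.
  rewrite ge0_fin_numE; last by case/andP : (J'b x).
  by case/andP : (J'b x) => _ /le_lt_trans; apply; rewrite ltry.
pose j x := fine (J' x) - b.
have jE a' x : (\int[P (x, v)]_u (k (x, u) + a')%:E)%E = (j x + a')%:E.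
  rewrite (integral_shift _ (PT x) (mkx x) (fun u => kb (x, u))) EFinD; congr (_ + _)%E.
  have := integral_shift b (PT x) (mkx x) (fun u => kb (x, u)).
  rewrite -/(J' x) => E; rewrite /j EFinB fineK// E addeK//.
have mj : measurable_fun setT j.
  by apply: measurable_funB => //; exact: measurableT_comp.
have jb x : `|j x| <= b.
  have /andP[h1 h2] := J'b x; rewrite -[J' x]fineK// !lee_fin in h1 h2.
  by rewrite /j ler_norml; lra.
have muT : mu0 setT = 1%E by exact: probability_setT.
have -> : integral_at f mu0 P v t h = (\int[mu0]_x (j x)%:E)%E.
  apply: eq_integral => x _; have := jE 0 x; rewrite addr0 => <-.
  by apply: eq_integral => u _; rewrite addr0.
rewrite -(integral_shift a muT mj jb); apply: eq_integral => x _; exact: jE.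
Qed.

Let state (z : (VT t0 * (ZT * UT t0))%type) : ZT := trajectory f z.2.1 z.2.2 z.1 t.

Let measurable_state : measurable_fun setT state.
Proof.
apply: (measurable_trajectory tI).
- exact: (measurableT_comp measurable_fst measurable_snd).
- exact: (measurableT_comp measurable_snd measurable_snd).
- exact: measurable_fst.
Qed.

Definition state_law : R.-pker VT t0 ~> ZT := push mu0 P measurable_state.

Lemma state_lawE v (A : set ZT) : measurable A ->
  state_law v A = joint mu0 P v [set z : (ZT * UT t0)%type | A (trajectory f z.1 z.2 v t)].
Proof. exact: pushE. Qed.

Lemma integral_state_law v (h : ZT -> \bar R) : (forall z, 0 <= h z)%E ->
  measurable_fun setT h ->
  (\int[state_law v]_x h x =
   \int[joint mu0 P v]_z h (trajectory f z.1 z.2 v t))%E.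
Proof. exact: integral_push. Qed.

Lemma integral_at_state_law v (h : 'rV[R]_N -> R) (b : R) :
  measurable_fun setT (h : ZT -> measurableTypeR R) -> (forall x, `|h x| <= b) ->
  (\int[state_law v]_x (h x)%:E = integral_at f mu0 P v t h)%E.
Proof.
move=> mh hb.
have mhb : measurable_fun setT ((fun x => h x + b) : ZT -> measurableTypeR R).
  exact: measurable_funD.
have hb0 x : 0 <= h x + b.
  by have := hb x; rewrite ler_norml => /andP[h1 h2]; lra.
have lT : state_law v setT = 1%E by exact: prob_kernel.
have E : (\int[state_law v]_x (h x + b)%:E = integral_at f mu0 P v t (fun x => (h x + b)%R))%E.
  rewrite integral_state_law//; last by apply/measurable_EFinP.
  by rewrite (integral_at_joint mu0 P v tI hb0 mhb).
have := E; rewrite (integral_at_shift v b mh hb) (integral_shift b lT mh hb).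
by move=> /(congr1 (fun y => y - b%:E)%E); rewrite !addeK.
Qed.

(** With D = M (t - t0), the state satisfies |X_t| <= |x| + D, hence
    |X_t| ^ 2 <= 2 |x| ^ 2 + 2 D ^ 2. *)
Lemma state_law_second_moment v : finite_second_moment mu0 ->
  (\int[state_law v]_x (`|x : 'rV[R]_N| ^+ 2)%:E < +oo)%E.
Proof.
move=> mu2.
pose D := M * (t - t0).
have mn : measurable_fun setT (fun x : ZT => (`|x : 'rV[R]_N| ^+ 2)%:E).
  apply/measurable_EFinP; apply: measurable_funX.
  have := measurable_normB (@measurable_id _ ZT setT) (@measurable_cst _ _ _ _ _ (0 : ZT)).
  by apply: eq_measurable_fun => x _; rewrite subr0.
have n0 (x : ZT) : (0 <= (`|x : 'rV[R]_N| ^+ 2)%:E)%E by rewrite lee_fin exprn_ge0.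
rewrite (integral_state_law v n0 mn).
pose k (x : ZT) := ((2 : R)%:E * (`|x : 'rV[R]_N| ^+ 2)%:E + (2 * D ^+ 2)%:E)%E.
have mk : measurable_fun setT k.
  by apply: emeasurable_funD => //; exact: measurable_funeM.
have D20 : (0 <= (2 * D ^+ 2)%:E)%E by rewrite lee_fin mulr_ge0// sqr_ge0.
have n20 (x : ZT) : (0 <= (2 : R)%:E * (`|x : 'rV[R]_N| ^+ 2)%:E)%E.
  by rewrite mule_ge0// lee_fin.
have k0 x : (0 <= k x)%E by exact: adde_ge0.
have mk1 : measurable_fun setT (fun z : (ZT * UT t0)%type => k z.1).
  exact: (measurableT_comp mk measurable_fst).
have mst : measurable_fun setT
    ((fun z : (ZT * UT t0)%type => trajectory f z.1 z.2 v t) : _ -> ZT).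
  apply: (measurable_trajectory tI); [exact: measurable_fst|
    exact: measurable_snd|exact: measurable_cst].
apply: (@le_lt_trans _ _ (\int[joint mu0 P v]_z k z.1)%E).
  apply: (ge0_le_integral (joint mu0 P v) measurableT (fun z _ => n0 _)
    (measurableT_comp mn mst) mk1) => z _.
  rewrite /k -EFinM -EFinD lee_fin.
  have := trajectory_travel z.1 z.2 v tI; rewrite -/D => tD.
  have tn : `|trajectory f z.1 z.2 v t| <= `|z.1 : 'rV[R]_N| + D.
    rewrite -[X in `|X| <= _](subrK (z.1 : 'rV[R]_N)) addrC.
    by apply: le_trans (ler_normD _ _) _; rewrite lerD2l.
  have {tD} D0 : 0 <= D by exact: le_trans (normr_ge0 _) tD.
  have : `|trajectory f z.1 z.2 v t| ^+ 2 <= (`|z.1 : 'rV[R]_N| + D) ^+ 2.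
    by rewrite lerXn2r// nnegrE ?addr_ge0.
  move=> /le_trans; apply; rewrite -subr_ge0.
  have sqE (b c : R) : 2 * b ^+ 2 + 2 * c ^+ 2 - (b + c) ^+ 2 = (b - c) ^+ 2 by ring.
  by rewrite sqE sqr_ge0.
rewrite (integral_joint mu0 P v (fun z => k0 z.1) mk1).
have -> : (\int[mu0]_x \int[P (x, v)]_u k x = \int[mu0]_x k x)%E.
  apply: eq_integral => x _; rewrite [LHS](integral_cst (P (x, v)) measurableT (k x)).
  by rewrite prob_kernel mule1.
rewrite (ge0_integralD mu0 measurableT (fun x _ => n20 x) _ (fun _ _ => D20)) //; last first.
  exact: measurable_funeM.
rewrite (ge0_integralZl mu0 measurableT mn (fun x _ => n0 x)) ?lee_fin//.
apply: lte_add_pinfty.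
  by apply: lte_mul_pinfty => //; rewrite lee_fin.
have muT : mu0 setT = 1%E by exact: probability_setT.
have := @integral_prob_le _ _ _ mu0 (cst (2 * D ^+ 2)%:E) (2 * D ^+ 2) muT.
move=> /(_ (measurable_cst _) _)/wrap[|/andP[_ h]].
  by move=> x; rewrite /= lexx andbT.
by apply: le_lt_trans h _; rewrite ltry.
Qed.

(** [transported] is chosen through its integrals against bounded continuous
    functions. The law of the state has the required integrals, and these determine
    a probability measure. *)
Lemma transportedE v (A : set ZT) : finite_second_moment mu0 -> measurable A ->
  transported f t mu0 P v A = state_law v A.
Proof.
move=> mu2 mA.
pose lw : probability ZT R := kprob state_law v.
pose Q := [set mu : probability ZT R | finite_second_moment mu /\
    forall phi : 'rV[R]_N -> R, continuous phi -> bounded_fun phi ->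
      (\int[mu]_x (phi x)%:E)%E = integral_at f mu0 P v t phi].
have Qlw : Q lw.
  split; first exact: state_law_second_moment.
  move=> phi cphi [b [_ hb]].
  have hb' x : `|phi x| <= `|b| + 1.
    by apply: hb => //; rewrite (le_lt_trans (ler_norm b))// ltrDl.
  exact: (integral_at_state_law v (continuous_borel_real cphi) hb').
have [_ tr] : Q (transported f t mu0 P v) := @xgetI _ mu0 Q lw Qlw.
apply: (bounded_continuous_eq (m2 := lw)) mA => h ch bh h0.
by rewrite tr//; apply/esym; exact: Qlw.2.
Qed.

Lemma joint_fst v (A : set ZT) : measurable A ->
  joint mu0 P v (A `*` setT) = mu0 A.
Proof.
move=> mA; rewrite (jointE mu0 P v (measurableX mA measurableT)).
have <- : (\int[mu0]_x (\1_A x)%:E = mu0 A)%E.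
  by rewrite (integral_indic mu0 measurableT mA) setIT.
apply: eq_integral => x _; rewrite indicE; have [xA|xA] := boolP (x \in A).
  by rewrite in_xsectionX// prob_kernel.
by rewrite notin_xsectionX// measure0.
Qed.

(** The state travels a distance of at most M (t - t0). *)
Lemma state_law_tail v (r : R) :
  (state_law v [set x : ZT | (r + M * (t - t0) < `|x : 'rV[R]_N|)%R] <=
   mu0 [set x : ZT | (r < `|x : 'rV[R]_N|)%R])%E.
Proof.
have mr := @measurable_norm_gt R N.
rewrite (state_lawE v (mr _)) -(joint_fst v (mr r)); apply: le_measure.
- rewrite inE.
  have := @measurable_fun_pair2 _ _ _ (VT t0) (ZT * UT t0)%type ZT state v measurable_state.
  by move=> /(_ measurableT _ (mr (r + M * (t - t0)))); rewrite setTI.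
- by rewrite inE; exact: measurableX.
move=> z /= h; split => //.
have := trajectory_travel z.1 z.2 v tI => tD.
rewrite -(ltrD2r (M * (t - t0))); apply: lt_le_trans h _.
rewrite -[X in `|X| <= _](subrK (z.1 : 'rV[R]_N)) addrC.
by apply: le_trans (ler_normD _ _) _; rewrite lerD2l.
Qed.

End state_at_time.
Lemma upper_value_shift (g : 'rV[R]_N -> R) (b a t : R) (mu : probability ZT R) :
  measurable_fun setT (g : ZT -> measurableTypeR R) -> (forall x, `|g x| <= b) ->
  t <= T ->
  upper_value T U V f (fun x => g x + a) t mu = (upper_value T U V f g t mu + a%:E)%E.
Proof.
move=> mg gb tT; have tI : t <= T <= T by rewrite tT lexx.
rewrite /upper_value -ereal_inf_shift; congr ereal_inf; apply: eq_imagel => P _.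
rewrite -ereal_sup_shift; congr ereal_sup; apply: eq_imagel => v _.
exact: (integral_at_shift mu P tI v a mg gb).
Qed.

(** * The payoff *)

Section payoff.
Variables (g : 'rV[R]_N -> R) (G Lg : R).
Hypotheses (g0 : forall x, 0 <= g x) (gG : forall x, g x <= G) (Lg0 : 0 <= Lg).
Hypothesis gL : forall x y, `|g x - g y| <= Lg * `|x - y|.
Lemma G_ge0 : 0 <= G.
Proof. exact: le_trans (g0 0) (gG 0). Qed.

Lemma g_continuous : continuous g.
Proof.
apply: (@uniformly_continuous_real _ 'rV[R]_N) => e e0.
have L0 : 0 < Lg + 1 by rewrite ltr_wpDl.
exists (e / (Lg + 1)); first by rewrite divr_gt0.
move=> x y; rewrite mx_norm_ball /ball_/= => xy; apply: le_lt_trans (gL _ _) _.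
apply: le_lt_trans (_ : (Lg + 1) * `|x - y| < _).
  by rewrite ler_wpM2r// lerDl.
by rewrite mulrC -ltr_pdivlMr.
Qed.

Lemma measurable_g : measurable_fun setT (g : ZT -> measurableTypeR R).
Proof. exact: continuous_borel_real g_continuous. Qed.

Lemma measurable_g_trajectory s d (S : measurableType d)
    (xs : S -> 'rV[R]_N) (us : S -> control U s T) (vs : S -> control V s T) :
  s <= T ->
  measurable_fun setT (xs : S -> ZT) ->
  measurable_fun setT (us : S -> UT s) ->
  measurable_fun setT (vs : S -> VT s) ->
  measurable_fun setT (fun z => (g (trajectory f (xs z) (us z) (vs z) T))%:E).
Proof.
move=> sT mx mu mv; apply/measurable_EFinP.
apply: (measurableT_comp measurable_g).
by apply: (measurable_trajectory) => //; rewrite sT lexx.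
Qed.

(** The Lipschitz constant of the flow from time [s] to time [T]. *)
Definition flow_lip (s : R) := 2 * weight s K T.

Lemma flow_lip_ge0 s : 0 <= flow_lip s.
Proof. by rewrite mulr_ge0// expR_ge0. Qed.

Lemma g_trajectory_le s x y (u : control U s T) (v : control V s T) r :
  s <= T -> `|x - y| <= r ->
  g (trajectory f x u v T) <= g (trajectory f y u v T) + Lg * (flow_lip s * r).
Proof.
move=> sT xy; rewrite -lerBlDl; apply: le_trans (ler_norm _) _.
apply: le_trans (gL _ _) _; rewrite ler_wpM2l//.
have TI : s <= T <= T by rewrite sT lexx.
apply: le_trans (trajectory_dist_init x y u v TI) _.
by rewrite ler_wpM2l// flow_lip_ge0.
Qed.

Section good_cells.
Variables (t0 t1 : R) (mu0 : probability ZT R).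
Hypothesis t1I : t0 <= t1 <= T.

Let G0 : 0 <= G. Proof. exact: G_ge0. Qed.
Let law (P : kernel_at t0) := state_law mu0 P t1I.

(** Tightness of the single measure [mu0] gives a radius valid for all strategies
    and all controls, because the state travels at bounded speed. *)
Lemma good_cells (eta : R) : 0 < eta ->
  exists (m : nat) (c : 'rV[R]_N -> 'I_m.+1) (ctr : 'I_m.+1 -> 'rV[R]_N)
    (B : set ZT) (delta e : R),
  [/\ (forall i, measurable ([set z | c z = i] : set ZT)), measurable B,
      0 <= delta & (forall z, ~ B z -> `|z - ctr (c z)| <= delta)] /\
  [/\ Lg * (flow_lip t1 * delta) <= eta, G * e <= eta &
      forall P v, (law P v B <= e%:E)%E].
Proof.
move=> eta0; pose D := Lg * flow_lip t1.
have D0 : 0 <= D by rewrite mulr_ge0// flow_lip_ge0.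
have d0 : 0 < eta / (D + 1) by rewrite divr_gt0// ltr_wpDl.
have e0 : 0 < eta / (G + 1) by rewrite divr_gt0// ltr_wpDl.
have le_eta (b : R) : 0 <= b -> b * (eta / (b + 1)) <= eta.
  move=> b0; rewrite mulrA ler_pdivrMr ?ltr_wpDl// mulrDr mulr1 mulrC lerDl.
  exact: ltW.
have [r rP] := tight mu0 e0.
have [m [c [ctr [mc near]]]] := @cells_exist R N (r + M * (t1 - t0)) _ d0.
exists m, c, ctr, [set z : ZT | (r + M * (t1 - t0) < `|z : 'rV[R]_N|)%R].
exists (eta / (D + 1)), (eta / (G + 1)); split; split.
- exact: mc.
- exact: measurable_norm_gt.
- exact: ltW.
- exact: near.
- by rewrite mulrA; exact: le_eta.
- exact: le_eta.
- move=> P v; apply: le_trans rP; exact: state_law_tail.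
Qed.

End good_cells.

(** * Discretizing and assembling strategies *)

Section cells.
Variables (I : finType) (c : 'rV[R]_N -> I) (ctr : I -> 'rV[R]_N).
Variables (B : set ZT) (delta : R).
Hypothesis mc : forall i, measurable ([set z | c z = i] : set ZT).
Hypothesis mB : measurable B.
Hypothesis delta0 : 0 <= delta.
Hypothesis c_near : forall z, ~ B z -> `|z - ctr (c z)| <= delta.

Lemma g_cell_le s z (u : control U s T) (v : control V s T) : s <= T ->
  g (trajectory f z u v T) <= g (trajectory f (ctr (c z)) u v T) +
    (Lg * (flow_lip s * delta) + G * \1_B z).
Proof.
move=> sT; have L0 : 0 <= Lg * (flow_lip s * delta).
  exact: mulr_ge0 Lg0 (mulr_ge0 (flow_lip_ge0 s) delta0).
have [Bz|nBz] := pselect (B z).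
  rewrite indicE mem_set// mulr1; apply: le_trans (gG _) _.
  by rewrite addrA lerDr addr_ge0.
rewrite indicE memNset// mulr0 addr0.
by apply: g_trajectory_le => //; exact: c_near.
Qed.

Lemma g_cell_ge s z (u : control U s T) (v : control V s T) : s <= T ->
  g (trajectory f (ctr (c z)) u v T) <= g (trajectory f z u v T) +
    (Lg * (flow_lip s * delta) + G * \1_B z).
Proof.
move=> sT; have L0 : 0 <= Lg * (flow_lip s * delta).
  exact: mulr_ge0 Lg0 (mulr_ge0 (flow_lip_ge0 s) delta0).
have [Bz|nBz] := pselect (B z).
  rewrite indicE mem_set// mulr1; apply: le_trans (gG _) _.
  by rewrite addrA lerDr addr_ge0.
rewrite indicE memNset// mulr0 addr0.
by apply: g_trajectory_le => //; rewrite distrC; exact: c_near.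
Qed.

(** An idealized payoff, in which everything depends on the state only through its
    cell. *)
Definition cell_payoff s (Q : R.-pker VT s ~> UT s) (i : I) (v : control V s T) : \bar R :=
  (\int[Q v]_u (g (trajectory f (ctr i) u v T))%:E)%E.

(** Player I observes the cell of the state and plays the kernel attached to it. *)
Lemma assemble s (mu : probability ZT R) (tau : R)
    (Q : I -> R.-pker VT s ~> UT s) : s <= T -> 0 < tau ->
  (forall i, kernel_delay tau (Q i)) ->
  exists2 P : kernel_at s, strategy P & forall v,
    (integral_at f mu P v T g <=
     \sum_(i : I) mu [set z | c z = i] * cell_payoff (Q i) i v +
     ((Lg * (flow_lip s * delta))%:E + G%:E * mu B))%E.
Proof.
move=> sT tau0 dQ.
have mc1 i : measurable ([set z | c z.1 = i] : set (ZT * VT s)).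
  by rewrite -[X in measurable X]setTI; exact: (measurable_fst measurableT _ (mc i)).
pose P : kernel_at s := kselect (fun i => kprecomp (Q i)
  (measurable_snd : measurable_fun setT (@snd ZT (VT s)))) mc1.
exists P.
  exists tau => //; apply/(has_delayP _ sT tau0) => t v1 v2 tI vv x A mA dA.
  exact: (dQ (c x) t v1 v2 tI vv A mA dA).
move=> v.
have mh : measurable_fun setT
    (fun z : (ZT * UT s)%type => (g (trajectory f z.1 z.2 v T))%:E).
  apply: measurable_g_trajectory => //; exact: measurable_fst.
have mH i : measurable_fun setT (fun x : ZT => \int[Q i v]_u (g (trajectory f x u v T))%:E)%E.
  apply: (measurable_int_kernel (a := cst v) (Q i) _ _ mh) => //.
  by move=> z; rewrite lee_fin.
have H0 i x : (0 <= \int[Q i v]_u (g (trajectory f x u v T))%:E)%E.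
  by apply: integral_ge0 => u _; rewrite lee_fin.
rewrite /integral_at.
have mHc : measurable_fun setT (fun x : ZT => \int[Q (c x) v]_u (g (trajectory f x u v T))%:E)%E.
  exact: (measurable_fun_select mc mH).
have mJ : measurable_fun setT (fun x : ZT => cell_payoff (Q (c x)) (c x) v).
  by apply: (measurable_fun_select (h := fun i _ => cell_payoff (Q i) i v) mc) => i.
have J0 i : (0 <= cell_payoff (Q i) i v)%E.
  by apply: integral_ge0 => u _; rewrite lee_fin.
have muT : mu setT = 1%E by exact: probability_setT.
have e0 : 0 <= Lg * (flow_lip s * delta).
  exact: mulr_ge0 Lg0 (mulr_ge0 (flow_lip_ge0 s) delta0).
rewrite -(integral_select mc mu J0).
apply: (integral_le_error muT mB e0 G_ge0 (fun x => H0 (c x) x) mHc (fun x => J0 (c x)) mJ).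
move=> x; have e1 : 0 <= Lg * (flow_lip s * delta) + G * \1_B x.
  by rewrite addr_ge0// mulr_ge0// G_ge0.
have m1 : measurable_fun setT (fun u : UT s => (g (trajectory f (ctr (c x)) u v T))%:E).
  by apply: measurable_g_trajectory => //; exact: measurable_cst.
have m2 : measurable_fun setT (fun u : UT s => (g (trajectory f x u v T))%:E).
  by apply: measurable_g_trajectory => //; exact: measurable_cst.
have Q1 : Q (c x) v setT = 1%E by exact: prob_kernel.
have := integral_le_error Q1 measurable0 e1 (lexx 0)
  (fun u => _ : (0 <= (g (trajectory f x u v T))%:E)%E) m2
  (fun u => _ : (0 <= (g (trajectory f (ctr (c x)) u v T))%:E)%E) m1.
move=> /(_ _ _ _)/wrap[].
- by move=> u; rewrite lee_fin.
- by move=> u; rewrite lee_fin.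
- move=> u; rewrite mul0r addr0 -EFinD lee_fin; exact: g_cell_le.
by rewrite measure0 mule0 adde0.
Qed.

Section discretize.
Variables (t0 t1 : R) (mu0 : probability ZT R) (P : kernel_at t0) (tau : R).
Hypotheses (t01 : t0 <= t1) (t1T : t1 <= T) (tau0 : 0 < tau).
Hypothesis dP : has_delay tau P.

Let t0T : t0 <= T. Proof. exact: le_trans t1T. Qed.
Let t1I : t0 <= t1 <= T. Proof. by rewrite t01. Qed.

Let state_cut (z : (VT t0 * (ZT * UT t0))%type) : (ZT * UT t1)%type :=
  (trajectory f z.2.1 z.2.2 z.1 t1, cut t1 z.2.2).

Let measurable_state_cut : measurable_fun setT state_cut.
Proof.
have m21 : measurable_fun setT (fun z : (VT t0 * (ZT * UT t0))%type => z.2.1).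
  exact: (measurableT_comp measurable_fst measurable_snd).
have m22 : measurable_fun setT (fun z : (VT t0 * (ZT * UT t0))%type => z.2.2).
  exact: (measurableT_comp measurable_snd measurable_snd).
apply: measurable_fun_pair.
  exact: (measurable_trajectory t1I m21 m22 measurable_fst).
exact: (measurableT_comp (@measurable_cut _ _ U t0 T t1 t01 t1T) m22).
Qed.

Let law2 : R.-pker VT t0 ~> (ZT * UT t1)%type := push mu0 P measurable_state_cut.

Lemma measurable_event (v : control V t0 T) (A : set ZT) (A' : set (UT t1)) :
  measurable A -> measurable A' ->
  measurable ([set z : (ZT * UT t0)%type | A (trajectory f z.1 z.2 v t1) /\ A' (cut t1 z.2)] : set (ZT * UT t0)).
Proof.
move=> mA mA'.
have := @measurable_fun_pair2 _ _ _ (VT t0) (ZT * UT t0)%type (ZT * UT t1)%type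
  state_cut v measurable_state_cut.
move=> /(_ measurableT (A `*` A') (measurableX mA mA')).
by rewrite setTI.
Qed.

(** The state at [t1] depends only on the controls up to [t1], so that the event is
    determined; the delay of [P] does the rest. *)
Lemma joint_event t (v1 v2 : control V t0 T) (A : set ZT) (A' : set (UT t1)) :
  t1 <= t <= T -> coincide t0 t v1 v2 -> measurable A -> measurable A' ->
  determined (Num.min (t + tau) T) A' ->
  joint mu0 P v1 [set z : (ZT * UT t0)%type | A (trajectory f z.1 z.2 v1 t1) /\ A' (cut t1 z.2)] =
  joint mu0 P v2 [set z : (ZT * UT t0)%type | A (trajectory f z.1 z.2 v2 t1) /\ A' (cut t1 z.2)].
Proof.
move=> /andP[t1t tT] vv mA mA' dA'.
have t0t : t0 <= t := le_trans t01 t1t.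
set r := Num.min (t + tau) T in dA'.
have t1r : t1 <= r by rewrite /r le_min t1T andbT (le_trans t1t)// lerDl ltW.
have rT : r <= T by rewrite /r ge_min lexx orbT.
have vv1 : coincide t0 t1 v1 v2 by exact: coincide_sub vv.
have -> : [set z : (ZT * UT t0)%type | A (trajectory f z.1 z.2 v1 t1) /\ A' (cut t1 z.2)] =
          [set z : (ZT * UT t0)%type | A (trajectory f z.1 z.2 v2 t1) /\ A' (cut t1 z.2)].
  have E (z : (ZT * UT t0)%type) :
      trajectory f z.1 z.2 v1 t1 = trajectory f z.1 z.2 v2 t1.
    apply: (trajectory_nonanticipative _ t1I _ vv1).
    exact: coincide_refl.
  by rewrite predeqE => z /=; rewrite E.
apply: (@joint_determined t0 mu0 P t0T tau t) => //.
- by rewrite t0t.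
- exact: measurable_event.
move=> x u u' uu [/= h1 h2]; split.
  have uu1 : coincide t0 t1 u u' by exact: coincide_sub (lexx t0) t1r uu.
  by rewrite /= -(trajectory_nonanticipative x t1I uu1 (coincide_refl t0 t1 v2)).
apply: dA' h2.
apply: coincide_trans (coincide_sub (lexx t1) rT (cutE u t01)) _.
apply: coincide_trans (coincide_sub t01 (lexx r) uu) _.
exact: coincide_sym (coincide_sub (lexx t1) rT (cutE u' t01)).
Qed.

(** Conditionally on the cell [i] of the state at [t1], the strategy [P] facing
    [v0] and then [v] plays after [t1] some law, which is [Q i v]. The probability of
    the cell does not depend on [v], by nonanticipation. The weighted sum of the
    payoffs is then, up to the size of the cells, the payoff of [P] against the
    concatenation of [v0] and [v]. *)
Lemma discretize (v0 : control V t0 T) (a e : R) :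
  (forall v, integral_at f mu0 P v T g <= a%:E)%E ->
  (joint mu0 P v0 [set z : (ZT * UT t0)%type | B (trajectory f z.1 z.2 v0 t1)] <= e%:E)%E ->
  exists2 Q : I -> R.-pker VT t1 ~> UT t1, (forall i, kernel_delay tau (Q i)) &
    forall v, (\sum_(i : I)
       joint mu0 P v0 [set z : (ZT * UT t0)%type | c (trajectory f z.1 z.2 v0 t1) = i] *
       cell_payoff (Q i) i v <=
       (a + (Lg * (flow_lip t1 * delta) + G * e))%:E)%E.
Proof.
move=> Pa Be.
have mcat : measurable_fun setT (concat v0 : VT t1 -> VT t0).
  by apply: measurable_concat => //; exact: measurable_cst.
have t1I' : t1 <= t1 <= T by rewrite lexx.
have catl (v : control V t1 T) : coincide t0 t1 (concat v0 v) v0 by exact: concatl.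
have catr (v : control V t1 T) : coincide t1 T (concat v0 v) v by exact: concatr.
(* The law of the state at t1 and of the control after t1, against v0 followed
   by v, is used through these three properties only. *)
have [L [LE LI LT1]] : exists L : R.-pker VT t1 ~> (ZT * UT t1)%type, [/\
    (forall (v : control V t1 T) (A : set ZT) (A' : set (UT t1)),
      measurable A -> measurable A' -> L v (A `*` A') =
      joint mu0 P (concat v0 v) [set z : (ZT * UT t0)%type |
        A (trajectory f z.1 z.2 (concat v0 v) t1) /\ A' (cut t1 z.2)]),
    (forall (v : control V t1 T) (h : (ZT * UT t1)%type -> \bar R),
      (forall z, 0 <= h z)%E -> measurable_fun setT h -> (\int[L v]_z h z =
      \int[joint mu0 P (concat v0 v)]_z h (state_cut (concat v0 v, z)))%E) &
    (forall v : control V t1 T, L v setT = 1%E)].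
  exists (kprecomp law2 mcat); split=> [v A A' mA mA'|v h h0 mh|v].
  - exact: (pushE mu0 P measurable_state_cut (concat v0 v) (measurableX mA mA')).
  - exact: (integral_push mu0 P measurable_state_cut (concat v0 v) h0 mh).
  - exact: prob_kernel.
have LT (v : control V t1 T) (A : set ZT) : measurable A -> L v (A `*` setT) =
    joint mu0 P v0 [set z : (ZT * UT t0)%type | A (trajectory f z.1 z.2 v0 t1)].
  move=> mA; rewrite (LE v A setT mA measurableT).
  rewrite (@joint_event t1 (concat v0 v) v0 A setT t1I' (catl v) mA measurableT
    (fun _ _ _ _ => Logic.I)).
  by congr (joint _ _ _ _); rewrite predeqE => z /=; split=> [[]|].
pose Q i := kcond L (mc i) (dirac point : probability (ZT * UT t1)%type R).
exists Q => [i t v1 v2 tI vv A mA dA|v].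
  have /andP[t1t tT] := tI.
  rewrite (kcondE L (mc i) _ v1 mA) (kcondE L (mc i) _ v2 mA).
  rewrite (LT v1 _ (mc i)) (LT v2 _ (mc i)) (LE v1 _ A (mc i) mA) (LE v2 _ A (mc i) mA).
  rewrite (@joint_event t (concat v0 v1) (concat v0 v2) _ A tI _ (mc i) mA dA) //.
  apply: coincide_cat (coincide_trans (catl v1) (coincide_sym (catl v2))) _.
  apply: coincide_trans (coincide_sub (lexx t1) tT (catr v1)) _.
  apply: coincide_trans vv _.
  exact: coincide_sym (coincide_sub (lexx t1) tT (catr v2)).
have mh i : measurable_fun setT (fun u : UT t1 => (g (trajectory f (ctr i) u v T))%:E).
  by apply: measurable_g_trajectory => //; exact: measurable_cst.
under eq_bigr => i _ do rewrite -(LT v _ (mc i)).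
have h0 i (u : UT t1) : (0 <= (g (trajectory f (ctr i) u v T))%:E)%E by rewrite lee_fin.
rewrite (integral_kcond_sum mc L _ v h0 mh).
pose BT : set (ZT * UT t1) := B `*` setT.
have mBT : measurable BT by exact: measurableX.
have e0 : 0 <= Lg * (flow_lip t1 * delta).
  exact: mulr_ge0 Lg0 (mulr_ge0 (flow_lip_ge0 t1) delta0).
have mk : measurable_fun setT
    (fun z : (ZT * UT t1)%type => (g (trajectory f z.1 z.2 v T))%:E).
  by apply: measurable_g_trajectory => //; exact: measurable_fst.
have mhc : measurable_fun setT
    (fun z : (ZT * UT t1)%type => (g (trajectory f (ctr (c z.1)) z.2 v T))%:E).
  have mc1 i : measurable ([set z | c z.1 = i] : set (ZT * UT t1)).
    by rewrite -[X in measurable X]setTI; exact: (measurable_fst measurableT _ (mc i)).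
  apply: (measurable_fun_select
    (h := fun i (z : (ZT * UT t1)%type) => (g (trajectory f (ctr i) z.2 v T))%:E) mc1) => i.
  exact: (measurableT_comp (mh i) measurable_snd).
have k0 (z : (ZT * UT t1)%type) : (0 <= (g (trajectory f z.1 z.2 v T))%:E)%E.
  by rewrite lee_fin.
have := integral_le_error (LT1 v) mBT e0 G_ge0 (fun z => h0 (c z.1) z.2) mhc k0 mk.
move=> /(_ _)/wrap[].
  move=> z; rewrite -EFinD lee_fin.
  have -> : \1_BT z = \1_B z.1 :> R.
    by rewrite !indicE; congr ((_ : bool)%:R); apply/idP/idP; rewrite !inE//= => -[].
  exact: g_cell_ge.
move=> /le_trans; apply.
rewrite EFinD; apply: leeD.
  rewrite (LI v _ k0 mk).
  have TI : t0 <= T <= T by rewrite t0T lexx.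
  have := Pa (concat v0 v).
  rewrite (integral_at_joint mu0 P (concat v0 v) TI g0 measurable_g).
  apply: le_trans; rewrite le_eqVlt; apply/orP; left; apply/eqP.
  apply: eq_integral => z _; congr ((g _)%:E) => /=.
  have TI1 : t1 <= T <= T by rewrite t1T lexx.
  rewrite [RHS](trajectory_flow z.1 t01 TI1
    (coincide_sym (cutE z.2 t01)) (catr v)).
  by [].
rewrite EFinD; apply: leeD => //; rewrite EFinM (LT v B mB).
by apply: lee_wpmul2l; [rewrite lee_fin G_ge0|exact: Be].
Qed.

End discretize.

(** * Gluing two strategies *)

Section glue.
Variables (t0 t1 : R) (mu0 : probability ZT R) (P : kernel_at t0) (tau : R).
Hypotheses (t01 : t0 <= t1) (t1T : t1 <= T) (tau0 : 0 < tau).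
Hypothesis dP : has_delay tau P.
Variables (C : finType) (code : control V t0 T -> C).
Hypothesis mcode : forall k, measurable ([set v | code v = k] : set (VT t0)).
Variables (Q : C -> I -> R.-pker VT t1 ~> UT t1).
Hypothesis dQ : forall k i, kernel_delay tau (Q k i).
Let s := t1 - tau.
Hypothesis t0s : t0 <= s.

Let st1 : s <= t1. Proof. by rewrite /s gerBl ltW. Qed.
Let sT : s <= T. Proof. exact: le_trans t1T. Qed.
Let t0T : t0 <= T. Proof. exact: le_trans t1T. Qed.
Let t1I : t0 <= t1 <= T. Proof. by rewrite t01. Qed.

(** All that Player I has to remember at [t1]: the code of the frozen control of
    Player II, and the cell of the state that would have been reached against it. *)
Definition glue_index (x : ZT) (v : VT t0) (u : UT t0) : (C * I)%type :=
  (code (hold s v), c (trajectory f x u (hold s v) t1)).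

Lemma measurable_glue_index k :
  measurable [set z : (ZT * VT t0 * UT t0)%type | glue_index z.1.1 z.1.2 z.2 = k].
Proof.
case: k => k i.
have mv : measurable_fun setT (fun z : (ZT * VT t0 * UT t0)%type => hold s z.1.2 : VT t0).
  apply: (measurableT_comp (@measurable_hold _ _ V t0 T s t0s sT)).
  exact: (measurableT_comp measurable_snd measurable_fst).
have mx : measurable_fun setT
    ((fun z : (ZT * VT t0 * UT t0)%type => trajectory f z.1.1 z.2 (hold s z.1.2) t1) : _ -> ZT).
  apply: (measurable_trajectory t1I) => //.
  exact: (measurableT_comp measurable_fst measurable_fst).
have m1 := mv measurableT _ (mcode k); have m2 := mx measurableT _ (mc i).
rewrite setTI in m1; rewrite setTI in m2.
have := measurableI _ _ m1 m2; congr measurable; rewrite predeqE => z.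
by rewrite /glue_index /=; split=> [[-> ->]|[<- <-]].
Qed.

(** The true state at [t1] is within 2 M tau of the state reached against the
    frozen control, which is within [delta] of the centre of its cell. *)
Lemma glue_cost_le (x : ZT) (v : control V t0 T) (u : control U t0 T)
    (u' : control U t1 T) :
  g (trajectory f x (concat u u') v T) <=
  g (trajectory f (ctr (c (trajectory f x u (hold s v) t1))) u' (cut t1 v) T) +
  ((Lg * (flow_lip t1 * delta) + Lg * (flow_lip t1 * (2 * M * tau))) +
   G * \1_B (trajectory f x u (hold s v) t1)).
Proof.
have TI : t1 <= T <= T by rewrite t1T lexx.
set z := trajectory f x u (hold s v) t1.
rewrite (trajectory_flow x t01 TI (concatr u u' t01 t1T)
  (coincide_sym (cutE v t01))).
rewrite (trajectory_nonanticipative x t1I (concatl u u' t1T)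
  (coincide_refl t0 t1 v)).
have near : `|trajectory f x u v t1 - z| <= 2 * M * tau.
  have := trajectory_hold x u t0s st1 t1T
    (coincide_sym (holdE v sT)).
  by rewrite /s subKr.
apply: le_trans (g_trajectory_le u' (cut t1 v) t1T near) _.
rewrite [in leRHS]addrAC [in leRHS]addrA lerD2r.
exact: (g_cell_le z u' (cut t1 v) t1T).
Qed.

(** Player I plays [P] against the control of Player II frozen at s = t1 - tau, and
    after [t1] the kernel given by the index then reached. This index is known at
    time [s], a time tau before it is used, whence the delay. *)
Lemma glue_strategy : exists2 S : kernel_at t0, strategy S & forall v,
  (integral_at f mu0 S v T g <=
   \sum_(i : I) state_law mu0 P t1I (hold s v) [set z | c z = i] *
      cell_payoff (Q (code (hold s v)) i) i (cut t1 v) +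
   ((Lg * (flow_lip t1 * delta) + Lg * (flow_lip t1 * (2 * M * tau)))%:E +
    G%:E * state_law mu0 P t1I (hold s v) B))%E.
Proof.
have mcc : measurable_fun setT (fun z : (UT t0 * UT t1)%type => concat z.1 z.2 : UT t0).
  exact: (measurable_concat t01 t1T measurable_fst measurable_snd).
have [S [SB SI]] := @glue_kernel _ _ _ _ _ ZT (VT t0) (UT t0) (VT t1) (UT t1) R
  (C * I)%type P (fun k => Q k.1 k.2) (hold s) (cut t1) glue_index (@concat _ _ U t0 T t1)
  (@measurable_hold _ _ V t0 T s t0s sT) (@measurable_cut _ _ V t0 T t1 t01 t1T) measurable_glue_index mcc.
exists S.
  exists tau => //; apply/(has_delayP _ t0T tau0) => t v1 v2 tI vv x A mA dA.
  rewrite (SB x v1 A mA) (SB x v2 A mA).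
  (* If s <= t, then the frozen controls are equal and the delay is that of Q.
     Otherwise t + tau < t1, so that the event concerns the part of the control
     played with P, and the delay is that of P. *)
  have /andP[t0t tT] := tI; have [st|ts] := leP s t.
    have E : hold s v1 = hold s v2.
      by apply: hold_eq sT _; exact: coincide_sub vv.
    rewrite /glue_index E; apply: eq_integral => u _.
    pose t' := Num.max t t1.
    have t'I : t1 <= t' <= T by rewrite /t' le_max lexx orbT ge_max tT t1T.
    apply: (@dQ _ _ t' (cut t1 v1) (cut t1 v2) t'I).
    - have [t1t|tt1] := leP t t1.
        by rewrite /t' max_r//; exact: coincide_point.
      rewrite /t' max_l; last exact: ltW.
      have h1 := coincide_sub (lexx t1) tT (cutE v1 t01).
      have h2 := coincide_sub (lexx t1) tT (cutE v2 t01).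
      apply: coincide_trans h1 _; apply: coincide_trans _ (coincide_sym h2).
      exact: coincide_sub vv.
    - rewrite -[X in measurable X]setTI.
      exact: (measurableT_comp mcc (pair1_measurable u)).
    - move=> u1 u2 uu; apply: dA.
      have rT : Num.min (t' + tau) T <= T by rewrite ge_min lexx orbT.
      have tt' : Num.min (t + tau) T <= Num.min (t' + tau) T.
        by rewrite le_min !ge_min lexx orbT andbT lerD2r /t' le_max lexx.
      apply: (coincide_sub (lexx t0) tt').
      apply: (@coincide_cat _ _ _ t1).
        apply: coincide_trans (concatl u u1 t1T) _.
        exact: coincide_sym (concatl u u2 t1T).
      have h1 := coincide_sub (lexx t1) rT (concatr u u1 t01 t1T).
      have h2 := coincide_sub (lexx t1) rT (concatr u u2 t01 t1T).
      apply: coincide_trans h1 _; apply: coincide_trans uu _.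
      exact: coincide_sym h2.
  have tt1 : t + tau < t1 by rewrite -ltrBrDr.
  have mtE : Num.min (t + tau) T = t + tau.
    by rewrite min_l// (le_trans (ltW tt1)).
  rewrite mtE in dA.
  have QA v : (\int[P (x, hold s v)]_u (Q (glue_index x v u).1 (glue_index x v u).2
      (cut t1 v)) [set u' | A (concat u u')] = P (x, hold s v) A)%E.
    have <- : (\int[P (x, hold s v)]_u (\1_A u)%:E = P (x, hold s v) A)%E.
      by rewrite (integral_indic (P (x, hold s v)) measurableT mA) setIT.
    apply: eq_integral => u _; rewrite indicE; have [uA|uA] := boolP (u \in A).
      rewrite (_ : mkset _ = setT) ?prob_kernel//; apply/seteqP; split=> // u' _ /=.
      move: uA; rewrite inE; apply: dA.
      exact: coincide_sub (lexx t0) (ltW tt1) (coincide_sym (concatl u u' t1T)).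
    rewrite (_ : mkset _ = set0) ?measure0//; apply/seteqP; split=> // u' /= Au.
    move/negP : uA; apply; rewrite inE; apply: dA Au.
    exact: coincide_sub (lexx t0) (ltW tt1) (concatl u u' t1T).
  rewrite !QA.
  have hh : coincide t0 t (hold s v1) (hold s v2).
    have h1 := coincide_sub (lexx t0) (ltW ts) (holdE v1 sT).
    have h2 := coincide_sub (lexx t0) (ltW ts) (holdE v2 sT).
    apply: coincide_trans h1 _; apply: coincide_trans vv _; exact: coincide_sym h2.
  move/(has_delayP _ t0T tau0) : dP => /(_ t _ _ tI hh x A mA); apply.
  by rewrite mtE.
move=> v; have TI : t0 <= T <= T by rewrite t0T lexx.
pose vh : VT t0 := hold s v; pose v' : VT t1 := cut t1 v.
pose st (z : (ZT * UT t0)%type) : ZT := trajectory f z.1 z.2 vh t1.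
have mst : measurable_fun setT st.
  apply: (measurable_trajectory t1I); [exact: measurable_fst|
    exact: measurable_snd|exact: measurable_cst].
have mcst i : measurable [set z | c (st z) = i].
  by rewrite -[X in measurable X]setTI; exact: (mst measurableT _ (mc i)).
pose h (w : (ZT * UT t0 * UT t1)%type) : \bar R :=
  (g (trajectory f w.1.1 (concat w.1.2 w.2) v T))%:E.
have h0 w : (0 <= h w)%E by rewrite lee_fin.
have mh : measurable_fun setT h.
  apply: (measurable_g_trajectory t0T).
  - exact: (measurableT_comp measurable_fst measurable_fst).
  - apply: (measurable_concat t01 t1T); last exact: measurable_snd.
    exact: (measurableT_comp measurable_snd measurable_fst).
  - exact: measurable_cst.
pose Qk i := Q (code vh) i.
pose F i (z : (ZT * UT t0)%type) : \bar R := (\int[Qk i v']_u' h (z, u'))%E.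
have F0 i z : (0 <= F i z)%E by apply: integral_ge0 => u' _; exact: h0.
have mF i : measurable_fun setT (F i).
  exact: (measurable_int_kernel (a := cst v') (Qk i) (measurable_cst _) h0 mh).
have mFc : measurable_fun setT (fun z => F (c (st z)) z).
  exact: (measurable_fun_select mcst mF).
have mk (x : ZT) : measurable_fun setT
    (fun u : UT t0 => (g (trajectory f x u v T))%:E).
  by apply: (measurable_g_trajectory t0T) => //; exact: measurable_cst.
have -> : integral_at f mu0 S v T g =
    (\int[joint mu0 P vh]_z F (c (st z)) z)%E.
  rewrite (integral_joint mu0 P vh (fun z => F0 (c (st z)) z) mFc).
  apply: eq_integral => x _.
  rewrite (SI x v (fun u => (g (trajectory f x u v T))%:E) (fun u => _) (mk x))//.
  by move=> u; rewrite lee_fin.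
have J0 i : (0 <= cell_payoff (Qk i) i v')%E.
  by apply: integral_ge0 => u _; rewrite lee_fin.
have mJ : measurable_fun setT
    (fun x : ZT => cell_payoff (Qk (c x)) (c x) v').
  by apply: (measurable_fun_select (h := fun i _ => cell_payoff (Qk i) i v') mc) => i;
    exact: measurable_cst.
have mJst : measurable_fun setT
    (fun z => cell_payoff (Qk (c (st z))) (c (st z)) v').
  exact: (measurableT_comp mJ mst).
have mBst : measurable (st @^-1` B).
  by rewrite -[X in measurable X]setTI; exact: (mst measurableT _ mB).
have G0 : 0 <= G by exact: G_ge0.
have fl0 : 0 <= flow_lip t1 by exact: flow_lip_ge0.
have e0 : 0 <= Lg * (flow_lip t1 * delta) + Lg * (flow_lip t1 * (2 * M * tau)).
  by rewrite addr_ge0// mulr_ge0// mulr_ge0// mulr_ge0 ?mulr_ge0// ltW.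
have jT : joint mu0 P vh setT = 1%E by exact: prob_kernel.
rewrite -(integral_select mc (state_law mu0 P t1I vh) J0).
rewrite (integral_state_law mu0 P t1I vh (fun x => J0 (c x)) mJ).
rewrite (state_lawE mu0 P t1I vh mB).
apply: (integral_le_error jT mBst e0 G0 (fun z => F0 (c (st z)) z) mFc
  (fun z => J0 (c (st z))) mJst) => z.
have q1 : Qk (c (st z)) v' setT = 1%E by exact: prob_kernel.
have e1 : 0 <= Lg * (flow_lip t1 * delta) + Lg * (flow_lip t1 * (2 * M * tau))
    + G * \1_(st @^-1` B) z.
  by rewrite addr_ge0// mulr_ge0.
have mhz : measurable_fun setT (fun u' : UT t1 => h (z, u')).
  exact: (measurable_fun_pair2 z mh).
have mkz : measurable_fun setT (fun u' : UT t1 =>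
    (g (trajectory f (ctr (c (st z))) u' v' T))%:E).
  by apply: (measurable_g_trajectory t1T) => //; exact: measurable_cst.
have := integral_le_error q1 measurable0 e1 (lexx 0) (fun u' => h0 (z, u')) mhz
  (fun u' => _ : (0 <= (g (trajectory f (ctr (c (st z))) u' v' T))%:E)%E) mkz.
move=> /(_ _ _)/wrap[].
- by move=> u'; rewrite lee_fin.
- move=> u'; rewrite mul0r addr0 -EFinD lee_fin; exact: glue_cost_le.
by rewrite measure0 mule0 adde0.
Qed.
End glue.

(** * Dynamic programming *)

Section programming.
Variables (t0 t1 : R) (mu0 : probability ZT R).
Hypotheses (t01 : t0 < t1) (t1I : t0 <= t1 <= T).
Hypothesis mu2 : finite_second_moment mu0.

Let t01' : t0 <= t1. Proof. exact: ltW. Qed.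
Let t1T : t1 <= T. Proof. by case/andP : t1I. Qed.
Let G0 : 0 <= G. Proof. exact: G_ge0. Qed.
Let law (P : kernel_at t0) := state_law mu0 P t1I.

Variables (e eta : R).
Hypothesis de : Lg * (flow_lip t1 * delta) <= eta.
Hypothesis Ge : G * e <= eta.
Hypothesis lB : forall P v, (law P v B <= e%:E)%E.

Let GB P v : (G%:E * law P v B <= eta%:E)%E.
Proof.
apply: le_trans (_ : (G%:E * e%:E <= _)%E); last by rewrite -EFinM lee_fin.
by apply: lee_wpmul2l; [rewrite lee_fin|exact: lB].
Qed.

(** [discretize] the strategy along [v0], then [assemble] the result for the
    transported measure, which gives the same weights to the cells. *)
Lemma dpp_ge_cells (P : kernel_at t0) (a : R) v0 : strategy P ->
  (forall v, integral_at f mu0 P v T g <= a%:E)%E ->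
  (upper_value T U V f g t1 (transported f t1 mu0 P v0) <= (a + 4 * eta)%:E)%E.
Proof.
move=> [tau tau0 dP] Pa.
have JB : (joint mu0 P v0
    [set z : (ZT * UT t0)%type | B (trajectory f z.1 z.2 v0 t1)] <= e%:E)%E.
  by have := lB P v0; rewrite /law (state_lawE mu0 P t1I v0 mB).
have [Q dQ QJ] := discretize
  t01' t1T tau0 dP Pa JB.
have [S sS SJ] := assemble
  (transported f t1 mu0 P v0) t1T tau0 dQ.
apply: ge_ereal_inf; exists (ereal_sup
  [set integral_at f (transported f t1 mu0 P v0) S v T g | v in [set: control V t1 T]]).
  by exists S.
apply: ge_ereal_sup => _ [v _ <-]; apply: le_trans (SJ v) _.
have E A : measurable A -> transported f t1 mu0 P v0 A = law P v0 A.
  by move=> mA; exact: transportedE.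
rewrite (E B mB).
under eq_bigr => i _ do
  rewrite (E _ (mc i)) /law (state_lawE mu0 P t1I v0 (mc i)).
apply: le_trans (leeD (QJ v) (leeD (_ : _ <= eta%:E)%E (GB P v0))) _.
  by rewrite lee_fin.
by rewrite -!EFinD lee_fin; have := lerD de Ge; lra.
Qed.

Lemma cell_payoff_bounds s (Q : R.-pker VT s ~> UT s) i (v : control V s T) : s <= T ->
  (0 <= cell_payoff Q i v <= G%:E)%E.
Proof.
move=> sT; apply: integral_prob_le; first exact: prob_kernel.
  by apply: (measurable_g_trajectory sT) => //; exact: measurable_cst.
by move=> u; rewrite !lee_fin g0  gG.
Qed.

(** A near-optimal strategy for the transported measure is discretized at its own
    starting time, where the state is the initial state. *)
Lemma near_optimal (P : kernel_at t0) (a : R) v0 : 0 < eta ->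
  (upper_value T U V f g t1 (transported f t1 mu0 P v0) <= a%:E)%E ->
  exists tau (Q : I -> R.-pker VT t1 ~> UT t1),
  [/\ 0 < tau, (forall i, kernel_delay tau (Q i)) & forall v,
    (\sum_i law P v0 [set z | c z = i] * cell_payoff (Q i) i v <=
      (a + 3 * eta)%:E)%E].
Proof.
move=> eta0 Va; set mu1 := transported _ _ _ _ _ in Va.
have E A : measurable A -> mu1 A = law P v0 A by move=> mA; exact: transportedE.
have : (upper_value T U V f g t1 mu1 < (a + eta)%:E)%E.
  by apply: le_lt_trans Va _; rewrite lte_fin ltrDl.
move=> /ereal_inf_lt[_ [S [tau tau0 dS] <-] SJ].
have Sa v : (integral_at f mu1 S v T g <= (a + eta)%:E)%E.
  by apply: le_trans (ltW SJ); apply: ereal_sup_ubound; exists v.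
pose w : control V t1 T := point.
have JE (A : set ZT) : measurable A ->
    joint mu1 S w [set z : (ZT * UT t1)%type | A (trajectory f z.1 z.2 w t1)] = law P v0 A.
  move=> mA; rewrite -(E A mA) -(joint_fst mu1 S w mA); congr (joint _ _ _ _).
  by rewrite predeqE => z /=; rewrite (trajectory_start z.1 z.2 w t1T); split=> [|[]].
have JB : (joint mu1 S w
    [set z : (ZT * UT t1)%type | B (trajectory f z.1 z.2 w t1)] <= e%:E)%E.
  by rewrite (JE B mB); exact: lB.
have [Q dQ QJ] := discretize
  (lexx t1) t1T tau0 dS Sa JB.
exists tau, Q; split => // v.
under eq_bigr => i _ do rewrite -(JE _ (mc i)).
apply: le_trans (QJ v) _; rewrite lee_fin; have := lerD de Ge; lra.
Qed.

Section code.
Variables (P : kernel_at t0) (n : nat).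

Let w v i : R := fine (law P v [set z | c z = i]).

(** The bits locate the weight of each cell on the grid of step 1 / n. As there are
    finitely many codes, one strategy per code can be chosen without a measurable
    selection theorem. *)
Definition code (v : control V t0 T) : {ffun I * 'I_n.+1 -> bool} :=
  [ffun ij : I * 'I_n.+1 => ij.2%:R <= n%:R * w v ij.1].

Lemma codeE v i (j : 'I_n.+1) : code v (i, j) = (j%:R <= n%:R * w v i).
Proof. exact: ffunE. Qed.

Lemma measurable_code k : measurable ([set v | code v = k] : set (VT t0)).
Proof.
have -> : [set v | code v = k] =
    \bigcap_(ij in [set: (I * 'I_n.+1)%type])
      [set v : VT t0 | (ij.2%:R <= n%:R * w v ij.1) = k ij].
  rewrite predeqE => v /=; split=> [<- ij _ /=|h]; first by rewrite ffunE.
  by apply/ffunP => ij; rewrite ffunE; exact: h.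
apply: fin_bigcap_measurable; first exact: finite_finset.
move=> ij _.
have mw : measurable_fun setT (fun v : VT t0 => n%:R * w v ij.1).
  have mk := measurable_kernel (law P) _ (mc ij.1).
  exact: (measurable_funM (measurable_cst _) (measurableT_comp (fine_measurable measurableT) mk)).
have := measurable_fun_ler (measurable_cst (ij.2%:R : R)) mw.
by move=> /(_ measurableT [set k ij] Logic.I); rewrite setTI.
Qed.

Lemma code_near v v' i : (0 < n)%N -> code v = code v' ->
  (law P v [set z | c z = i] <= law P v' [set z | c z = i] + (n%:R^-1)%:E)%E.
Proof.
move=> n0 vv.
have l01 u : (0 <= law P u [set z | c z = i] <= 1)%E.
  rewrite measure_ge0/= -(@prob_kernel _ _ _ _ _ (law P) u).
  apply: le_measure (@subsetT _ _); first by rewrite inE; exact: mc.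
  by rewrite inE; exact: measurableT.
have lfin u : law P u [set z | c z = i] \is a fin_num.
  have /andP[l0 l1] := l01 u; rewrite (ge0_fin_numE l0).
  by apply: le_lt_trans l1 _; rewrite ltry.
have w01 : 0 <= w v i <= 1.
  by rewrite -!lee_fin fineK//; exact: l01.
rewrite -(fineK (lfin v)) -(fineK (lfin v')) -EFinD lee_fin.
apply: (@grid_near R (w v i) (w v' i) n n0 w01) => j.
have E := congr1 (fun k : {ffun I * 'I_n.+1 -> bool} => k (i, j)) vv.
exact: (etrans (esym (codeE v i j)) (etrans E (codeE v' i j))).
Qed.

End code.

(** For each code one control that has it is selected, together with a near-optimal
    family of kernels. A control with the same code gives weights that exceed the
    selected ones by at most 1 / n, at a cost of at most #|I| G / n. The strategies
    are then glued with the smallest of the finitely many delays. *)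
Lemma dpp_le_cells (P : kernel_at t0) (a : R) : 0 < eta -> strategy P ->
  (forall v, upper_value T U V f g t1 (transported f t1 mu0 P v) <= a%:E)%E ->
  (upper_value T U V f g t0 mu0 <= (a + 7 * eta)%:E)%E.
Proof.
move=> eta0 [tauP tauP0 dP] Pa.
have mG0 : 0 <= #|I|%:R * G by rewrite mulr_ge0.
pose n := (Num.truncn (#|I|%:R * G / eta)).+1.
have nP : #|I|%:R * (n%:R^-1 * G) <= eta.
  have n0 : 0 < n%:R :> R by rewrite ltr0n.
  rewrite mulrCA ler_pdivrMl// -ler_pdivrMr//; apply/ltW; exact: truncnS_gt.
have star : forall k : {ffun I * 'I_n.+1 -> bool},
  exists tQ : R * (I -> R.-pker VT t1 ~> UT t1),
  [/\ 0 < tQ.1, (forall i, kernel_delay tQ.1 (tQ.2 i)) &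
   forall v, code P n v = k -> forall v',
    (\sum_i law P v [set z | c z = i] * cell_payoff (tQ.2 i) i v' <=
      (a + 4 * eta)%:E)%E].
  move=> k; have [[vk vkE]|nk] := pselect (exists v, code P n v = k); last first.
    (* no control has this code: any kernel will do *)
    exists (1, fun=> kcst (dirac point : probability (UT t1) R) : R.-pker VT t1 ~> UT t1); split => //.
    by move=> v vE; exfalso; apply: nk; exists v.
  have [tau [Q [tau0 dQ QJ]]] := near_optimal eta0 (Pa vk).
  exists (tau, Q); split; [exact: tau0|exact: dQ|] => v vE v'.
  apply: (@le_trans _ _ (\sum_i (law P vk [set z | c z = i] *
      cell_payoff (Q i) i v' + (n%:R^-1 * G)%:E))%E).
    apply: lee_sum => i _.
    have /andP[J0 JG] := cell_payoff_bounds (Q i) i v' t1T.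
    apply: (@le_trans _ _ ((law P vk [set z | c z = i] + (n%:R^-1)%:E) *
        cell_payoff (Q i) i v')%E).
      exact: (lee_wpmul2r J0 (code_near i (ltn0Sn _) (etrans vE (esym vkE)))).
    have n0 : (0 <= (n%:R^-1)%:E :> \bar R)%E by rewrite lee_fin invr_ge0.
    rewrite (ge0_muleDl _ (measure_ge0 (law P vk) _) n0) EFinM.
    exact: (leeD (lexx _) (lee_wpmul2l n0 JG)).
  rewrite big_split/= sumEFin sumr_const.
  apply: le_trans (leeD (QJ v') (_ : (_ <= eta%:E)%E)) _.
    by rewrite lee_fin -[leLHS]mulr_natl; exact: nP.
  by rewrite -EFinD lee_fin; lra.
have [tQ tQP] := choice star.
pose D := Lg * (flow_lip t1 * (2 * M)).
have D0 : 0 <= D := mulr_ge0 Lg0 (mulr_ge0 (flow_lip_ge0 t1) (mulr_ge0 (ler0n R 2) M0)).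
have d0 : 0 < eta / (D + 1) by rewrite divr_gt0// ltr_wpDl.
have dD : D * (eta / (D + 1)) <= eta.
  by rewrite mulrA ler_pdivrMr ?ltr_wpDl// mulrDr mulr1 mulrC lerDl ltW.
(* tau0 <= t1 - t0 places the freezing time after t0, and tau0 <= eta / (D + 1)
   bounds the cost of freezing. *)
pose tau0 := Num.min (Num.min tauP (t1 - t0)) (eta / (D + 1)).
pose tau := \big[Num.min/tau0]_k (tQ k).1.
have tau_gt0 : 0 < tau.
  apply: lt_bigmin => [|k _]; last by have [] := tQP k.
  by rewrite !lt_min tauP0 subr_gt0 t01 d0.
have tau_le0 : tau <= tau0 by exact: bigmin_le_id.
have /andP[/andP[tau_P tau_t] tau_d] : (tau <= tauP) && (tau <= t1 - t0) && (tau <= eta / (D + 1)).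
  by rewrite -!le_min.
have t0s : t0 <= t1 - tau by rewrite lerBrDr -lerBrDl.
have mono (A : set (UT t1)) (r r' : R) : r <= r' ->
   determined r A -> determined r' A.
  by move=> rr dA u u' uu; apply: dA; exact: coincide_sub (lexx t1) rr uu.
have dQ k i : kernel_delay tau ((tQ k).2 i).
  have [_ dQ _] := tQP k; move=> t v1 v2 tI vv A mA dA.
  apply: (dQ i t v1 v2 tI vv A mA); apply: mono dA.
  by rewrite le_min !ge_min lerD2l bigmin_le lexx orbT.
have t0T : t0 <= T by exact: le_trans t1T.
have dP' : has_delay tau P.
  move/(has_delayP _ t0T tauP0) : dP => dP.
  apply/(has_delayP _ t0T tau_gt0) => t v1 v2 tI vv x A mA dA.
  apply: (dP t v1 v2 tI vv x A mA) => u u' uu; apply: dA.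
  apply: coincide_sub (lexx t0) _ uu.
  by rewrite le_min !ge_min lerD2l tau_P lexx orbT.
have [S sS SJ] := glue_strategy
  mu0 t01' t1T tau_gt0 dP' (@measurable_code P n) dQ t0s.
apply: ge_ereal_inf; exists (ereal_sup [set integral_at f mu0 S v T g | v in [set: control V t0 T]]).
  by exists S.
apply: ge_ereal_sup => _ [v _ <-]; apply: le_trans (SJ v) _.
set vh := hold _ v.
have [_ _ QJ] := tQP (code P n vh).
have h2 : Lg * (flow_lip t1 * (2 * M * tau)) <= eta.
  by rewrite [X in Lg * X]mulrA mulrA; apply: le_trans dD; exact: ler_wpM2l.
apply: le_trans (leeD (QJ vh erefl (cut t1 v)) (leeD (_ : _ <= (eta + eta)%:E)%E (GB P vh))) _.
  by rewrite lee_fin lerD.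
by rewrite -!EFinD lee_fin; lra.
Qed.

End programming.
End cells.

Section dpp.
Variables (t0 t1 : R) (mu0 : probability ZT R).
Hypotheses (t01 : t0 < t1) (t1T : t1 <= T).
Hypothesis mu2 : finite_second_moment mu0.

Let t1I : (t0 <= t1 <= T)%R. Proof. by rewrite ltW. Qed.

Local Open Scope ereal_scope.

Lemma upper_value_ge0 t (mu : probability ZT R) : 0 <= upper_value T U V f g t mu.
Proof.
apply: le_ereal_inf_tmp => _ [P _ <-]; apply: le_ereal_sup_tmp.
exists (integral_at f mu P point T g); first by exists point.
by do 2 apply: integral_ge0 => ? _; rewrite lee_fin.
Qed.

Lemma dpp_nonneg : upper_value T U V f g t0 mu0 =
  ereal_inf [set ereal_sup
      [set upper_value T U V f g t1 (transported f t1 mu0 P v)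
        | v in [set: control V t0 T]]
    | P in @strategy R N p q T U V t0].
Proof.
apply/eqP; rewrite eq_le; apply/andP; split.
  apply: le_ereal_inf_tmp => _ [P sP <-].
  have [->|[a [-> Pa]]] := @sup_nonneg_cases R (control V t0 T)
    (fun v => upper_value T U V f g t1 (transported f t1 mu0 P v))
    (fun v => upper_value_ge0 _ _); first exact: leey.
  apply/lee_addgt0Pr => eta eta0.
  have eta7 : (0 < eta / 7)%R by rewrite divr_gt0.
  have [m [c [ctr [B [delta [e [[mc mB d0 near] [de Ge lB]]]]]]]] :=
    good_cells mu0 t1I eta7.
  have := dpp_le_cells mc mB d0 near t01 mu2 de Ge lB eta7 sP Pa.
  by rewrite -EFinD mulrCA mulfV// mulr1.
apply: le_ereal_inf_tmp => _ [P sP <-].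
have J0 (v : control V t0 T) : 0 <= integral_at f mu0 P v T g.
  by do 2 apply: integral_ge0 => ? _; rewrite lee_fin.
have [->|[a [-> Pa]]] := sup_nonneg_cases J0; first exact: leey.
apply: ge_ereal_inf; eexists; first by exists P.
apply: ge_ereal_sup => _ [v _ <-].
apply/lee_addgt0Pr => eta eta0.
have eta4 : (0 < eta / 4)%R by rewrite divr_gt0.
have [m [c [ctr [B [delta [e [[mc mB d0 near] [de Ge lB]]]]]]]] :=
  good_cells mu0 t1I eta4.
have := dpp_ge_cells mc mB d0 near t01 mu2 de Ge lB v sP Pa.
by rewrite -EFinD mulrCA mulfV// mulr1.
Qed.

End dpp.
End payoff.
End game.

Theorem proposition3p1 (R : realType) (N p q : nat) (T : R)
  (U : control_set R p) (V : control_set R q)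
  (f : 'rV[R]_N -> 'rV[R]_p -> 'rV[R]_q -> 'rV[R]_N) (g : 'rV[R]_N -> R)
  (T_gt0 : 0 < T)
  (f_bounded : exists M : R,
     forall x u v, control_values U u -> control_values V v -> `|f x u v| <= M)
  (f_unif_continuous : forall e : R, 0 < e -> exists2 d : R, 0 < d &
     forall x x' u u' v v', control_values U u -> control_values U u' ->
       control_values V v -> control_values V v' ->
       `|x - x'| < d -> `|u - u'| < d -> `|v - v'| < d ->
       `|f x u v - f x' u' v'| < e)
  (f_lipschitz : exists K : R,
     forall u v, control_values U u -> control_values V v ->
       K.-lipschitz (fun x => f x u v))
  (g_bounded : bounded_fun g)
  (g_lipschitz : lipschitz g)
  (t0 t1 : R) (t0_ge0 : 0 <= t0) (t0_lt_T : t0 < T)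
  (t0_lt_t1 : t0 < t1) (t1_le_T : t1 <= T)
  (mu0 : probability (borelType 'rV[R]_N) R)
  (mu0_W : finite_second_moment mu0) :
  upper_value T U V f g t0 mu0 =
  ereal_inf [set ereal_sup
      [set upper_value T U V f g t1 (transported f t1 mu0 P v)
        | v in [set: control V t0 T]]
    | P in @strategy R N p q T U V t0].
Proof.
have [M0 fM0] := f_bounded; have [K0 fK0] := f_lipschitz.
pose M := `|M0|; pose K := `|K0| + 1.
have M_ge0 : 0 <= M by exact: normr_ge0.
have K_gt0 : 0 < K by rewrite ltr_wpDl.
have fM x u v : control_values U u -> control_values V v -> `|f x u v| <= M.
  by move=> Uu Vv; apply: le_trans (fM0 x u v Uu Vv) _; exact: ler_norm.
have fK u v : control_values U u -> control_values V v ->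
    forall x y, `|f x u v - f y u v| <= K * `|x - y|.
  move=> Uu Vv x y; have := fK0 u v Uu Vv (x, y) (conj Logic.I Logic.I).
  move=> /= /le_trans; apply; rewrite ler_wpM2r//.
  by apply: le_trans (ler_norm _) _; rewrite lerDl.
have [b0 [_ gb0]] := g_bounded; pose b := `|b0| + 1.
have gb x : `|g x| <= b.
  by apply: gb0 => //; rewrite (le_lt_trans (ler_norm b0))// ltrDl.
have [Lg Lg0 gL] : exists2 Lg, 0 <= Lg & forall x y, `|g x - g y| <= Lg * `|x - y|.
  have [L0 [_ gL0]] := g_lipschitz; exists (`|L0| + 1); first by rewrite addr_ge0.
  move=> x y; apply: (gL0 _ _ (x, y) _) => //.
  by rewrite (le_lt_trans (ler_norm L0))// ltrDl.
have mg : measurable_fun setT (g : borelType 'rV[R]_N -> measurableTypeR R).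
  exact: measurable_g Lg0 gL.
(* The transported measures do not involve g, so that adding b shifts both sides
   of the equality by b. *)
pose h x := g x + b.
have h0 x : 0 <= h x by have := gb x; rewrite ler_norml /h => /andP[? _]; lra.
have hG x : h x <= b + b by have := gb x; rewrite ler_norml /h lerD2r => /andP[].
have hL x y : `|h x - h y| <= Lg * `|x - y|.
  by rewrite /h opprD addrACA subrr addr0.
have vhE t mu : t <= T ->
    upper_value T U V f h t mu = (upper_value T U V f g t mu + b%:E)%E.
  exact: (upper_value_shift M_ge0 K_gt0 fM fK f_unif_continuous b mu mg gb).
pose S := @strategy R N p q T U V t0.
pose F k (P : R.-pker (borelType 'rV[R]_N * borelType (control V t0 T)) ~>
    borelType (control U t0 T)) := ereal_sup [set upper_value T U V f k t1 (transported f t1 mu0 P v)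
  | v in [set: control V t0 T]].
have FE P : S P -> F h P = (F g P + b%:E)%E.
  move=> _; rewrite /F -ereal_sup_shift; congr ereal_sup.
  apply: eq_imagel => v _; exact: vhE.
have infE : ereal_inf [set F h P | P in S] = (ereal_inf [set F g P | P in S] + b%:E)%E.
  rewrite -ereal_inf_shift; congr ereal_inf; apply: eq_imagel => P; exact: FE.
have hE : upper_value T U V f h t0 mu0 = ereal_inf [set F h P | P in S] :=
  dpp_nonneg M_ge0 K_gt0 fM fK f_unif_continuous h0 hG Lg0 hL t0_lt_t1 t1_le_T mu0_W.
have gE := etrans (esym (vhE t0 mu0 (ltW t0_lt_T))) (etrans hE infE).
have bfin : b%:E \is a fin_num by [].
exact: (etrans (esym (addeK _ bfin))
  (etrans (congr1 (fun y => y - b%:E)%E gE) (addeK _ bfin))).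
Qed.
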